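(* Let $n\ge 1$, and let $\sigma_j,\tau_j$ ($1\le j\le n$) and $\theta_{j\alpha}$ ($1\le\alpha\le j\le n-1$) be complex numbers such that $$\operatorname{Re}\theta_{j\alpha}>0,\qquad \operatorname{Re}\Bigl\{\sigma_j+\tau_j-1-\sum_{\alpha=1}^{j-1}\theta_{(j-1)\alpha}\Bigr\}>0$$ for all admissible indices. Then the following integral over the space $\mathcal R_n(-\infty,\infty)$ of Rayleigh triangles converges absolutely and $$\int_{\mathcal R_n(-\infty,\infty)}\ \prod_{j=1}^{n-1}\prod_{\alpha=1}^{j}(1+i\lambda_{j\alpha})^{-\sigma_j+\sigma_{j+1}-\theta_{j\alpha}}(1-i\lambda_{j\alpha})^{-\tau_j+\tau_{j+1}-\theta_{j\alpha}}\cdot\prod_{p=1}^{n}(1+i\lambda_{np})^{-\sigma_n}(1-i\lambda_{np})^{-\tau_n}$$ $$\times\prod_{j=1}^{n-1}\frac{\prod_{1\le\alpha\le j,\,1\le p\le j+1}|\lambda_{j\alpha}-\lambda_{(j+1)p}|^{\theta_{j\alpha}-1}}{\prod_{1\le\alpha<\beta\le j}(\lambda_{j\beta}-\lambda_{j\alpha})^{\theta_{j\alpha}+\theta_{j\beta}-2}}\cdot\prod_{1\le p<q\le n}(\lambda_{nq}-\lambda_{np})\,d\mathcal L$$ $$=\pi^{n}\,2^{2n-\sum_{j=1}^n(\sigma_j+\tau_j)}\prod_{1\le\alpha\le j\le n-1}\Gamma(\theta_{j\alpha})\cdot\prod_{j=1}^{n}\frac{\Gamma\bigl(\sigma_j+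\tau_j-1-\sum_{\alpha=1}^{j-1}\theta_{(j-1)\alpha}\bigr)}{\Gamma(\sigma_j)\Gamma(\tau_j)}.$$
   Context: A Rayleigh triangle $\mathcal L$ of size $n$ is a collection of $n(n+1)/2$ real numbers $\lambda_{jk}$, $1\le k\le j\le n$, satisfying $\lambda_{(j+1)k}\le\lambda_{jk}\le\lambda_{(j+1)(k+1)}$ for all $1\le k\le j\le n-1$. $\mathcal R_n(-\infty,\infty)$ is the set of all Rayleigh triangles of size $n$, and $d\mathcal L=\prod_{1\le\alpha\le j\le n}d\lambda_{j\alpha}$ is Lebesgue measure. $i$ is the imaginary unit; complex powers of numbers in the right half-plane are taken with the principal branch; $1/\Gamma$ is entire, being $0$ at the poles of $\Gamma$; empty sums are $0$ and empty products are $1$. *)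

(* Defs.v *)
From HB Require Import structures.
From mathcomp Require Import all_boot all_order all_algebra.
From mathcomp Require Import complex.
From mathcomp Require Import lra.
From mathcomp Require Import all_classical all_reals all_analysis.
Set Implicit Arguments.
Unset Strict Implicit.
Unset Printing Implicit Defensive.
Import Order.TTheory GRing.Theory Num.Theory.
Import numFieldNormedType.Exports.
Local Open Scope classical_set_scope.
Local Open Scope ring_scope.
Local Open Scope complex_scope.

(* Lebesgue measure on R^N, with N-tuples as points: R^0 carries the unit mass,
   and R^(N+1) the image of the product measure under R * R^N -> R^(N+1). *)
Definition tuple_of_pair (T : Type) (N : nat) (x : T * N.-tuple T) :
  N.+1.-tuple T := [the N.+1.-tuple T of x.1 :: x.2].

Lemma measurable_tuple_of_pair d (T : measurableType d) (N : nat) :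
  measurable_fun [set: T * N.-tuple T] (@tuple_of_pair T N).
Proof. by apply: measurable_cons. Qed.

Section tuple_lebesgue_succ.
Context (R : realType) (N : nat).
Local Notation TR := (measurableTypeR R).
Variable mu : {sigma_finite_measure set (N.-tuple TR) -> \bar R}.

Definition tuple_lebesgue_succ : set (N.+1.-tuple TR) -> \bar R :=
  pushforward (@lebesgue_measure R \x mu)%E (@tuple_of_pair TR N).

Let nu0 : tuple_lebesgue_succ set0 = 0%E.
Proof. by rewrite /tuple_lebesgue_succ /pushforward preimage_set0 measure0. Qed.

Let nu_ge0 A : (0 <= tuple_lebesgue_succ A)%E.
Proof. by rewrite /tuple_lebesgue_succ /pushforward measure_ge0. Qed.

Let nu_sigma_additive : semi_sigma_additive tuple_lebesgue_succ.
Proof.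
have mf := @measurable_tuple_of_pair _ TR N.
move=> F mF tF mUF; rewrite /tuple_lebesgue_succ /pushforward preimage_bigcup.
apply: measure_semi_sigma_additive.
- by move=> n; rewrite -[X in measurable X]setTI; exact: mf.
- apply/trivIsetP => /= i j _ _ ij; rewrite -preimage_setI.
  by move/trivIsetP : tF => /(_ _ _ _ _ ij) ->//; rewrite preimage_set0.
- by rewrite -preimage_bigcup -[X in measurable X]setTI; exact: mf.
Qed.

HB.instance Definition _ :=
  isMeasure.Build _ _ _ tuple_lebesgue_succ nu0 nu_ge0 nu_sigma_additive.

Let nu_sigma_finite : sigma_finite setT tuple_lebesgue_succ.
Proof.
pose g (t : N.+1.-tuple TR) : TR * N.-tuple TR := (thead t, [tuple of behead t]).
have gK : cancel (@tuple_of_pair TR N) g.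
  by move=> [x t]; rewrite /g /tuple_of_pair theadE; congr pair; exact: val_inj.
have mg : measurable_fun setT g.
  apply: measurable_fun_pair; first exact: measurable_tnth.
  exact: measurable_behead.
have /sigma_finiteP[F [TF ndF Foo]] := sigma_finiteT (@lebesgue_measure R).
have /sigma_finiteP[G [TG ndG Goo]] := sigma_finiteT mu.
exists (fun k => g @^-1` (F k `*` G k)).
  rewrite -preimage_bigcup; apply/seteqP; split => // t _ /=.
  have [n _ Fn] : (\bigcup_i F i) (g t).1 by rewrite -TF.
  have [k _ Gk] : (\bigcup_i G i) (g t).2 by rewrite -TG.
  exists (maxn n k) => //; split.
  - by move: Fn; exact/subsetPset/ndF/leq_maxl.
  - by move: Gk; exact/subsetPset/ndG/leq_maxr.
move=> k; have [mF Fk] := Foo k; have [mG Gk] := Goo k; split.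
  by rewrite -[X in measurable X]setTI; apply: mg => //; exact: measurableX.
rewrite /tuple_lebesgue_succ /pushforward.
rewrite (_ : _ @^-1` _ = F k `*` G k); last first.
  by apply/seteqP; split => x; rewrite /preimage /mkset gK.
by rewrite product_measure1E// lte_mul_pinfty// ge0_fin_numE.
Qed.

HB.instance Definition _ :=
  Measure_isSigmaFinite.Build _ _ _ tuple_lebesgue_succ nu_sigma_finite.
End tuple_lebesgue_succ.

Fixpoint tuple_lebesgue (R : realType) (N : nat) :
    {sigma_finite_measure set (N.-tuple (measurableTypeR R)) -> \bar R} :=
  match N return
    {sigma_finite_measure set (N.-tuple (measurableTypeR R)) -> \bar R} with
  | 0 => \d_([tuple])
  | N'.+1 => tuple_lebesgue_succ (tuple_lebesgue R N')
  end.

Section complex_functions.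
Context (R : realType).
Implicit Types z s : R[i].

Definition cexp z : R[i] :=
  (expR (complex.Re z) * cos (complex.Im z)) +i*
  (expR (complex.Re z) * sin (complex.Im z)).

(* The principal logarithm on the right half-plane Re z > 0, the only place
   where it is used; the value elsewhere is irrelevant. *)
Definition cln z : R[i] :=
  ln (Normc.normc z) +i* atan (complex.Im z / complex.Re z).

(* 0 ^ s follows the convention of powR; vanishing bases only occur on a null
   set of the integrals below. *)
Definition cpow z s : R[i] :=
  if z == 0 then (s == 0)%:R else cexp (s * cln z).
End complex_functions.

Section complex_integral.
Context d (T : measurableType d) (R : realType).
Variables (mu : {measure set T -> \bar R}) (D : set T) (f : T -> R[i]).

Definition abs_convergent : Prop :=
  [/\ measurable_fun D (fun x => complex.Re (f x)),
      measurable_fun D (fun x => complex.Im (f x)) &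
      (\int[mu]_(x in D) (Normc.normc (f x))%:E < +oo)%E].

Definition cintegral : R[i] :=
  (\int[mu]_(x in D) complex.Re (f x)) +i* (\int[mu]_(x in D) complex.Im (f x)).
End complex_integral.

Section complex_gamma.
Context (R : realType).
Implicit Types z : R[i].

Definition euler_integral z : R[i] :=
  cintegral (@lebesgue_measure R) `]0, +oo[
    (fun t : R => cpow t%:C (z - 1) * (expR (- t))%:C).

(* Euler's integral for Re z > 0 (then m = 0), continued to the whole plane by
   Gamma z = Gamma (z + m) / (z (z + 1) ... (z + m - 1)), where m is the least
   natural number such that Re z + m > 0. At a pole, division by zero makes
   Gamma z = 0, so that (Gamma z)^-1 is the entire function 1/Gamma, zeros
   included. *)
Definition Gamma z : R[i] :=
  let m := Num.truncn (1 - complex.Re z) in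
  euler_integral (z + m%:R) / \prod_(0 <= k < m) (z + k%:R).

Lemma Gamma_euler z : 0 < complex.Re z -> Gamma z = euler_integral z.
Proof.
move=> z0; rewrite /Gamma; have /eqP -> : Num.truncn (1 - complex.Re z) == 0%N.
  by rewrite -leqn0 truncn_le_nat; lra.
by rewrite big_geq// addr0 divr1.
Qed.

Lemma Gamma_pole (k : nat) : (Gamma (- k%:R : R[i]))^-1 = 0.
Proof.
rewrite /Gamma; set m := Num.truncn _.
have km : (k < m)%N.
  have ReE j : complex.Re (j%:R : R[i]) = j%:R.
    by elim: j => // j IH; rewrite -!natr1 -IH; case: (j%:R : R[i]).
  have ReN (w : R[i]) : complex.Re (- w) = - complex.Re w by case: w.
  by rewrite /m truncn_gt_nat ReN ReE opprK -natr1 addrC.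
rewrite (bigD1_seq k) ?iota_uniq ?mem_index_iota//=.
by rewrite addNr mul0r invr0 mulr0 invr0.
Qed.
End complex_gamma.

(* The n(n+1)/2 entries of a triangle, stored row after row; 'C(j, 2) is the
   total length of the rows before row j. Indices start at 1 as on paper:
   entry l j k is lambda_{jk} for 1 <= k <= j <= n. *)
Notation triangle R n := ('C(n.+1, 2).-tuple (measurableTypeR R)).

Definition entry (R : realType) (n : nat) (l : triangle R n) (j k : nat) : R :=
  nth (0 : R) l ('C(j, 2) + k.-1)%N.

Definition Rayleigh (R : realType) (n : nat) : set (triangle R n) :=
  [set l | forall j k : nat, (1 <= k <= j)%N -> (j <= n.-1)%N ->
     entry l j.+1 k <= entry l j k <= entry l j.+1 k.+1].

Definition rayleigh_integrand (R : realType) (n : nat)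
    (sigma tau : nat -> R[i]) (theta : nat -> nat -> R[i]) (l : triangle R n) :
    R[i] :=
  let lam j k : R := entry l j k in
  let u x : R[i] := 1 +i* x in
  let v x : R[i] := 1 -i* x in
  (\prod_(1 <= j < n) \prod_(1 <= a < j.+1)
     (cpow (u (lam j a)) (- sigma j + sigma j.+1 - theta j a) *
      cpow (v (lam j a)) (- tau j + tau j.+1 - theta j a))) *
  (\prod_(1 <= p < n.+1)
     (cpow (u (lam n p)) (- sigma n) * cpow (v (lam n p)) (- tau n))) *
  (\prod_(1 <= j < n)
     ((\prod_(1 <= a < j.+1) \prod_(1 <= p < j.+2)
         cpow (`|lam j a - lam j.+1 p|%:C) (theta j a - 1)) /
      (\prod_(1 <= b < j.+1) \prod_(1 <= a < b)
         cpow ((lam j b - lam j a)%:C) (theta j a + theta j b - 2)))) *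
  (\prod_(1 <= q < n.+1) \prod_(1 <= p < q) (lam n q - lam n p)%:C).

(* Main.v *)
Require Import Defs.
From HB Require Import structures.
From mathcomp Require Import all_boot all_order all_algebra.
From mathcomp Require Import complex ring lra zify.
From mathcomp Require Import all_classical all_reals all_analysis measurable_realfun.
Set Implicit Arguments.
Unset Strict Implicit.
Unset Printing Implicit Defensive.
Import Order.TTheory GRing.Theory Num.Theory.
Import numFieldNormedType.Exports.
Local Open Scope classical_set_scope.
Local Open Scope ring_scope.
Local Open Scope complex_scope.

(** The rows are integrated out one after another, starting with the last one.

    For fixed [a_1 < ... < a_m], the rows [x] interlacing [a] are parametrised by
    the partial fractions [\prod (t - x_p) / \prod (t - a_j) =
    t - c - \sum w_j / (t - a_j)], where [c] is real and all [w_j > 0]. The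
    Jacobian is a quotient of two Vandermonde products; it is found by peeling off
    the first entry of [x], which costs one substitution in one variable.

    Put [v_j = w_j / (1 + a_j^2)], [A = 1 + \sum v_j], [y = (c - \sum v_j a_j) / A].
    Evaluation at [t = i] gives
    [\prod (1 + i x_p) = \prod (1 + i a_j) * A (1 + i y)], so the integral over [x]
    separates into Cauchy's integral [C (s, t)] of [(1 + i y)^-s (1 - i y)^-t] and a
    Dirichlet integral over [v], and what is left of [a] is exactly the integrand of
    the smaller triangle.

    Cauchy's integral is compared with Euler's beta integral [B]: both satisfy
    first-order recursions, by which [(s + t - 1) C (s, t) B (s, t)] is divided by
    [4] under [(s, t) -> (s + 1, t + 1)]. Laplace's method gives the limit of the
    quotient by its value at [(1, 1)], whence it equals [pi 2^(2 - s - t)]. *)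

(** Three obstacles shape the proof. (1) The exponents are complex, so an identity between products
    may be raised to a power only while arguments stay in the principal strip. The alternating sum
    of arctangents along two interlacing rows stays in []-pi/2, pi/2[], which turns the identity at
    [t = i] into one of logarithms; hence products of powers are written as [cexp] of sums of
    logarithms. (2) Iterated integration needs absolute convergence at every stage. The substitution
    removes the fixed row also after passing to the modulus, so the norm of the integral over one
    row is a constant, and norms multiply from row to row. (3) At first [Gamma] is known to be
    nonzero only on the positive axis. Identities are therefore kept in multiplied form, and the
    product formula itself, applied to conjugate parameters, later yields [Gamma s != 0] for
    [Re s >= 1]; recursion then reaches the parameters where [1 / Gamma] may vanish. Changes of
    variables are proved for nonnegative functions, as equalities of measures, and carried over to
    complex integrands through positive and negative parts. *)

Local Notation Re := complex.Re.
Local Notation Im := complex.Im.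
Local Notation normc := Normc.normc.

(** * Change of variables for nonnegative integrands *)

Section pushforward_density.
Context d d' (T : measurableType d) (Y : measurableType d') (R : realType).
Variables (mu : {measure set T -> \bar R}) (Phi : T -> Y) (J : T -> R).
Hypotheses (mPhi : measurable_fun setT Phi)
  (J0 : forall x, 0 <= J x) (mJ : measurable_fun setT J).
Local Open Scope ereal_scope.

(** The image under [Phi] of the measure with density [J]. Viewing one side of a change of variables
    as a measure reduces the formula to a comparison on intervals. The hypotheses are arguments so
    that the measure structure can be attached to the term. *)
Definition pushforward_density of measurable_fun setT Phi
    & (forall x, (0 <= J x)%R) & measurable_fun setT J :=
  fun A : set Y => \int[mu]_(x in Phi @^-1` A) (J x)%:E.

Local Notation den := (pushforward_density mPhi J0 mJ).

Let mPre A : measurable A -> measurable (Phi @^-1` A).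
Proof. by move=> mA; rewrite -[X in measurable X]setTI; exact: mPhi. Qed.

Let den0 : den set0 = 0.
Proof. by rewrite /pushforward_density preimage_set0 integral_set0. Qed.

Let den_ge0 A : 0 <= den A.
Proof. by rewrite /pushforward_density integral_ge0// => x _; rewrite lee_fin. Qed.

Let den_sigma_additive : semi_sigma_additive den.
Proof.
move=> /= F mF tF mUF; rewrite /pushforward_density; apply: cvg_toP.
  apply: ereal_nondecreasing_is_cvgn => m n mn.
  apply: lee_sum_nneg_natr => // k _ _; apply: integral_ge0 => /= x Fkx.
  by rewrite lee_fin.
rewrite preimage_bigcup ge0_integral_bigcup//=.
- by move=> k; exact: mPre.
- by apply: measurable_funTS; exact/measurable_EFinP.
- by move=> x _; rewrite lee_fin.
- apply/trivIsetP => /= i j _ _ ij; rewrite -preimage_setI.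
  by move/trivIsetP : tF => /(_ _ _ _ _ ij) ->//; rewrite preimage_set0.
Qed.

HB.instance Definition _ :=
  isMeasure.Build _ _ _ den den0 den_ge0 den_sigma_additive.

Import HBNNSimple.

(** Both sides are continuous along increasing sequences, so simple functions suffice, and by
    linearity indicators, for which the identity is the definition of the measure. *)
Lemma ge0_integral_pushforward_density (f : Y -> \bar R) :
  measurable_fun setT f -> (forall x, 0 <= f x) ->
  \int[den]_x f x = \int[mu]_x (f (Phi x) * (J x)%:E).
Proof.
move=> mf f0; pose h := nnsfun_approx measurableT mf.
have mhP n : measurable_fun setT (fun x => (h n (Phi x))%:E).
  by apply/measurable_EFinP; exact: measurableT_comp.
have -> : \int[den]_x f x = lim (\int[den]_x (EFin \o h n) x @[n --> \oo]).
  have fE x : f x = lim ((EFin \o h n) x @[n --> \oo]).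
    by apply/esym/cvg_lim => //; exact: cvg_nnsfun_approx.
  under eq_integral do rewrite fE.
  apply: monotone_convergence => //.
  - by move=> n; exact/measurable_EFinP.
  - by move=> n x _ //=; rewrite lee_fin.
  - by move=> x _ a b ab; rewrite lee_fin; exact/lefP/nd_nnsfun_approx.
have -> : \int[mu]_x (f (Phi x) * (J x)%:E) =
    lim (\int[mu]_x ((EFin \o h n) (Phi x) * (J x)%:E) @[n --> \oo]).
  have fJ x : f (Phi x) * (J x)%:E =
      lim ((EFin \o h n) (Phi x) * (J x)%:E @[n --> \oo]).
    by apply/esym/cvg_lim => //; apply: cvgeZr => //; exact: cvg_nnsfun_approx.
  under eq_integral do rewrite fJ.
  apply: monotone_convergence => [//| | |].
  - move=> n; apply: emeasurable_funM; [exact: mhP|exact/measurable_EFinP].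
  - by move=> n x _ /=; rewrite mule_ge0 ?lee_fin.
  - by move=> x _ a b ab/=; rewrite lee_wpmul2r ?lee_fin//; exact/lefP/nd_nnsfun_approx.
suff suf n : \int[mu]_x ((EFin \o h n) (Phi x) * (J x)%:E) =
    \int[den]_x (EFin \o h n) x.
  by under eq_fun do rewrite -suf.
transitivity (\int[den]_x
   (\sum_(y \in range (h n)) (y * \1_(h n @^-1` [set y]) x)%:E)); last first.
  by apply: eq_integral => t _; rewrite /= fimfunE -fsumEFin.
have indich m r : measurable_fun setT (fun x => (r * \1_(h m @^-1` [set r]) x)%:E).
  by apply: (measurable_comp measurableT) => //; exact: measurable_funM.
rewrite ge0_integral_fsum//; last by move=> m y _; exact: nnfun_muleindic_ge0.
transitivity (\int[mu]_x (\sum_(y \in range (h n))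
    (y * \1_(h n @^-1` [set y]) (Phi x))%:E * (J x)%:E)).
  under [RHS]eq_integral => x xE.
    rewrite -ge0_mule_fsuml => [|y]; last exact: nnfun_muleindic_ge0.
    rewrite fsumEFin // -(fimfunE _ (Phi x)); over.
  by [].
have mind r : measurable_fun setT (fun x => (\1_(h n @^-1` [set r]) (Phi x) : R)).
  exact: measurableT_comp.
rewrite ge0_integral_fsum//; last 2 first.
  - move=> y; apply: emeasurable_funM; last exact/measurable_EFinP.
    by apply/measurable_EFinP; exact: measurable_funM.
  - by move=> m y _; apply: mule_ge0; [exact: nnfun_muleindic_ge0|rewrite lee_fin].
apply: eq_fsbigr => r rhn.
under [RHS]eq_integral do rewrite EFinM.
rewrite integralZl_indic_nnsfun => //.
under eq_integral do rewrite EFinM -muleA.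
rewrite ge0_integralZl//.
- under eq_integral do rewrite muleC.
  rewrite (eq_integral ((EFin \o J) \_ (Phi @^-1` (h n @^-1` [set r])))); last first.
    by move=> x xE; rewrite epatch_indic.
  by rewrite -integral_mkcondr setTI integral_indic// setIT.
- by apply: emeasurable_funM; exact/measurable_EFinP.
- by move=> t Et; rewrite mule_ge0 ?lee_fin.
- by move: rhn; rewrite inE => -[t _ <-]; rewrite lee_fin.
Qed.

End pushforward_density.

(** * Substitution in one variable, for increasing functions on an interval *)

Section substitution.
Context (R : realType).
Local Notation TR := (measurableTypeR R).
Local Notation leb := (@lebesgue_measure R).
Variables (F f : R -> R) (I : interval R).
Hypotheses (mF : measurable_fun [set: TR] (F : TR -> TR))
  (mf : measurable_fun [set: TR] (f : TR -> TR)).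
Hypothesis dF : forall x, x \in I -> is_derive x 1 F (f x).
Hypothesis cf : forall x, x \in I -> {for x, continuous f}.
Hypothesis f_gt0 : forall x, x \in I -> 0 < f x.

Let fI (x : R) := f x * (x \in I)%:R.

Let fI0 x : 0 <= fI x.
Proof.
rewrite /fI; case: (boolP (x \in I)) => [/f_gt0/ltW|]; last by rewrite mulr0.
by rewrite mulr1.
Qed.

Let mI (J : interval R) : measurable_fun [set: TR] (fun x : TR => (x \in J)%:R : TR).
Proof.
have -> : (fun x : TR => (x \in J)%:R : TR) = \1_[set` J].
  by apply/funext => x; rewrite indicE; congr (_%:R); congr nat_of_bool;
    apply/idP/idP; rewrite inE.
by apply: measurable_indic; exact: measurable_itv.
Qed.

Let mfI : measurable_fun [set: TR] (fI : TR -> TR).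
Proof. by apply: measurable_funM => //; exact: mI. Qed.

Let IJ (J : interval R) (x : R) : 0 <= (x \in J)%:R :> R.
Proof. exact: ler0n. Qed.

Let incF x y : x \in I -> y \in I -> x < y -> F x < F y.
Proof.
move=> xI yI xy.
have sub z : x <= z <= y -> z \in I.
  move=> /andP[xz zy]; have /= := (@interval_is_interval _ I) x y.
  by apply => //; rewrite xz zy.
have [||c cxy] := @MVT _ F f x y xy.
- by move=> z zxy; apply: dF; apply: sub; move: zxy; rewrite in_itv /= => /andP[/ltW -> /ltW ->].
- apply: derivable_within_continuous => z; rewrite in_itv/= => zxy.
  by have := dF (sub _ zxy); case.
move=> e; rewrite -subr_gt0 e mulr_gt0 ?subr_gt0// f_gt0//; apply: sub.
by move: cxy; rewrite in_itv/= => /andP[/ltW -> /ltW ->].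
Qed.

Let core x y : x \in I -> y \in I -> x < y ->
  (\int[leb]_z ((\1_(`]F x, F y]%classic) (F z))%:E * (fI z)%:E) =
   (F y - F x)%:E)%E.
Proof.
move=> xI yI xy.
have sub z : x <= z <= y -> z \in I.
  move=> /andP[xz zy]; have /= := (@interval_is_interval _ I) x y.
  by apply => //; rewrite xz zy.
transitivity (\int[leb]_(z in `]x, y]%classic) (f z)%:E)%E.
  rewrite [RHS]integral_mkcond; apply: eq_integral => z _.
  rewrite patchE /fI indicE.
  case: (boolP (z \in I)) => zI; last first.
    rewrite mulr0 mule0 ifF//; apply/negP; rewrite inE/= in_itv/= => /andP[h1 h2].
    by move/negP: zI; apply; apply: sub; rewrite h2 ltW.
  have -> : (F z \in `]F x, F y]%classic) = (z \in `]x, y]%classic).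
    have mono a b : a \in I -> b \in I -> (F a < F b) = (a < b).
      move=> aI bI; apply/idP/idP; last exact: incF.
      by apply: contraTT; rewrite -!leNgt le_eqVlt => /predU1P[->//|/incF]; move=> /(_ bI aI)/ltW.
    apply/idP/idP; rewrite !inE/= !in_itv/= mono// => /andP[-> ].
      by rewrite !leNgt mono.
    by rewrite !leNgt mono.
  by case: ifPn => _; rewrite ?mulr1 ?mul1e ?mul0e.
rewrite integral_itv_obnd_cbnd//; last first.
  by apply: measurableT_comp => //; exact: measurable_funTS.
rewrite (@continuous_FTC2 _ f F)//.
- apply: continuous_in_subspaceT => z; rewrite inE/= in_itv/= => zxy.
  by apply: cf; exact: sub.
- have dc z : x <= z <= y -> {for z, continuous F}.
    move=> zxy; apply: differentiable_continuous; apply/derivable1_diffP.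
    by have := dF (sub _ zxy); case.
  split.
  + move=> z; rewrite in_itv/= => /andP[/ltW xz /ltW zy].
    have zI : z \in I by apply: sub; rewrite xz.
    by have [] := dF zI.
  + by apply: cvg_at_right_filter; apply: dc; rewrite lexx ltW.
  + by apply: cvg_at_left_filter; apply: dc; rewrite lexx ltW.
- move=> z; rewrite in_itv/= => /andP[/ltW xz /ltW zy].
  have zI : z \in I by apply: sub; rewrite xz.
  by rewrite derive1E; have [_ ->] := dF zI.
Qed.



Let n1 : {measure set TR -> \bar R} := pushforward_density leb mF fI0 mfI.

Let mid : measurable_fun [set: TR] (@id TR). Proof. exact: measurable_id. Qed.

Let n2 (J : interval R) : {measure set TR -> \bar R} :=
  pushforward_density leb mid (@IJ J) (mI J).

Let n1E (A : set R) : n1 A = (\int[leb]_z ((\1_A (F z))%:E * (fI z)%:E))%E.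
Proof.
rewrite /n1/= /pushforward_density integral_mkcond; apply: eq_integral => z _.
by rewrite epatch_indic muleC.
Qed.

Let n2E (J : interval R) (A : set R) : measurable (A : set TR) ->
  n2 J A = leb (A `&` [set` J]).
Proof.
move=> mA; rewrite /n2/= /pushforward_density preimage_id.
transitivity (\int[leb]_(x in A) (\1_[set` J] x)%:E)%E.
  by apply: eq_integral => z _; rewrite indicE; congr (_%:R)%:E; congr nat_of_bool;
    apply/idP/idP; rewrite inE.
by rewrite integral_indic// setIC.
Qed.

(** Both measures give [v - u]: on the left by the fundamental theorem of calculus between preimages
    of the endpoints, which exist because [u] and [v] lie in [J]. *)
Lemma substitution_ocitv (J : interval R) (u v : R) :
  (forall y, y \in J -> exists2 x, x \in I & F x = y) ->
  u \in J -> v \in J -> n1 `]u, v]%classic = n2 J `]u, v]%classic.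
Proof.
move=> surj uJ vJ.
have [uv|vu] := ltP u v; last by rewrite set_itv_ge ?measure0// bnd_simp -leNgt.
have [x xI ux] := surj _ uJ; have [y yI vy] := surj _ vJ.
have xy : x < y.
  rewrite ltNge; apply: contraTN uv; rewrite le_eqVlt -ux -vy => /predU1P[->|].
    by rewrite ltxx.
  by move=> yx; rewrite -leNgt ltW// incF.
rewrite n1E -ux -vy core// n2E; last exact: measurable_itv.
rewrite setIidl; last first.
  move=> z/=; rewrite ux vy in_itv/= => /andP[uz zv].
  have /= := (@interval_is_interval _ J) u v.
  by apply => //; rewrite (ltW uz).
by rewrite lebesgue_measure_itv/= lte_fin incF// -EFinB.
Qed.

Let from_measures (J : interval R) :
  (forall u v, n1 `]u, v]%classic = n2 J `]u, v]%classic) ->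
  forall g : TR -> \bar R, measurable_fun setT g -> (forall x, 0 <= g x)%E ->
  (\int[leb]_x (g (F x) * (f x * (x \in I)%:R)%:E) =
   \int[leb]_x (g x * ((x \in J)%:R)%:E))%E.
Proof.
move=> h g mg g0.
rewrite -(ge0_integral_pushforward_density leb mF fI0 mfI)//.
rewrite -(ge0_integral_pushforward_density leb mid (@IJ J) (mI J))//.
apply: eq_measure_integral => A mA _.
rewrite -[LHS]/(n1 A) -[RHS]/(n2 J A).
(* Half-open intervals are stable under intersection, and []-k, k]] exhausts the line with finite
   mass for [n2 J], hence also for [n1]. *)
apply: (@measure_unique _ R TR (@ocitv R) (fun k => `]- k%:R, k%:R]%classic)
  erefl _ _ _ n1 (n2 J) _ _ _ mA) => //.
- exact: ocitvI.
- move=> i; exact: is_ocitv.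
- exact: bigcup_itvT.
- by move=> B [[u v] _ <-]; exact: h.
- move=> k; rewrite h n2E; last exact: measurable_itv.
  apply: le_lt_trans (_ : leb `](- k%:R)%R, k%:R]%classic < +oo)%E.
    apply: le_measure; rewrite ?inE; [|exact: measurable_itv|exact: subIsetl].
    by apply: measurableI; exact: measurable_itv.
  by rewrite lebesgue_measure_itv/=; case: ifPn => // _; rewrite -EFinB ltry.
Qed.

Lemma ge0_substitutionT (g : TR -> \bar R) :
  (forall y, exists2 x, x \in I & F x = y) ->
  measurable_fun setT g -> (forall x, 0 <= g x)%E ->
  (\int[leb]_x (g (F x) * (f x * (x \in I)%:R)%:E) = \int[leb]_x g x)%E.
Proof.
move=> surj mg g0; rewrite (@from_measures `]-oo, +oo[)//.
  by apply: eq_integral => x _; rewrite in_itv/= mule1.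
by move=> u v; apply: substitution_ocitv; rewrite ?in_itv.
Qed.

Lemma ge0_substitution_gt0 (g : TR -> \bar R) :
  (forall x, x \in I -> 0 < F x) ->
  (forall y, 0 < y -> exists2 x, x \in I & F x = y) ->
  measurable_fun setT g -> (forall x, 0 <= g x)%E ->
  (\int[leb]_x (g (F x) * (f x * (x \in I)%:R)%:E) =
   \int[leb]_x (g x * ((0 < x)%R%:R)%:E))%E.
Proof.
move=> F0 surj mg g0; rewrite (@from_measures `]0, +oo[)//.
  by apply: eq_integral => x _; rewrite in_itv/= andbT.
have surj' y : y \in `]0, +oo[ -> exists2 x, x \in I & F x = y.
  by rewrite in_itv/= andbT => /surj.
(* An interval []u, v]] with [u <= 0] has an endpoint outside []0, +oo[], for which surjectivity
   provides no preimage. Both measures vanish on []-oo, 0]], so continuity from below reduces the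
   claim to the intervals []1/(n+1), v]]. *)
have shrink (m : {measure set TR -> \bar R}) u v : u <= 0 ->
    m `]-oo, 0]%classic = 0%E ->
    m `]u, v]%classic = limn (fun n => m `](n.+1%:R^-1)%R, v]%classic).
  move=> u0 m0.
  have mcl : measurable (`]-oo, (0:R)]%classic : set TR) by exact: measurable_itv.
  have -> : m `]u, v]%classic = m (`]0%R, v]%classic : set TR).
    have [v0|v0] := leP v 0.
      rewrite [in RHS]set_itv_ge ?measure0 ?bnd_simp -?leNgt//.
      apply/eqP; rewrite eq_le measure_ge0 andbT -m0.
      apply: le_measure; rewrite ?inE; [exact: measurable_itv|exact: measurable_itv|].
      by move=> z/=; rewrite !in_itv/= => /andP[_ /le_trans]; apply.
    have -> : `]u, v]%classic = `]u, 0%R]%classic `|` (`]0%R, v]%classic : set R).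
      apply/seteqP; split => z /=; rewrite !in_itv/=.
        by move=> /andP[-> ->]; rewrite andbT/=; case: (ltP 0 z) => _; [right|left].
      by move=> [/andP[-> zl]|/andP[zg ->]]/=; [exact: le_trans zl (ltW v0)|rewrite (le_lt_trans u0)].
    have m00 : m (`]u, 0%R]%classic : set TR) = 0%E.
      apply/eqP; rewrite eq_le measure_ge0 andbT -m0.
      apply: le_measure; rewrite ?inE; [exact: measurable_itv|exact: measurable_itv|].
      by move=> z/=; rewrite !in_itv/= => /andP[].
    rewrite measureU; [by rewrite -[RHS]add0e; congr (_ + _)%E; exact: m00|exact: measurable_itv|exact: measurable_itv|].
    by apply/seteqP; split => // z [] /=; rewrite !in_itv/= => /andP[_ zl] /andP[/lt_le_trans] /(_ _ zl); rewrite ltxx.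
  apply/esym/cvg_lim => //.
  have -> : `]0%R, v]%classic = \bigcup_n `](n.+1%:R^-1)%R, v]%classic :> set R.
    apply/seteqP; split => z /=.
      rewrite in_itv/= => /andP[z0 zv].
      have [n nz] : exists n : nat, n.+1%:R^-1 < z.
        exists (Num.truncn z^-1); rewrite invf_plt ?posrE//.
        by rewrite truncnS_gt.
      by exists n => //=; rewrite in_itv/= nz.
    by move=> [n _ /=]; rewrite !in_itv/= => /andP[nz ->]; rewrite andbT (lt_trans _ nz)// invr_gt0.
  apply: nondecreasing_cvg_mu.
  - by move=> n; exact: measurable_itv.
  - by apply: bigcup_measurable => n _; exact: measurable_itv.
  - move=> n m' nm; apply/subsetPset => z /=; rewrite !in_itv/= => /andP[nz ->].
    by rewrite andbT (le_lt_trans _ nz)// lef_pV2 ?posrE// ler_nat.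
have n10 : n1 `]-oo, 0]%classic = 0%E.
  rewrite n1E; apply: integral0_eq => z _; rewrite /fI.
  case: (boolP (z \in I)) => [/F0 Fz|_]; last by rewrite mulr0 mule0.
  by rewrite indicE memNset/= ?mul0e// in_itv/= leNgt Fz.
have n20 : n2 `]0, +oo[ `]-oo, 0]%classic = 0%E.
  rewrite n2E; last exact: measurable_itv.
  rewrite (_ : _ `&` _ = set0) ?measure0//.
  by apply/seteqP; split => // z [] /=; rewrite !in_itv/= andbT leNgt => /negP.
move=> u v; have [u0|u0] := leP u 0; last first.
  have [uv|vu] := ltP u v; last by rewrite set_itv_ge ?measure0// bnd_simp -leNgt.
  by apply: substitution_ocitv => //; rewrite in_itv/= andbT// (lt_trans u0).
rewrite !shrink//; apply: congr_lim; apply/funext => n.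
have i0 : 0 < n.+1%:R^-1 :> R by rewrite invr_gt0.
have [uv|vu] := ltP n.+1%:R^-1 v; last by rewrite set_itv_ge ?measure0// bnd_simp -leNgt.
by apply: substitution_ocitv => //; rewrite in_itv/= andbT// (lt_trans i0).
Qed.

End substitution.

(** * Integrals of complex-valued functions *)

Section real_measurability.
Context d (T : measurableType d) (R : realType).
Implicit Types f : T -> R.

Lemma measurable_fun_inv f :
  measurable_fun setT f -> measurable_fun setT (fun x => (f x)^-1).
Proof.
move=> mf.
(* Inversion is not continuous at 0. Writing [1/x] as [x (x^2)^-1] leaves only a real power of a
   nonnegative base, and at 0 both sides are 0. *)
have -> : (fun x => (f x)^-1) = (fun x => f x * (f x ^+ 2) `^ (- 1)).
  apply/funext => x; rewrite powR_inv1 ?sqr_ge0//.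
  have [->|fx] := eqVneq (f x) 0; first by rewrite invr0 mul0r.
  by rewrite expr2 invfM mulVKf.
apply: measurable_funM => //; apply: (measurableT_comp (measurable_powR _)) => //.
exact: measurable_funX.
Qed.

Lemma measurable_fun_sqrtr f :
  measurable_fun setT f -> measurable_fun setT (fun x => Num.sqrt (f x)).
Proof.
move=> mf; apply: (measurableT_comp _ mf).
exact: (continuous_measurable_fun (@sqrt_continuous R)).
Qed.

Lemma measurable_fun_atan f :
  measurable_fun setT f -> measurable_fun setT (fun x => atan (f x)).
Proof.
move=> mf; apply: (measurableT_comp _ mf).
by apply: continuous_measurable_fun => x; exact: continuous_atan.
Qed.

Lemma measurable_fun_cos f :
  measurable_fun setT f -> measurable_fun setT (fun x => cos (f x)).
Proof.
move=> mf; apply: (measurableT_comp _ mf).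
by apply: continuous_measurable_fun => x; exact: continuous_cos.
Qed.

Lemma measurable_fun_sin f :
  measurable_fun setT f -> measurable_fun setT (fun x => sin (f x)).
Proof.
move=> mf; apply: (measurableT_comp _ mf).
by apply: continuous_measurable_fun => x; exact: continuous_sin.
Qed.
End real_measurability.

(** * Real part, imaginary part and modulus *)

Section complex_parts.
Context (R : realType).
Implicit Types z w : R[i].

Lemma ReD z w : Re (z + w) = Re z + Re w. Proof. by case: z w => ? ? []. Qed.
Lemma ImD z w : Im (z + w) = Im z + Im w. Proof. by case: z w => ? ? []. Qed.
Lemma ReN z : Re (- z) = - Re z. Proof. by case: z. Qed.
Lemma ImN z : Im (- z) = - Im z. Proof. by case: z. Qed.
Lemma ReB z w : Re (z - w) = Re z - Re w. Proof. by rewrite ReD ReN. Qed.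
Lemma ImB z w : Im (z - w) = Im z - Im w. Proof. by rewrite ImD ImN. Qed.
Lemma ReM z w : Re (z * w) = Re z * Re w - Im z * Im w.
Proof. by case: z w => ? ? []. Qed.
Lemma ImM z w : Im (z * w) = Re z * Im w + Im z * Re w.
Proof. by case: z w => ? ? []. Qed.
Lemma ReMl (x : R) w : Re (x%:C * w) = x * Re w.
Proof. by rewrite ReM /= mul0r subr0. Qed.
Lemma ImMl (x : R) w : Im (x%:C * w) = x * Im w.
Proof. by rewrite ImM /= mul0r addr0. Qed.

Lemma eqc z w : Re z = Re w -> Im z = Im w -> z = w.
Proof. by case: z w => a b [c e] /= -> ->. Qed.

Lemma Re_nat n : Re (n%:R : R[i]) = n%:R.
Proof. by elim: n => // n IH; rewrite -!natr1 ReD IH. Qed.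
Lemma Im_nat n : Im (n%:R : R[i]) = 0.
Proof. by elim: n => // n IH; rewrite -natr1 ImD IH addr0. Qed.

Lemma natC n : (n%:R : R)%:C = n%:R :> R[i].
Proof. by apply: eqc; rewrite ?Re_nat ?Im_nat. Qed.

Lemma Re_sum I (r : seq I) (P : pred I) (F : I -> R[i]) :
  Re (\sum_(i <- r | P i) F i) = \sum_(i <- r | P i) Re (F i).
Proof. by apply: (big_morph _ ReD). Qed.

Lemma normcR (x : R) : normc x%:C = `|x|.
Proof. by rewrite /= expr0n /= addr0 sqrtr_sqr. Qed.

Lemma normc_ge0 z : 0 <= normc z.
Proof. by case: z => a b /=; exact: sqrtr_ge0. Qed.

Lemma normcE_sqrt z : normc z = Num.sqrt (Re z ^+ 2 + Im z ^+ 2).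
Proof. by case: z. Qed.

Lemma Re_le_normc z : `|Re z| <= normc z.
Proof. by rewrite normcE_sqrt -sqrtr_sqr ler_wsqrtr// lerDl sqr_ge0. Qed.

Lemma Im_le_normc z : `|Im z| <= normc z.
Proof. by rewrite normcE_sqrt -sqrtr_sqr ler_wsqrtr// lerDr sqr_ge0. Qed.

Lemma normc_le z : normc z <= `|Re z| + `|Im z|.
Proof.
rewrite normcE_sqrt -[leRHS]ger0_norm ?addr_ge0// -sqrtr_sqr ler_wsqrtr//.
have := mulr_ge0 (normr_ge0 (Re z)) (normr_ge0 (Im z)).
by rewrite sqrrD !real_normK ?num_real// mulr2n; lra.
Qed.

Lemma normc_prod I (r : seq I) (P : pred I) (F : I -> R[i]) :
  normc (\prod_(i <- r | P i) F i) = \prod_(i <- r | P i) normc (F i).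
Proof. by apply: (big_morph _ (@Normc.normcM R)); exact: Normc.normc1. Qed.
End complex_parts.

Section complex_measurability.
Context d (T : measurableType d) (R : realType).
Implicit Types f g : T -> R[i].

Definition cmeas f :=
  measurable_fun setT (fun x => Re (f x)) /\
  measurable_fun setT (fun x => Im (f x)).

Lemma cmeas_cst (z : R[i]) : cmeas (fun=> z). Proof. by split. Qed.

Lemma cmeas_real (f : T -> R) : measurable_fun setT f -> cmeas (fun x => (f x)%:C).
Proof. by split. Qed.

Lemma cmeasD f g : cmeas f -> cmeas g -> cmeas (fun x => f x + g x).
Proof.
move=> [f1 f2] [g1 g2]; split.
  by under eq_fun do rewrite ReD; exact: measurable_funD.
by under eq_fun do rewrite ImD; exact: measurable_funD.
Qed.

Lemma cmeasM f g : cmeas f -> cmeas g -> cmeas (fun x => f x * g x).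
Proof.
move=> [f1 f2] [g1 g2]; split.
  under eq_fun do rewrite ReM.
  by apply: measurable_funB; exact: measurable_funM.
under eq_fun do rewrite ImM.
by apply: measurable_funD; exact: measurable_funM.
Qed.

Lemma cmeas_prod (I : Type) (r : seq I) (P : pred I) (F : I -> T -> R[i]) :
  (forall i, cmeas (F i)) -> cmeas (fun x => \prod_(i <- r | P i) F i x).
Proof.
move=> mF; elim: r => [|i r IH].
  by under eq_fun do rewrite big_nil; exact: cmeas_cst.
under eq_fun do rewrite big_cons.
by case: (P i) => //; exact: cmeasM.
Qed.

Lemma cmeas_normc f : cmeas f -> measurable_fun setT (fun x => normc (f x)).
Proof.
move=> [f1 f2]; under eq_fun do rewrite normcE_sqrt.
by apply: measurable_fun_sqrtr; apply: measurable_funD; exact: measurable_funX.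
Qed.

Lemma cmeasV f : cmeas f -> cmeas (fun x => (f x)^-1).
Proof.
move=> [f1 f2].
have mm : measurable_fun setT (fun x => (Re (f x) ^+ 2 + Im (f x) ^+ 2)^-1).
  by apply: measurable_fun_inv; apply: measurable_funD; exact: measurable_funX.
split.
  rewrite (_ : (fun _ => _) = (fun x => Re (f x) * (Re (f x) ^+ 2 + Im (f x) ^+ 2)^-1)).
    exact: measurable_funM.
  by apply/funext => x; case: (f x).
rewrite (_ : (fun _ => _) = (fun x => - (Im (f x) * (Re (f x) ^+ 2 + Im (f x) ^+ 2)^-1))).
  by apply: measurableT_comp => //; exact: measurable_funM.
by apply/funext => x; case: (f x).
Qed.

Lemma cmeas_cexp f : cmeas f -> cmeas (fun x => cexp (f x)).
Proof.
move=> [f1 f2]; split; apply: measurable_funM.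
- by apply: (measurableT_comp (@measurable_expR R)).
- exact: measurable_fun_cos.
- by apply: (measurableT_comp (@measurable_expR R)).
- exact: measurable_fun_sin.
Qed.

Lemma cmeas_cln f : cmeas f -> cmeas (fun x => cln (f x)).
Proof.
move=> mf; have [f1 f2] := mf; split.
  by apply: (measurableT_comp (@measurable_ln R)); exact: cmeas_normc.
apply: measurable_fun_atan; apply: measurable_funM => //.
exact: measurable_fun_inv.
Qed.

Lemma cmeas_if (b : T -> bool) f g : measurable_fun setT b ->
  cmeas f -> cmeas g -> cmeas (fun x => if b x then f x else g x).
Proof.
move=> mb [f1 f2] [g1 g2]; split.
  by under eq_fun do rewrite (fun_if (@complex.Re R)); exact: measurable_fun_ifT.
by under eq_fun do rewrite (fun_if (@complex.Im R)); exact: measurable_fun_ifT.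
Qed.

Lemma cmeas_cpow f (s : R[i]) : cmeas f -> cmeas (fun x => cpow (f x) s).
Proof.
move=> mf; rewrite /cpow; apply: cmeas_if.
- have [f1 f2] := mf.
  rewrite (_ : (fun _ => _) = (fun x => (Re (f x) == 0) && (Im (f x) == 0))).
    by apply: measurable_and; exact: measurable_fun_eqr.
  by apply/funext => x; case: (f x) => a b; rewrite eq_complex.
- exact: cmeas_cst.
- by apply: cmeas_cexp; apply: cmeasM; [exact: cmeas_cst|exact: cmeas_cln].
Qed.

End complex_measurability.

Lemma cmeas_comp d d' (T : measurableType d) (Y : measurableType d') (R : realType)
  (f : Y -> R[i]) (phi : T -> Y) :
  cmeas f -> measurable_fun setT phi -> cmeas (fun x => f (phi x)).
Proof. by move=> [f1 f2] mphi; split; [exact: (measurableT_comp f1)|exact: (measurableT_comp f2)]. Qed.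

(** * Absolutely convergent complex integrals and their transport *)

Section has_cint.
Context d (T : measurableType d) (R : realType).
Variable mu : {measure set T -> \bar R}.
Implicit Types (f g : T -> R[i]) (v w : R[i]).
Local Open Scope ereal_scope.

(** Measurability, absolute convergence and value in one proposition, so that linearity, Fubini and
    changes of variables transport all three together. *)
Definition has_cint f v := [/\ cmeas f, \int[mu]_x (normc (f x))%:E < +oo,
  \int[mu]_x (Re (f x))%:E = (Re v)%:E & \int[mu]_x (Im (f x))%:E = (Im v)%:E].

Lemma has_cint_integrable f v : has_cint f v ->
  mu.-integrable setT (fun x => (Re (f x))%:E) /\
  mu.-integrable setT (fun x => (Im (f x))%:E).
Proof.
move=> [[f1 f2] fi _ _]; split; apply/integrableP; split.
- exact/measurable_EFinP.
- apply: le_lt_trans fi; apply: ge0_le_integral => //=.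
  + by apply/measurable_EFinP; exact: measurableT_comp.
  + by apply/measurable_EFinP; exact: cmeas_normc.
  + by move=> x _; rewrite lee_fin; exact: Re_le_normc.
- exact/measurable_EFinP.
- apply: le_lt_trans fi; apply: ge0_le_integral => //=.
  + by apply/measurable_EFinP; exact: measurableT_comp.
  + by apply/measurable_EFinP; exact: cmeas_normc.
  + by move=> x _; rewrite lee_fin; exact: Im_le_normc.
Qed.

Lemma has_cint_uniq f v w : has_cint f v -> has_cint f w -> v = w.
Proof.
move=> [_ _ a b] [_ _ a' b']; apply: eqc.
  by move: a; rewrite a' => -[].
by move: b; rewrite b' => -[].
Qed.

Lemma has_cint_cintegral f v : has_cint f v -> cintegral mu setT f = v.
Proof. by move=> [_ _ a b]; apply: eqc; rewrite /cintegral/= /Rintegral ?a ?b. Qed.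

Lemma cmeas_has_cint f : cmeas f -> \int[mu]_x (normc (f x))%:E < +oo ->
  has_cint f (cintegral mu setT f).
Proof.
move=> mf fi.
suff [h1 h2] : \int[mu]_x (Re (f x))%:E \is a fin_num /\
               \int[mu]_x (Im (f x))%:E \is a fin_num.
  by split => //; rewrite /cintegral/= /Rintegral fineK.
have [f1 f2] := mf.
split; apply: integrable_fin_num => //; apply/integrableP; split.
- exact/measurable_EFinP.
- apply: le_lt_trans fi; apply: ge0_le_integral => //=.
  + by apply/measurable_EFinP; exact: measurableT_comp.
  + by apply/measurable_EFinP; exact: cmeas_normc.
  + by move=> x _; rewrite lee_fin; exact: Re_le_normc.
- exact/measurable_EFinP.
- apply: le_lt_trans fi; apply: ge0_le_integral => //=.
  + by apply/measurable_EFinP; exact: measurableT_comp.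
  + by apply/measurable_EFinP; exact: cmeas_normc.
  + by move=> x _; rewrite lee_fin; exact: Im_le_normc.
Qed.

Lemma has_cint_dominated f (h : T -> R) : cmeas f -> measurable_fun setT h ->
  (forall x, (normc (f x) <= h x)%R) -> \int[mu]_x (h x)%:E < +oo ->
  has_cint f (cintegral mu setT f).
Proof.
move=> mf mh fh hi; apply: cmeas_has_cint => //; apply: le_lt_trans hi.
apply: ge0_le_integral => //.
- by move=> x _; rewrite lee_fin normc_ge0.
- by apply/measurable_EFinP; exact: cmeas_normc.
- exact/measurable_EFinP.
- by move=> x _; rewrite lee_fin.
Qed.

Lemma has_cintD f g v w : has_cint f v -> has_cint g w ->
  has_cint (fun x => (f x + g x)%R) (v + w)%R.
Proof.
move=> hf hg; have [mf fi f1 f2] := hf; have [mg gi g1 g2] := hg.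
have [if1 if2] := has_cint_integrable hf.
have [ig1 ig2] := has_cint_integrable hg.
split; first exact: cmeasD.
- apply: (@le_lt_trans _ _ (\int[mu]_x ((normc (f x))%:E + (normc (g x))%:E))).
    apply: ge0_le_integral => //.
    + by move=> x _; rewrite lee_fin normc_ge0.
    + by apply/measurable_EFinP; apply: cmeas_normc; exact: cmeasD.
    + by apply: emeasurable_funD; apply/measurable_EFinP; exact: cmeas_normc.
    + by move=> x _; rewrite -EFinD lee_fin le_normcD.
  rewrite ge0_integralD//; first exact: lte_add_pinfty.
  + by move=> x _; rewrite lee_fin normc_ge0.
  + by apply/measurable_EFinP; exact: cmeas_normc.
  + by move=> x _; rewrite lee_fin normc_ge0.
  + by apply/measurable_EFinP; exact: cmeas_normc.
- under eq_integral do rewrite ReD EFinD.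
  by rewrite integralD// f1 g1 ReD.
- under eq_integral do rewrite ImD EFinD.
  by rewrite integralD// f2 g2 ImD.
Qed.

Lemma has_cintZ c f v : has_cint f v -> has_cint (fun x => (c * f x)%R) (c * v)%R.
Proof.
move=> hf; have [mf fi f1 f2] := hf.
have [if1 if2] := has_cint_integrable hf.
split; first by apply: cmeasM => //; exact: cmeas_cst.
- under eq_integral do rewrite Normc.normcM EFinM.
  rewrite ge0_integralZl_EFin ?normc_ge0//.
  + by rewrite lte_mul_pinfty// lee_fin normc_ge0.
  + by move=> x _; rewrite lee_fin normc_ge0.
  + by apply/measurable_EFinP; exact: cmeas_normc.
- under eq_integral do rewrite ReM EFinB !EFinM.
  rewrite integralB//; [|exact: integrableZl|exact: integrableZl].
  by rewrite !integralZl// f1 f2 ReM.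
- under eq_integral do rewrite ImM EFinD !EFinM.
  rewrite integralD//; [|exact: integrableZl|exact: integrableZl].
  by rewrite !integralZl// f1 f2 ImM.
Qed.

Lemma has_cint_opp f v : has_cint f v -> has_cint (fun x => (- f x)%R) (- v)%R.
Proof.
move=> /(has_cintZ (-1)%R); rewrite mulN1r.
by under eq_fun do rewrite mulN1r.
Qed.

Lemma has_cint_ae f g v : cmeas g -> {ae mu, forall x, f x = g x} ->
  has_cint f v -> has_cint g v.
Proof.
move=> mg fg [mf fi f1 f2]; split => //.
- rewrite (_ : \int[mu]_x _ = \int[mu]_x (normc (f x))%:E)//.
  apply: ae_eq_integral => //.
  + by apply/measurable_EFinP; exact: cmeas_normc.
  + by apply/measurable_EFinP; exact: cmeas_normc.
  + by apply: filterS fg => x -> _.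
- rewrite -f1; apply: ae_eq_integral => //.
  + by apply/measurable_EFinP; case: mg.
  + by apply/measurable_EFinP; case: mf.
  + by apply: filterS fg => x -> _.
- rewrite -f2; apply: ae_eq_integral => //.
  + by apply/measurable_EFinP; case: mg.
  + by apply/measurable_EFinP; case: mf.
  + by apply: filterS fg => x -> _.
Qed.

End has_cint.

Section has_cint_fubini.
Context d1 d2 (T1 : measurableType d1) (T2 : measurableType d2) (R : realType).
Variable m1 : {sigma_finite_measure set T1 -> \bar R}.
Variable m2 : {sigma_finite_measure set T2 -> \bar R}.
Variable f : T1 * T2 -> R[i].
Local Open Scope ereal_scope.

Lemma has_cint_prod (k : T1 -> R[i]) v : cmeas f ->
  \int[m1]_x \int[m2]_y (normc (f (x, y)))%:E < +oo ->
  {ae m1, forall x, has_cint m2 (fun y => f (x, y)) (k x)} ->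
  has_cint m1 k v -> has_cint (m1 \x m2) f v.
Proof.
move=> mf fi fk [[mk1 mk2] ki k1 k2]; have [mf1 mf2] := mf.
have fi' : \int[m1 \x m2]_z (normc (f z))%:E < +oo.
  rewrite (fubini_tonelli1 (fun z => (normc (f z))%:E))//.
    by apply/measurable_EFinP; exact: cmeas_normc.
  by move=> z; rewrite lee_fin normc_ge0.
have [i1 i2] := has_cint_integrable (cmeas_has_cint mf fi').
split => //.
- rewrite -integral12_prod_meas1// -k1; apply: ae_eq_integral => //.
  + exact: (measurable_fubini_F i1).
  + exact/measurable_EFinP.
  + by apply: filterS fk => x [_ _ e _] _; rewrite /fubini_F e.
- rewrite -integral12_prod_meas1// -k2; apply: ae_eq_integral => //.
  + exact: (measurable_fubini_F i2).
  + exact/measurable_EFinP.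
  + by apply: filterS fk => x [_ _ _ e] _; rewrite /fubini_F e.
Qed.

End has_cint_fubini.

Section has_cint_swap.
Context d1 d2 (T1 : measurableType d1) (T2 : measurableType d2) (R : realType).
Variable m1 : {sigma_finite_measure set T1 -> \bar R}.
Variable m2 : {sigma_finite_measure set T2 -> \bar R}.
Variable f : T1 * T2 -> R[i].

(** Tonelli exchanges the factors for nonnegative functions; positive and negative parts of the real
    and imaginary parts give the general case. *)
Lemma has_cint_swap v :
  has_cint (m2 \x m1)%E (fun z : T2 * T1 => f (z.2, z.1)) v ->
  has_cint (m1 \x m2)%E f v.
Proof.
have msw : measurable_fun setT (fun z : T1 * T2 => (z.2, z.1)).
  by apply: measurable_fun_pair.
have msw' : measurable_fun setT (fun z : T2 * T1 => (z.2, z.1)).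
  by apply: measurable_fun_pair.
have key (g : T1 * T2 -> \bar R) : measurable_fun setT g -> (forall z, 0 <= g z)%E ->
    (\int[m1 \x m2]_z g z = \int[m2 \x m1]_z g (z.2, z.1))%E.
  move=> mg g0; rewrite fubini_tonelli2//.
  by rewrite (fubini_tonelli1 (fun z : T2 * T1 => g (z.2, z.1)))//; exact: measurableT_comp.
move=> [mf fi f1 f2].
have mf' : cmeas f.
  rewrite (_ : f = (fun z => f ((z.2, z.1).2, (z.2, z.1).1))); last first.
    by apply/funext => -[].
  exact: (cmeas_comp mf msw).
have [mf1 mf2] := mf'.
have key' (g : T1 * T2 -> \bar R) : measurable_fun setT g ->
    (\int[m1 \x m2]_z g z = \int[m2 \x m1]_z g (z.2, z.1))%E.
  move=> mg; rewrite integralE [RHS]integralE; congr (_ - _)%E.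
    rewrite (key _ (measurable_funepos mg) (funepos_ge0 _)).
    by apply: eq_integral => z _; rewrite !funeposE.
  rewrite (key _ (measurable_funeneg mg) (funeneg_ge0 _)).
  by apply: eq_integral => z _; rewrite !funenegE.
split => //.
- rewrite key//; first by apply/measurable_EFinP; exact: cmeas_normc.
  by move=> z; rewrite lee_fin normc_ge0.
- by rewrite key'//; exact/measurable_EFinP.
- by rewrite key'//; exact/measurable_EFinP.
Qed.

End has_cint_swap.

Section has_cint_transfer.
Context d1 d2 (T1 : measurableType d1) (T2 : measurableType d2) (R : realType).
Variables (m1 : {measure set T1 -> \bar R}) (m2 : {measure set T2 -> \bar R}).
Variables (Phi : T1 -> T2) (J : T1 -> R) (K : T2 -> R).
Hypotheses (J0 : forall x, 0 <= J x) (K0 : forall x, 0 <= K x).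
Hypotheses (mPhi : measurable_fun setT Phi) (mJ : measurable_fun setT J)
  (mK : measurable_fun setT K).
Hypothesis PhiJK : forall g : T2 -> \bar R, measurable_fun setT g ->
  (forall y, 0 <= g y)%E ->
  (\int[m1]_x (g (Phi x) * (J x)%:E) = \int[m2]_y (g y * (K y)%:E))%E.

Let transfer_real (g : T2 -> R) : measurable_fun setT g ->
  (\int[m1]_x (J x * g (Phi x))%:E = \int[m2]_y (K y * g y)%:E)%E.
Proof.
move=> mg.
have fp d (T : measurableType d) (h k : T -> R) : (forall x, 0 <= k x) ->
    ((fun x => (k x * h x)%:E)^\+ = (fun x => (EFin \o h)^\+ x * (k x)%:E))%E.
  move=> k0; apply/funext => x; rewrite !funeposE/= -!EFin_max -EFinM.
  by rewrite maxr_pMl// mul0r [h x * _]mulrC.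
have fn d (T : measurableType d) (h k : T -> R) : (forall x, 0 <= k x) ->
    ((fun x => (k x * h x)%:E)^\- = (fun x => (EFin \o h)^\- x * (k x)%:E))%E.
  move=> k0; apply/funext => x; rewrite !funenegE/= -!EFin_max -EFinM.
  by rewrite maxr_pMl// mul0r mulNr [h x * _]mulrC.
rewrite integralE [RHS]integralE; congr (_ - _)%E.
  rewrite (fp _ _ (fun x => g (Phi x))) // (fp _ _ g)//.
  rewrite -(PhiJK (measurable_funepos _) (funepos_ge0 _)); last exact/measurable_EFinP.
  by apply: eq_integral => x _; rewrite !funeposE.
rewrite (fn _ _ (fun x => g (Phi x))) // (fn _ _ g)//.
rewrite -(PhiJK (measurable_funeneg _) (funeneg_ge0 _)); last exact/measurable_EFinP.
by apply: eq_integral => x _; rewrite !funenegE.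
Qed.

(** A change of variables known for nonnegative functions extends to complex ones: since [J] and [K]
    are nonnegative, multiplication by them commutes with taking positive and negative parts. *)
Lemma has_cint_transfer (f : T2 -> R[i]) v : cmeas f ->
  has_cint m2 (fun y => (K y)%:C * f y) v <->
  has_cint m1 (fun x => (J x)%:C * f (Phi x)) v.
Proof.
move=> mf; have [mf1 mf2] := mf.
have e0 : (\int[m1]_x (normc ((J x)%:C * f (Phi x))%R)%:E =
   \int[m2]_y (normc ((K y)%:C * f y)%R)%:E)%E.
  under eq_integral do rewrite Normc.normcM normcR ger0_norm//.
  under [RHS]eq_integral do rewrite Normc.normcM normcR ger0_norm//.
  by apply: (transfer_real (g := fun y => normc (f y))); exact: cmeas_normc.
have e1 : (\int[m1]_x (Re ((J x)%:C * f (Phi x))%R)%:E =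
   \int[m2]_y (Re ((K y)%:C * f y)%R)%:E)%E.
  under eq_integral do rewrite ReMl.
  under [RHS]eq_integral do rewrite ReMl.
  exact: (transfer_real (g := fun y => Re (f y))).
have e2 : (\int[m1]_x (Im ((J x)%:C * f (Phi x))%R)%:E =
   \int[m2]_y (Im ((K y)%:C * f y)%R)%:E)%E.
  under eq_integral do rewrite ImMl.
  under [RHS]eq_integral do rewrite ImMl.
  exact: (transfer_real (g := fun y => Im (f y))).
have c1 : cmeas (fun y => (K y)%:C * f y).
  by apply: cmeasM => //; exact: cmeas_real.
have c2 : cmeas (fun x => (J x)%:C * f (Phi x)).
  by apply: cmeasM; [exact: cmeas_real|exact: cmeas_comp].
by split => -[_ a b c]; split => //; rewrite ?e0 ?e1 ?e2// -?e0 -?e1 -?e2.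
Qed.

End has_cint_transfer.

(** * Primitives on intervals exhausted by compact ones *)

Section improper_FTC.
Context (R : realType).
Local Notation TR := (measurableTypeR R).
Local Notation leb := (@lebesgue_measure R).
Variables (I : interval R) (a b : R^nat).
Hypotheses (ab : forall n, a n < b n)
  (ndab : forall n m, (n <= m)%N -> a m <= a n /\ b n <= b m)
  (abI : forall n x, a n <= x <= b n -> x \in I)
  (Iab : forall x, x \in I -> exists n, a n <= x <= b n).

Let E n : set R := `[a n, b n]%classic.

Let ndE n m : (n <= m)%N -> E n `<=` E m.
Proof.
move=> /ndab[amn bnm] x; rewrite /E/= !in_itv/= => /andP[ax xb].
by rewrite (le_trans amn)// (le_trans xb).
Qed.

Let bigE : \bigcup_n E n = [set` I].
Proof.
apply/seteqP; split => [x [n _]|x /Iab[n xn]].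
  by rewrite /E/= in_itv/= => /abI.
by exists n => //=; rewrite in_itv.
Qed.

Let proper_FTC (F f : R -> R) : (forall x, x \in I -> is_derive x 1 F (f x)) ->
  (forall x, x \in I -> {for x, continuous f}) ->
  forall n, (\int[leb]_(x in E n) (f x)%:E = (F (b n) - F (a n))%:E)%E.
Proof.
move=> dF cf n; rewrite (@continuous_FTC2 _ f F)//.
- apply: continuous_in_subspaceT => z; rewrite inE/= in_itv/= => zxy.
  by apply: cf; exact: (abI zxy).
- have dc z : a n <= z <= b n -> {for z, continuous F}.
    move=> zxy; apply: differentiable_continuous; apply/derivable1_diffP.
    by have := dF _ (abI zxy); case.
  split.
  + move=> z; rewrite in_itv/= => /andP[/ltW xz /ltW zy].
    have zI : z \in I by apply: (@abI n); rewrite xz.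
    by have [] := dF _ zI.
  + by apply: cvg_at_right_filter; apply: dc; rewrite lexx ltW.
  + by apply: cvg_at_left_filter; apply: dc; rewrite lexx ltW.
- move=> z; rewrite in_itv/= => /andP[/ltW xz /ltW zy].
  have zI : z \in I by apply: (@abI n); rewrite xz.
  by rewrite derive1E; have [_ ->] := dF _ zI.
Qed.

(** The integral over each [[a n, b n]] is an increment of [F], hence at most [2 M]. This is the
    integrability criterion behind the Gamma and the Cauchy integral. *)
Lemma ge0_bounded_primitive (F f : R -> R) (M : R) :
  (forall x, x \in I -> is_derive x 1 F (f x)) ->
  (forall x, x \in I -> {for x, continuous f}) ->
  (forall x, x \in I -> 0 <= f x) -> (forall x, x \in I -> `|F x| <= M) ->
  measurable_fun [set: TR] (f : TR -> TR) ->
  (\int[leb]_(x in [set` I]) (f x)%:E < +oo)%E.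
Proof.
move=> dF cf f0 FM mf.
apply: (@le_lt_trans _ _ (M + M)%:E); last by rewrite ltry.
have h : (\int[leb]_(x in E i) (f x)%:E @[i --> \oo] -->
   \int[leb]_(x in \bigcup_i E i) (f x)%:E)%E.
  apply: ge0_nondecreasing_set_cvg_integral.
  - by move=> n m nm; apply/subsetPset; exact: ndE.
  - by move=> n; exact: measurable_itv.
  - by move=> n; apply: measurable_funTS; exact/measurable_EFinP.
  - by move=> n x; rewrite /E/= in_itv/= => /abI/f0; rewrite lee_fin.
rewrite -bigE -(cvg_lim _ h)//.
apply: lime_le; first by apply/cvg_ex; eexists; exact: h.
apply: nearW => n; rewrite (proper_FTC dF cf) lee_fin.
have aI : a n \in I by apply: (@abI n); rewrite lexx ltW.
have bI : b n \in I by apply: (@abI n); rewrite lexx ltW.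
by have := FM _ aI; have := FM _ bI; rewrite !ler_norml => /andP[? ?] /andP[? ?]; lra.
Qed.

Lemma improper_FTC (F f : R -> R) (l1 l2 : R) :
  (forall x, x \in I -> is_derive x 1 F (f x)) ->
  (forall x, x \in I -> {for x, continuous f}) ->
  leb.-integrable [set` I] (EFin \o f) ->
  F (a n) @[n --> \oo] --> l1 -> F (b n) @[n --> \oo] --> l2 ->
  (\int[leb]_(x in [set` I]) (f x)%:E = (l2 - l1)%:E)%E.
Proof.
move=> dF cf fi Fa Fb.
have mI : measurable ([set` I] : set TR) by exact: measurable_itv.
have mE n : measurable (E n : set TR) by exact: measurable_itv.
have /integrableP[mfI _] := fi.
pose g n x := ((EFin \o f) \_ (E n)) x.
have [|||||_ _ h] := @dominated_convergence _ TR R leb [set` I] mI g (EFin \o f)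
  (fun x => `|f x|%:E).
- move=> n; apply: (measurable_restrict (EFin \o f) (mE n) mI).1.
  by apply: (measurable_funS mI _ mfI); exact: subIsetl.
- exact: mfI.
- apply: aeW => x xI; have [n nx] := Iab xI.
  apply: cvg_near_cst; exists n => // m /= nm.
  by rewrite /g patchE mem_set//; apply: (ndE nm); rewrite /E/= in_itv.
- have := integrable_abse fi; apply: eq_integrable => //.
- apply: aeW => n x; rewrite /g patchE; case: ifPn => // _.
  by rewrite abse0 lee_fin.
have e : (fun n => \int[leb]_(x in [set` I]) g n x)%E = (fun n => (F (b n) - F (a n))%:E).
  apply/funext => n; rewrite /g -integral_mkcondr -(proper_FTC dF cf); congr integral.
  apply/seteqP; split => [x []//|x xE]; split => //.
  by rewrite -bigE; exists n.
have h2 : (fun n => (F (b n) - F (a n))%:E) @ \oo --> (l2 - l1)%:E.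
  by apply: cvg_EFin; [exact: nearW|]; apply: cvgB.
by apply: (cvg_unique _ _ h2) => //; move: h; rewrite /= e.
Qed.

End improper_FTC.

(** * Integration over tuples *)

Section explicit_norm.
Context d (T : measurableType d) (R : realType).
Variable mu : {measure set T -> \bar R}.

(** The integral of the modulus is kept as an explicit number because it becomes the integrand of
    the next outer integral when absolute convergence of an iterated integral is checked. *)
Definition has_cintN (f : T -> R[i]) v (M : R) :=
  has_cint mu f v /\ (\int[mu]_x (normc (f x))%:E = M%:E)%E.
End explicit_norm.

Section explicit_norm_fubini.
Context d1 d2 (T1 : measurableType d1) (T2 : measurableType d2) (R : realType).
Variable m1 : {sigma_finite_measure set T1 -> \bar R}.
Variable m2 : {sigma_finite_measure set T2 -> \bar R}.
Variable f : T1 * T2 -> R[i].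
Local Open Scope ereal_scope.

Lemma has_cintN_prod (k : T1 -> R[i]) (N : T1 -> R) v M : cmeas f ->
  (forall x, has_cintN m2 (fun y => f (x, y)) (k x) (N x)) ->
  has_cint m1 k v -> \int[m1]_x (N x)%:E = M%:E -> has_cintN (m1 \x m2) f v M.
Proof.
move=> mf fk kv NM; split.
  apply: (has_cint_prod mf _ _ kv).
    under eq_integral => x _ do rewrite (fk x).2.
    by rewrite NM ltry.
  by apply: aeW => x; exact: (fk x).1.
rewrite (fubini_tonelli1 (fun z => (normc (f z))%:E))//.
- by rewrite -NM; apply: eq_integral => x _; exact: (fk x).2.
- by apply/measurable_EFinP; exact: cmeas_normc.
- by move=> z; rewrite lee_fin normc_ge0.
Qed.

(** A converse to Fubini: a value known on the product, computed in one order of integration, is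
    handed to the inner integrals of the other order. *)
Lemma has_cint_prod1 (k : T1 -> R[i]) v : cmeas k ->
  (forall x, has_cint m2 (fun y => f (x, y)) (k x)) ->
  has_cint (m1 \x m2) f v -> has_cint m1 k v.
Proof.
move=> mk fk fv; have [mf fi f1 f2] := fv; have [mf1 mf2] := mf.
have [i1 i2] := has_cint_integrable fv.
have mn : measurable_fun setT (fun z => (normc (f z))%:E).
  by apply/measurable_EFinP; exact: cmeas_normc.
have n0 z : 0 <= (normc (f z))%:E by rewrite lee_fin normc_ge0.
split => //.
(* The factor 2 comes from bounding [normc (k x)] by the sum of the moduli of its two parts, each of
   which is at most the integral of [normc (f (x, y))]. *)
- apply: (@le_lt_trans _ _ (\int[m1]_x (2%:E * \int[m2]_y (normc (f (x, y)))%:E))); last first.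
    rewrite ge0_integralZl//.
    + move: fi; rewrite (fubini_tonelli1 (fun z => (normc (f z))%:E))// => fi.
      by rewrite lte_mul_pinfty.
    + exact: (measurable_fun_fubini_tonelli_F (fun z => (normc (f z))%:E)).
    + by move=> x _; exact: integral_ge0.
  apply: ge0_le_integral => //.
  + by move=> x _; rewrite lee_fin normc_ge0.
  + by apply/measurable_EFinP; exact: cmeas_normc.
  + apply: measurable_funeM.
    exact: (measurable_fun_fubini_tonelli_F (fun z => (normc (f z))%:E)).
  + move=> x _; have [[fx1 fx2] _ e1 e2] := fk x.
    have h (g : T2 -> R) : measurable_fun setT g ->
        (forall y, (`|g y| <= normc (f (x, y)))%R) ->
        `|\int[m2]_y (g y)%:E| <= \int[m2]_y (normc (f (x, y)))%:E.
      move=> mg gf; apply: le_trans (le_abse_integral _ _ _) _ => //.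
        exact/measurable_EFinP.
      apply: ge0_le_integral => //.
      * by apply/measurable_EFinP; exact: measurableT_comp.
      * by apply/measurable_EFinP; apply: cmeas_normc; split.
      * by move=> y _; rewrite lee_fin.
    have := h _ fx1 (fun=> Re_le_normc _); rewrite e1 => h1.
    have := h _ fx2 (fun=> Im_le_normc _); rewrite e2 => h2.
    apply: le_trans (_ : `|(Re (k x))%:E| + `|(Im (k x))%:E| <= _).
      by rewrite -EFinD lee_fin normc_le.
    by rewrite mule_natl mule2n leeD.
- rewrite -f1 -integral12_prod_meas1//; apply: eq_integral => x _.
  by have [_ _ e _] := fk x; rewrite /fubini_F e.
- rewrite -f2 -integral12_prod_meas1//; apply: eq_integral => x _.
  by have [_ _ _ e] := fk x; rewrite /fubini_F e.
Qed.

End explicit_norm_fubini.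

Section tuple_integral.
Context (R : realType).
Local Notation TR := (measurableTypeR R).
Local Notation leb := (@lebesgue_measure R).
Local Notation mu := (@tuple_lebesgue R).

(** Integrands are functions on plain sequences, so that entries can be consed, concatenated and
    mapped without dependent lengths; only their restriction to [N]-tuples has to be measurable. *)
Definition tmeasurable d (Y : measurableType d) N (g : seq R -> Y) :=
  measurable_fun setT (fun t : N.-tuple TR => g t).

Lemma measurable_nth N i :
  measurable_fun setT (fun t : N.-tuple TR => (nth (0 : R) t i : TR)).
Proof.
have [iN|Ni] := ltnP i N.
  rewrite (_ : (fun _ => _) = (fun t => tnth t (Ordinal iN))).
    exact: measurable_tnth.
  by apply/funext => t; rewrite (tnth_nth (0 : R)).
rewrite (_ : (fun _ => _) = cst 0); first exact: measurable_cst.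
by apply/funext => t; rewrite nth_default// size_tuple.
Qed.

Lemma tmeasurable_comp d d' (Y : measurableType d) (T : measurableType d') M
    (g : seq R -> Y) (Phi : T -> seq R) :
  (forall t, size (Phi t) = M) ->
  (forall i, (i < M)%N -> measurable_fun setT (fun t => (nth 0 (Phi t) i : TR))) ->
  tmeasurable M g -> measurable_fun setT (fun t => g (Phi t)).
Proof.
move=> sPhi mPhi mg.
pose phi t : M.-tuple TR := [tuple nth 0 (Phi t) i | i < M].
rewrite (_ : (fun _ => _) = (fun t => g (phi t))); last first.
  apply/funext => t; congr g; apply: (@eq_from_nth _ 0).
    by rewrite size_tuple sPhi.
  move=> i; rewrite sPhi => iM.
  by have := tnth_nth 0 (phi t) (Ordinal iM) => /= <-; rewrite tnth_mktuple.
apply: (measurableT_comp mg); apply/measurable_fun_tnthP => i.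
rewrite (_ : _ \o _ = (fun t => nth 0 (Phi t) i)); first exact: mPhi.
by apply/funext => t /=; rewrite tnth_mktuple.
Qed.

Lemma ge0_integral_tuple0 (g : seq R -> \bar R) :
  (\int[mu 0]_t g t = g [::])%E.
Proof.
transitivity (\int[\d_([tuple] : 0.-tuple TR)]_(t in setT) (fun t : 0.-tuple TR => g [::]) t)%E.
  by apply: eq_integral => t _; rewrite tuple0.
by rewrite integral_cst//= diracT mule1.
Qed.

Lemma tmeasurable_pair d (Y : measurableType d) N (g : seq R -> Y) :
  tmeasurable N.+1 g ->
  measurable_fun setT (fun z : TR * N.-tuple TR => g (z.1 :: z.2)).
Proof.
by move=> mg; exact: (measurableT_comp mg (@measurable_tuple_of_pair _ TR N)).
Qed.

Lemma tmeasurable_cons d (Y : measurableType d) N (g : seq R -> Y) x :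
  tmeasurable N.+1 g -> tmeasurable N (fun t => g (x :: t)).
Proof.
by move=> /tmeasurable_pair mg; exact: (measurableT_comp mg (measurable_pair1 x)).
Qed.

Lemma ge0_integral_tupleP N (g : seq R -> \bar R) :
  tmeasurable N.+1 g -> (forall t, 0 <= g t)%E ->
  (\int[mu N.+1]_t g t = \int[leb \x mu N]_z g (z.1 :: z.2))%E.
Proof.
move=> mg g0 /=.
rewrite (@ge0_integral_pushforward _ _ _ _ _ _ (@measurable_tuple_of_pair _ TR N))//.
Qed.

Lemma ge0_integral_tupleS N (g : seq R -> \bar R) :
  tmeasurable N.+1 g -> (forall t, 0 <= g t)%E ->
  (\int[mu N.+1]_t g t = \int[leb]_x \int[mu N]_t g (x :: t))%E.
Proof.
move=> mg g0; rewrite ge0_integral_tupleP//.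
by rewrite (fubini_tonelli1 (fun z : TR * N.-tuple TR => g (z.1 :: z.2)))//; exact: tmeasurable_pair.
Qed.

Lemma ge0_integral_tupleS2 N (g : seq R -> \bar R) :
  tmeasurable N.+1 g -> (forall t, 0 <= g t)%E ->
  (\int[mu N.+1]_t g t = \int[mu N]_t \int[leb]_x g (x :: t))%E.
Proof.
move=> mg g0; rewrite ge0_integral_tupleP//.
by rewrite (fubini_tonelli2 (fun z : TR * N.-tuple TR => g (z.1 :: z.2)))//; exact: tmeasurable_pair.
Qed.

Lemma tmeasurable_integral N (g : seq R -> \bar R) :
  tmeasurable N.+1 g -> (forall t, 0 <= g t)%E ->
  measurable_fun setT (fun x : TR => \int[mu N]_t g (x :: t))%E.
Proof.
move=> mg g0.
exact: (measurable_fun_fubini_tonelli_F (m2 := mu N)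
  (fun z : TR * N.-tuple TR => g (z.1 :: z.2)) (tmeasurable_pair mg)).
Qed.

Lemma tmeasurable_integral2 N (g : seq R -> \bar R) :
  tmeasurable N.+1 g -> (forall t, 0 <= g t)%E ->
  tmeasurable N (fun t => \int[leb]_x g (x :: t))%E.
Proof.
move=> mg g0.
exact: (measurable_fun_fubini_tonelli_G (m1 := leb)
  (fun z : TR * N.-tuple TR => g (z.1 :: z.2)) (tmeasurable_pair mg)).
Qed.

Lemma measurable_cat N1 N2 d (Y : measurableType d) (g : seq R -> Y) :
  tmeasurable (N1 + N2) g ->
  measurable_fun setT (fun z : N1.-tuple TR * N2.-tuple TR => g (z.1 ++ z.2)).
Proof.
apply: tmeasurable_comp => [t|i _]; first by rewrite size_cat !size_tuple.
under eq_fun do rewrite nth_cat size_tuple.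
case: ltnP => _.
  exact: (measurableT_comp (@measurable_nth N1 i) measurable_fst).
exact: (measurableT_comp (@measurable_nth N2 (i - N1)) measurable_snd).
Qed.

Lemma ge0_integral_cat N1 N2 (g : seq R -> \bar R) :
  tmeasurable (N1 + N2) g -> (forall t, 0 <= g t)%E ->
  (\int[mu (N1 + N2)]_t g t = \int[mu N1]_t \int[mu N2]_x g (t ++ x))%E.
Proof.
elim: N1 g => [|N1 IH] g mg g0.
  by rewrite (ge0_integral_tuple0 (fun t => \int[mu N2]_x g (t ++ x))%E).
rewrite -[LHS]/(\int[mu (N1 + N2).+1]_t g t)%E.
rewrite (ge0_integral_tupleS (N := N1 + N2))//.
rewrite (ge0_integral_tupleS (g := fun t => \int[mu N2]_x g (t ++ x))%E)//.
- apply: eq_integral => x _; apply: (IH (fun t => g (x :: t))) => //.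
  exact: (tmeasurable_cons (N := N1 + N2)).
- exact: (measurable_fun_fubini_tonelli_F (m2 := mu N2)
    (fun z : N1.+1.-tuple TR * N2.-tuple TR => g (z.1 ++ z.2)) (measurable_cat mg)).
- by move=> t; exact: integral_ge0.
Qed.

Definition tcmeas N (f : seq R -> R[i]) := cmeas (fun t : N.-tuple TR => f t).

Lemma tcmeas_comp d (T : measurableType d) M (f : seq R -> R[i]) (Phi : T -> seq R) :
  (forall t, size (Phi t) = M) ->
  (forall i, (i < M)%N -> measurable_fun setT (fun t => (nth 0 (Phi t) i : TR))) ->
  tcmeas M f -> cmeas (fun t => f (Phi t)).
Proof.
move=> h1 h2 [f1 f2]; split.
  exact: (tmeasurable_comp (g := fun t => Re (f t)) h1 h2 f1).
exact: (tmeasurable_comp (g := fun t => Im (f t)) h1 h2 f2).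
Qed.

Lemma has_cint_tuple0 (f : seq R -> R[i]) :
  has_cintN (mu 0) (fun t : 0.-tuple TR => f t) (f [::]) (normc (f [::])).
Proof.
split; last exact: (ge0_integral_tuple0 (fun t => (normc (f t))%:E)).
split.
- rewrite (_ : (fun _ => _) = (fun=> f [::])); first exact: cmeas_cst.
  by apply/funext => t; rewrite tuple0.
- by rewrite (ge0_integral_tuple0 (fun t => (normc (f t))%:E)) ltry.
- exact: (ge0_integral_tuple0 (fun t => (Re (f t))%:E)).
- exact: (ge0_integral_tuple0 (fun t => (Im (f t))%:E)).
Qed.

Lemma has_cint_tupleS N (f : seq R -> R[i]) v : tcmeas N.+1 f ->
  has_cint (mu N.+1) (fun t : N.+1.-tuple TR => f t) v <->
  has_cint (leb \x mu N)%E (fun z : TR * N.-tuple TR => f (z.1 :: z.2)) v.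
Proof.
move=> mf.
have := @has_cint_transfer _ _ _ _ _ (leb \x mu N)%E (mu N.+1)
  (@tuple_of_pair TR N) (cst 1) (cst 1) (fun=> ler01) (fun=> ler01)
  (@measurable_tuple_of_pair _ TR N) (measurable_cst _) (measurable_cst _) _
  (fun t => f t) v mf.
under [X in has_cint _ X _ <-> _]eq_fun do rewrite mul1r.
under [X in _ <-> has_cint _ X _]eq_fun do rewrite mul1r.
apply => g mg g0.
under eq_integral do rewrite mule1.
under [RHS]eq_integral do rewrite mule1.
by rewrite /= (@ge0_integral_pushforward _ _ _ _ _ _ (@measurable_tuple_of_pair _ TR N)).
Qed.

Lemma has_cint_cat N1 N2 (f : seq R -> R[i]) v : tcmeas (N1 + N2) f ->
  has_cint (mu (N1 + N2)) (fun t : (N1 + N2).-tuple TR => f t) v <->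
  has_cint (mu N1 \x mu N2)%E (fun z : N1.-tuple TR * N2.-tuple TR => f (z.1 ++ z.2)) v.
Proof.
move=> mf.
have mcat : measurable_fun setT
    (fun z : N1.-tuple TR * N2.-tuple TR => [tuple of z.1 ++ z.2]).
  apply/measurable_fun_tnthP => i.
  rewrite (_ : _ \o _ =
      (fun z : N1.-tuple TR * N2.-tuple TR => nth (0 : R) (z.1 ++ z.2) i)).
    apply: (measurable_cat (g := fun s => nth (0 : R) s i : TR)).
    exact: measurable_nth.
  by apply/funext => z; rewrite /= (tnth_nth (0 : R)).
have := @has_cint_transfer _ _ _ _ _ (mu N1 \x mu N2)%E (mu (N1 + N2))
  (fun z : N1.-tuple TR * N2.-tuple TR => [tuple of z.1 ++ z.2]) (cst 1) (cst 1)
  (fun=> ler01) (fun=> ler01)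
  mcat (measurable_cst _) (measurable_cst _) _ (fun t => f t) v mf.
under [X in has_cint _ X _ <-> _]eq_fun do rewrite mul1r.
under [X in _ <-> has_cint _ X _]eq_fun do rewrite mul1r.
apply => g mg g0.
under eq_integral do rewrite mule1.
under [RHS]eq_integral do rewrite mule1.
(* The function [g] lives on tuples; [insubd] extends it to all sequences. The default tuple is
   immaterial, since [g'] is evaluated only at sequences of the right length. *)
pose g' (s : seq R) := g (insubd [tuple of nseq (N1 + N2) 0] s).
have gE t : g t = g' t.
  by rewrite /g'; congr g; apply: val_inj; rewrite val_insubd size_tuple eqxx.
under [RHS]eq_integral do rewrite gE.
rewrite ge0_integral_cat//.
- etransitivity.
    exact: (fubini_tonelli1 _ (measurableT_comp mg mcat) (fun=> g0 _)).
  apply: eq_integral => t _; apply: eq_integral => x _.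
  exact: (gE [tuple of t ++ x]).
- by rewrite /tmeasurable; under eq_fun do rewrite -gE.
- by move=> s; exact: g0.
Qed.

Definition mulseq (s w : seq R) := [seq p.1 * p.2 | p <- zip s w].

Lemma size_mulseq s w : size s = size w -> size (mulseq s w) = size w.
Proof. by move=> e; rewrite size_map size_zip e minnn. Qed.

Lemma nth_mulseq s w i : size s = size w ->
  nth 0 (mulseq s w) i = nth 0 s i * nth 0 w i.
Proof.
move=> e; have [iw|wi] := ltnP i (size w).
  by rewrite (nth_map (0, 0)) ?size_zip ?e ?minnn// nth_zip.
by rewrite nth_default ?size_mulseq// (nth_default _ wi) mulr0.
Qed.

Lemma tmeasurable_mulseq d (Y : measurableType d) N (g : seq R -> Y) s :
  size s = N -> tmeasurable N g -> tmeasurable N (fun t => g (mulseq s t)).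
Proof.
move=> sN mg; apply: (@tmeasurable_comp _ _ _ _ N _ (fun t : N.-tuple TR => mulseq s t)) => //.
  by move=> t; rewrite size_mulseq size_tuple.
move=> i iN; under eq_fun do rewrite nth_mulseq ?size_tuple//.
by apply: measurable_funM => //; exact: measurable_nth.
Qed.

Lemma ge0_integral_scale1 (c : R) (g : TR -> \bar R) : 0 < c ->
  measurable_fun setT g -> (forall x, 0 <= g x)%E ->
  (\int[leb]_x (g (c * x)%R * c%:E) = \int[leb]_x g x)%E.
Proof.
move=> c0 mg g0.
have mF : measurable_fun [set: TR] ((fun x => c * x) : TR -> TR).
  exact: measurable_funM.
have dF (x : R) : x \in `]-oo, +oo[ -> is_derive x 1 (fun x : R => c * x) c.
  by move=> _; apply: is_derive_eq; rewrite ?scaler0 ?add0r /GRing.scale/= mulr1.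
have surj (y : R) : exists2 x : R, x \in `]-oo, +oo[ & c * x = y.
  by exists (c^-1 * y) => //; rewrite mulVKf// gt_eqF.
rewrite -(ge0_substitutionT mF (measurable_cst c) dF _ _ surj mg g0)//.
- by apply: eq_integral => x _; rewrite in_itv/= mulr1.
- by move=> x _; exact: cst_continuous.
Qed.

Lemma ge0_integral_mulseq N (s : seq R) (g : seq R -> \bar R) :
  size s = N -> all (fun c => 0 < c) s ->
  tmeasurable N g -> (forall t, 0 <= g t)%E ->
  (\int[mu N]_t (g (mulseq s t) * (\prod_(c <- s) c)%:E) = \int[mu N]_t g t)%E.
Proof.
elim: N s g => [|N IH] [|c s] g//= sN.
  rewrite (ge0_integral_tuple0 (fun t => g (mulseq [::] t) * _)%E).
  by rewrite (ge0_integral_tuple0 g)/= big_nil mule1.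
move=> /andP[c0 s0] mg g0; move: sN => [sN].
have p0 : 0 <= \prod_(c0 <- s) c0.
  by rewrite big_seq; apply: prodr_ge0 => x xs; apply/ltW; exact: (allP s0).
have mS : tmeasurable N.+1 (fun t => g (mulseq (c :: s) t) * (\prod_(c0 <- c :: s) c0)%:E)%E.
  apply: emeasurable_funM => //.
  by apply: (tmeasurable_mulseq (s := c :: s) (g := g)) => //=; rewrite sN.
rewrite (ge0_integral_tupleS mS); last first.
  by move=> t; rewrite mule_ge0// lee_fin big_cons mulr_ge0// ltW.
rewrite (ge0_integral_tupleS mg g0).
have mG := tmeasurable_integral mg g0.
have G0 (x : TR) : (0 <= \int[mu N]_t g (x :: t))%E by exact: integral_ge0.
rewrite -[RHS](ge0_integral_scale1 c0 mG G0).
apply: eq_integral => x _.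
have e : (\int[mu N]_t (g ((c * x)%R :: mulseq s t) * (\prod_(c <- s) c)%:E) =
    \int[mu N]_t g ((c * x)%R :: t))%E.
  by apply: (IH s (fun t => g ((c * x)%R :: t))) => //; exact: tmeasurable_cons.
transitivity (c%:E * \int[mu N]_t (g ((c * x)%R :: mulseq s t) * (\prod_(c <- s) c)%:E))%E; last first.
  by rewrite e muleC.
rewrite -ge0_integralZl//.
- by apply: eq_integral => t _; rewrite big_cons EFinM /= muleCA.
- apply: emeasurable_funM => //.
  apply: (tmeasurable_mulseq (g := fun t => g (c * x :: t))) => //.
  exact: tmeasurable_cons.
- by move=> t _; rewrite mule_ge0// lee_fin.
- by rewrite lee_fin ltW.
Qed.

(** Induction drops leading coordinates until [i = 0]; integrating that coordinate with the others
    fixed, the set is a single point, hence null. This is what makes weak and strict interlacing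
    equivalent under the integral. *)
Lemma ae_neq_nth N i j : (i < j < N)%N ->
  {ae mu N, forall t : N.-tuple TR, nth (0 : R) t i != nth 0 t j}.
Proof.
move=> /andP[ij jN].
have key : (\int[mu N]_t ((nth (0 : R) t i == nth 0 t j)%:R : R)%:E = 0)%E.
  elim: N i j ij jN => // N IH i [//|j] ij jN.
  have mS M k l : tmeasurable M (fun t : seq R => ((nth (0 : R) t k == nth 0 t l)%:R : R)%:E).
    apply/measurable_EFinP.
    rewrite (_ : (fun _ => _) = (fun t : M.-tuple TR => if nth 0 t k == nth 0 t l then 1 else 0 : TR)).
      apply: measurable_fun_ifT => //.
      by apply: measurable_fun_eqr; exact: measurable_nth.
    by apply/funext => t; case: ifP.
  have n0 k l t : (0 <= ((nth (0 : R) t k == nth 0 t l)%:R : R)%:E)%E.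
    by rewrite lee_fin.
  case: i ij => [|i] ij; last first.
    rewrite (ge0_integral_tupleS (mS _ _ _))//.
    by apply: integral0_eq => x _ /=; exact: IH.
  rewrite (ge0_integral_tupleS2 (mS _ _ _))//.
  apply: integral0_eq => t _ /=.
  transitivity (\int[leb]_x (\1_[set nth (0:R) t j] x)%:E)%E.
    apply: eq_integral => x _; rewrite indicE; congr (_ %:R)%:E; congr nat_of_bool.
    by apply/eqP/idP; rewrite inE.
  by rewrite integral_indic// setIT; exact: lebesgue_measure_set1.
have mA : measurable [set t : N.-tuple TR | nth (0 : R) t i == nth 0 t j].
  rewrite -[X in measurable X]setTI.
  have /(_ measurableT [set true]) := measurable_fun_eqr (@measurable_nth N i) (@measurable_nth N j).
  exact.
exists [set t : N.-tuple TR | nth (0 : R) t i == nth 0 t j]; split => //.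
- rewrite -[X in mu N X]setIT -integral_indic// -key.
  apply: eq_integral => t _; rewrite indicE; congr (_ %:R)%:E; congr nat_of_bool.
  by apply/idP/idP; rewrite inE.
- by move=> t /= /negP; rewrite negbK.
Qed.

End tuple_integral.

(** * The complex exponential and the principal logarithm *)

Section complex_exponential.
Context (R : realType).
Implicit Types (z w s : R[i]) (x y : R).

Lemma cexpD z w : cexp (z + w) = cexp z * cexp w.
Proof.
by apply: eqc; rewrite ?ReM ?ImM /= ReD ImD expRD ?cosD ?sinD; ring.
Qed.

Lemma cexpR x : cexp x%:C = (expR x)%:C.
Proof. by apply: eqc; rewrite /= ?cos0 ?sin0 ?mulr1 ?mulr0. Qed.

Lemma cexp0 : cexp (0 : R[i]) = 1.
Proof. by have := cexpR 0; rewrite expR0. Qed.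

Lemma normc_cexp z : normc (cexp z) = expR (Re z).
Proof.
by rewrite normcE_sqrt /= !exprMn -mulrDr cos2Dsin2 mulr1 sqrtr_sqr ger0_norm// expR_ge0.
Qed.

Lemma cexp_neq0 z : cexp z != 0.
Proof.
apply/eqP => e; have := normc_cexp z; rewrite e Normc.normc0 => /eqP.
by rewrite eq_sym gt_eqF// expR_gt0.
Qed.

Lemma cexpN z : cexp (- z) = (cexp z)^-1.
Proof.
by apply: (mulfI (cexp_neq0 z)); rewrite -cexpD subrr cexp0 mulfV// cexp_neq0.
Qed.

Lemma cexp_sum (I : Type) (r : seq I) (P : pred I) (F : I -> R[i]) :
  cexp (\sum_(i <- r | P i) F i) = \prod_(i <- r | P i) cexp (F i).
Proof. by apply: (big_morph _ cexpD); exact: cexp0. Qed.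

Lemma sin_atan x : sin (atan x) = x * (Num.sqrt (1 + x ^+ 2))^-1.
Proof.
have h : 0 < Num.sqrt (1 + x ^+ 2) by rewrite sqrtr_gt0 ltr_pwDl// sqr_ge0.
rewrite -{2}(atanK x) /tan cos_atan invrK.
by rewrite -mulrA mulfV ?mulr1// gt_eqF.
Qed.

(** The only way back from products to logarithms: two numbers of the strip with equal exponentials
    are equal. Every use therefore has to bound an argument by [pi / 2]. *)
Lemma cln_inj_cexp z : `|Im z| < pi / 2 -> cln (cexp z) = z.
Proof.
move=> zpi; apply: eqc => /=.
  by have /= -> := normc_cexp z; rewrite expRK.
rewrite -[in RHS](@tanK R (Im z)).
  rewrite /tan -mulf_div divff ?mul1r//; by rewrite gt_eqF// expR_gt0.
by rewrite in_itv/= -ltr_norml.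
Qed.

Lemma cpow_cexp z s : `|Im z| < pi / 2 -> cpow (cexp z) s = cexp (s * z).
Proof. by move=> zpi; rewrite /cpow (negbTE (cexp_neq0 z)) cln_inj_cexp. Qed.

Lemma cpowR x s : 0 < x -> cpow x%:C s = cexp (s * (ln x)%:C).
Proof.
move=> x0; rewrite -[in LHS](lnK x0) -cexpR cpow_cexp//=.
by rewrite normr0 divr_gt0// pi_gt0.
Qed.

Lemma lnE_pos x y : 0 < x -> 0 < y -> ln (x * y) = ln x + ln y.
Proof. by move=> x0 y0; rewrite lnM ?posrE. Qed.

(* [cln (1 + i x)], with real part [ln (1 + x^2) / 2] *)
Definition cln1i x : R[i] := (ln (1 + x ^+ 2) / 2) +i* atan x.

Lemma ln1sqr_ge0 x : 0 <= ln (1 + x ^+ 2).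
Proof. by apply: ln_ge0; rewrite lerDl sqr_ge0. Qed.

Lemma onesqr_gt0 x : 0 < 1 + x ^+ 2.
Proof. by rewrite ltr_pwDl// sqr_ge0. Qed.

Lemma expR_half_ln x : expR (ln (1 + x ^+ 2) / 2) = Num.sqrt (1 + x ^+ 2).
Proof.
have h := onesqr_gt0 x.
apply: (@pexpIrn _ 2) => //; rewrite ?nnegrE ?expR_ge0 ?sqrtr_ge0//.
by rewrite sqr_sqrtr ?(ltW h)// -expRM_natl mulrC divfK ?pnatr_eq0// lnK.
Qed.

Lemma cexp_cln1i x : cexp (cln1i x) = 1 +i* x.
Proof.
have h : 0 < Num.sqrt (1 + x ^+ 2) by rewrite sqrtr_gt0 onesqr_gt0.
apply: eqc; rewrite /= expR_half_ln ?cos_atan ?sin_atan.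
  by rewrite mulfV// gt_eqF.
by rewrite mulrCA mulfV ?mulr1// gt_eqF.
Qed.

Lemma atan_bound x : `|atan x| < pi / 2.
Proof. by rewrite ltr_norml atan_gtNpi2 atan_ltpi2. Qed.

Lemma cpow1i x s : cpow (1 +i* x) s = cexp (s * cln1i x).
Proof. by rewrite -cexp_cln1i cpow_cexp// atan_bound. Qed.

Lemma cln1iN x : cln1i (- x) = (ln (1 + x ^+ 2) / 2) -i* atan x.
Proof. by rewrite /cln1i sqrrN atanN. Qed.
End complex_exponential.

(** * Derivatives of exponentials, vanishing boundary terms, exhaustions *)

Section derivatives.
Context (R : realType).
Implicit Types (f g : R -> R) (x a b : R).

Lemma is_derive_fD f g x a b : is_derive x 1 f a -> is_derive x 1 g b ->
  is_derive x 1 (fun t => f t + g t) (a + b).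
Proof. by move=> ? ?; exact: is_deriveD. Qed.

Lemma is_derive_fM f g x a b : is_derive x 1 f a -> is_derive x 1 g b ->
  is_derive x 1 (fun t => f t * g t) (a * g x + f x * b).
Proof.
move=> fa gb; have := is_deriveM fa gb; rewrite /GRing.scale/=.
by rewrite addrC [g x * a]mulrC.
Qed.

Lemma is_derive_fcomp f g x a b : is_derive (g x) 1 f a -> is_derive x 1 g b ->
  is_derive x 1 (fun t => f (g t)) (a * b).
Proof. by move=> fa gb; have := is_derive1_comp fa gb; rewrite /comp. Qed.

Lemma is_derive_fN f x a : is_derive x 1 f a -> is_derive x 1 (fun t => - f t) (- a).
Proof. by move=> ?; exact: is_deriveN. Qed.

Lemma is_derive_fZ c f x a : is_derive x 1 f a -> is_derive x 1 (fun t => c * f t) (c * a).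
Proof. by move=> ?; exact: is_deriveZ. Qed.

Lemma is_derive_cexp (g : R -> R[i]) x (dg : R[i]) :
  is_derive x 1 (fun t => Re (g t)) (Re dg) ->
  is_derive x 1 (fun t => Im (g t)) (Im dg) ->
  is_derive x 1 (fun t => Re (cexp (g t))) (Re (dg * cexp (g x))) /\
  is_derive x 1 (fun t => Im (cexp (g t))) (Im (dg * cexp (g x))).
Proof.
move=> d1 d2.
have de := is_derive_fcomp (is_derive_expR (Re (g x))) d1.
have dc := is_derive_fcomp (is_derive_cos (Im (g x))) d2.
have ds := is_derive_fcomp (is_derive_sin (Im (g x))) d2.
split.
  move: (is_derive_fM de dc); set v := (X in is_derive _ _ _ X -> _).
  by have -> : Re (dg * cexp (g x)) = v by rewrite /v ReM /=; ring.
move: (is_derive_fM de ds); set v := (X in is_derive _ _ _ X -> _).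
by have -> : Im (dg * cexp (g x)) = v by rewrite /v ImM /=; ring.
Qed.

Lemma is_derive_continuous f x a : is_derive x 1 f a -> {for x, continuous f}.
Proof.
by move=> [d _]; apply: differentiable_continuous; apply/derivable1_diffP.
Qed.
End derivatives.

Section complex_FTC.
Context (R : realType).
Local Notation TR := (measurableTypeR R).
Local Notation leb := (@lebesgue_measure R).
Variables (I : interval R) (a b : R^nat).
Hypotheses (ab : forall n, a n < b n)
  (ndab : forall n m, (n <= m)%N -> a m <= a n /\ b n <= b m)
  (abI : forall n x, a n <= x <= b n -> x \in I)
  (Iab : forall x, x \in I -> exists n, a n <= x <= b n).

Lemma cvg_normc0 (u : nat -> R[i]) : normc (u n) @[n --> \oo] --> (0 : R) ->
  (Re (u n) @[n --> \oo] --> (0 : R)) /\ (Im (u n) @[n --> \oo] --> (0 : R)).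
Proof.
move=> h; split; apply: norm_cvg0; apply: (squeeze_cvgr _ (cvg_cst 0) h); apply: nearW => n;
  by rewrite normr_ge0 ?Re_le_normc ?Im_le_normc.
Qed.

(** Integration by parts in the form used for all recursions below: the derivative of [cexp (g x)]
    has integral 0 if the boundary terms vanish, and their modulus [expR (Re (g x))] sees only the
    real part of [g]. *)
Lemma complex_FTC (g dg : R -> R[i]) v :
  (forall x, x \in I -> is_derive x 1 (fun t => Re (g t)) (Re (dg x))) ->
  (forall x, x \in I -> is_derive x 1 (fun t => Im (g t)) (Im (dg x))) ->
  (forall x, x \in I -> {for x, continuous (fun t => Re (dg t))}) ->
  (forall x, x \in I -> {for x, continuous (fun t => Im (dg t))}) ->
  has_cint leb (fun x => ((x \in I)%:R : R)%:C * (dg x * cexp (g x))) v ->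
  expR (Re (g (a n))) @[n --> \oo] --> (0 : R) ->
  expR (Re (g (b n))) @[n --> \oo] --> (0 : R) -> v = 0.
Proof.
move=> d1 d2 c1 c2 hv ga gb.
have dE x (xI : x \in I) := is_derive_cexp (d1 x xI) (d2 x xI).
have cE1 x : x \in I -> {for x, continuous (fun t => Re (cexp (g t)))}.
  by move=> xI; exact: (is_derive_continuous (dE x xI).1).
have cE2 x : x \in I -> {for x, continuous (fun t => Im (cexp (g t)))}.
  by move=> xI; exact: (is_derive_continuous (dE x xI).2).
have [i1 i2] := has_cint_integrable hv.
have na : normc (cexp (g (a n))) @[n --> \oo] --> (0 : R).
  by under eq_fun do rewrite normc_cexp.
have nb : normc (cexp (g (b n))) @[n --> \oo] --> (0 : R).
  by under eq_fun do rewrite normc_cexp.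
have [a1 a2] := cvg_normc0 na; have [b1 b2] := cvg_normc0 nb.
have mk (h : R -> R) : leb.-integrable setT (fun x => ((x \in I)%:R * h x)%:E) ->
    leb.-integrable [set` I] (EFin \o h).
  move=> hi; apply: (@eq_integrable _ _ _ leb _ (measurable_itv I)
    (fun x => ((x \in I)%:R * h x)%:E)).
  - by move=> x; rewrite inE/= => ->; rewrite mul1r.
  - apply: integrableS hi => //; exact: measurable_itv.
have mkE (h : R -> R) : (\int[leb]_x ((x \in I)%:R * h x)%:E =
    \int[leb]_(x in [set` I]) (h x)%:E)%E.
  rewrite [RHS]integral_mkcond; apply: eq_integral => x _.
  rewrite patchE; have -> : (x \in [set` I]) = (x \in I).
    by apply/idP/idP => [/set_mem|xI]; last exact/mem_set.
  by case: (x \in I); rewrite ?mul1r ?mul0r.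
have [_ _ e1 e2] := hv.
apply: eqc.
- have /= := improper_FTC ab ndab abI Iab (fun x xI => (dE x xI).1) _ _ a1 b1.
  rewrite subr0 => h; have {h} : (Re v)%:E = 0%:E; last by move=> [].
  rewrite -e1; under eq_integral do rewrite ReMl.
  rewrite mkE h; first by [].
    move=> x xI; rewrite (funext (fun t => ReM (dg t) (cexp (g t)))).
    by apply: continuousB; apply: continuousM; [exact: c1|exact: cE1|exact: c2|exact: cE2].
  apply: (mk (fun x => Re (dg x * cexp (g x)))).
  by move: i1; under eq_fun do rewrite ReMl.
- have /= := improper_FTC ab ndab abI Iab (fun x xI => (dE x xI).2) _ _ a2 b2.
  rewrite subr0 => h; have {h} : (Im v)%:E = 0%:E; last by move=> [].
  rewrite -e2; under eq_integral do rewrite ImMl.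
  rewrite mkE h; first by [].
    move=> x xI; rewrite (funext (fun t => ImM (dg t) (cexp (g t)))).
    by apply: continuousD; apply: continuousM; [exact: c1|exact: cE2|exact: c2|exact: cE1].
  apply: (mk (fun x => Im (dg x * cexp (g x)))).
  by move: i2; under eq_fun do rewrite ImMl.
Qed.

End complex_FTC.

Section exhaustions.
Context (R : realType).

(** From [e^x >= x] one gets [expR (h n) <= e^K / (c (n + 1))]. *)
Lemma cvg_expR_linear (h : R^nat) (c K : R) : 0 < c ->
  (forall n, h n <= K - c * n.+1%:R) -> expR (h n) @[n --> \oo] --> (0 : R).
Proof.
move=> c0 hK.
have lim : (expR K * c^-1 * n.+1%:R^-1) @[n --> \oo] --> (0 : R).
  rewrite -(mulr0 (expR K * c^-1)); apply: cvgMr; exact: cvg_harmonic.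
apply: (squeeze_cvgr _ (cvg_cst 0) lim); apply: nearW => n.
rewrite expR_ge0/=; apply: (@le_trans _ _ (expR (K - c * n.+1%:R))).
  by rewrite ler_expR.
rewrite expRB -!mulrA ler_pM2l ?expR_gt0// -invfM lef_pV2 ?posrE ?mulr_gt0 ?expR_gt0//.
by apply: le_trans (expR_ge1Dx _); rewrite lerDr.
Qed.

(** Exponential endpoints make the logarithm of an endpoint linear in [n], the shape that
    [cvg_expR_linear] requires of boundary terms given by powers. *)
Definition exhaustT_lo (n : nat) : R := - expR n.+1%:R.
Definition exhaust_hi (n : nat) : R := expR n.+1%:R.
Definition exhaust0_lo (n : nat) : R := expR (- n.+1%:R).

Lemma exhaustT : [/\ forall n, exhaustT_lo n < exhaust_hi n,
  forall n m, (n <= m)%N -> exhaustT_lo m <= exhaustT_lo n /\ exhaust_hi n <= exhaust_hi m,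
  forall n x, exhaustT_lo n <= x <= exhaust_hi n -> x \in `]-oo, +oo[ &
  forall x, x \in `]-oo, +oo[ -> exists n, exhaustT_lo n <= x <= exhaust_hi n].
Proof.
rewrite /exhaustT_lo /exhaust_hi; split => //.
- by move=> n; rewrite (@lt_trans _ _ 0) ?oppr_lt0 ?expR_gt0.
- by move=> n m nm; rewrite lerN2 !ler_expR !ler_nat ltnS.
- move=> x _; exists (Num.truncn `|x|); rewrite -ler_norml.
  apply: (le_trans (ltW (truncnS_gt _))).
  by apply: le_trans (expR_ge1Dx _); rewrite lerDr.
Qed.

Lemma exhaust0 : [/\ forall n, exhaust0_lo n < exhaust_hi n,
  forall n m, (n <= m)%N -> exhaust0_lo m <= exhaust0_lo n /\ exhaust_hi n <= exhaust_hi m,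
  forall n x, exhaust0_lo n <= x <= exhaust_hi n -> x \in `]0, +oo[ &
  forall x, x \in `]0, +oo[ -> exists n, exhaust0_lo n <= x <= exhaust_hi n].
Proof.
rewrite /exhaust0_lo /exhaust_hi; split.
- by move=> n; rewrite ltr_expR gtrN.
- by move=> n m nm; rewrite !ler_expR lerN2 !ler_nat ltnS.
- by move=> n x /andP[+ _]; rewrite in_itv/= andbT; apply: lt_le_trans; rewrite expR_gt0.
- move=> x; rewrite in_itv/= andbT => x0; exists (Num.truncn `|ln x|).
  rewrite -{2 3}(lnK x0) !ler_expR -ler_norml.
  exact: ltW (truncnS_gt _).
Qed.
End exhaustions.

(** * Gamma, Dirichlet and beta integrals *)

Section restriction.
Context d (T : measurableType d) (R : realType).
Variable mu : {measure set T -> \bar R}.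

Lemma cintegral_setT (D : set T) (f : T -> R[i]) :
  cintegral mu D f = cintegral mu setT (fun x => ((x \in D)%:R : R)%:C * f x).
Proof.
by apply: eqc; rewrite /cintegral/= Rintegral_mkcond; apply: eq_Rintegral => x _;
  rewrite patchE ?ReMl ?ImMl; case: (x \in D); rewrite ?mul1r ?mul0r.
Qed.

Lemma has_cint_set (D : set T) (f : T -> R[i]) v : measurable D ->
  has_cint mu (fun x => ((x \in D)%:R : R)%:C * f x) v ->
  abs_convergent mu D f /\ cintegral mu D f = v.
Proof.
move=> mD hf; have [[m1 m2] fi _ _] := hf; split; last first.
  by rewrite cintegral_setT; exact: has_cint_cintegral.
split.
- apply/(measurable_restrictT _ mD).
  rewrite (_ : _ \_ _ = (fun x => Re (((x \in D)%:R : R)%:C * f x)))//.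
  by apply/funext => x; rewrite patchE ReMl; case: (x \in D); rewrite ?mul1r ?mul0r.
- apply/(measurable_restrictT _ mD).
  rewrite (_ : _ \_ _ = (fun x => Im (((x \in D)%:R : R)%:C * f x)))//.
  by apply/funext => x; rewrite patchE ImMl; case: (x \in D); rewrite ?mul1r ?mul0r.
- rewrite integral_mkcond; move: fi; congr (_ < _)%E; apply: eq_integral => x _.
  rewrite patchE Normc.normcM normcR.
  by case: (x \in D); rewrite ?normr1 ?normr0 ?mul1r ?mul0r.
Qed.

Lemma has_cintN_Re (f g : T -> R[i]) v w : has_cint mu f v -> has_cint mu g w ->
  (forall x, normc (f x) = Re (g x)) -> has_cintN mu f v (Re w).
Proof.
by move=> hf [_ _ e _] fg; split => //; rewrite -e; apply: eq_integral => x _; rewrite fg.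
Qed.

Lemma eq_has_cint (f g : T -> R[i]) v w : f =1 g -> v = w ->
  has_cint mu f v -> has_cint mu g w.
Proof. by move=> /funext -> ->. Qed.
End restriction.

(** * Euler's integral: convergence, functional equation, positivity *)

Section gamma.
Context (R : realType).
Local Notation TR := (measurableTypeR R).
Local Notation leb := (@lebesgue_measure R).
Implicit Types (z s : R[i]) (x t c : R).

Definition pos (t : R) : R := (0 < t)%R%:R.

Lemma measurable_pos d (T : measurableType d) (f : T -> R) :
  measurable_fun setT f -> measurable_fun setT (fun u => pos (f u)).
Proof.
move=> mf; rewrite /pos.
rewrite (_ : (fun _ => _) = (fun u => if 0 < f u then 1 else 0 : R)).
  by apply: measurable_fun_ifT => //; exact: measurable_fun_ltr.
by apply/funext => u; case: ifP.
Qed.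

Lemma pos_ge0 t : 0 <= pos t. Proof. exact: ler0n. Qed.

Lemma pos_itv t : (t \in `]0, +oo[%classic)%:R = pos t.
Proof.
rewrite /pos; congr (_%:R); congr nat_of_bool.
by apply/idP/idP => [/set_mem/=|t0]; [|apply/mem_set => /=]; rewrite in_itv/= andbT.
Qed.

Lemma continuous_inv (f : R -> R) x : {for x, continuous f} -> f x != 0 ->
  {for x, continuous (fun t => (f t)^-1)}.
Proof. by move=> cf fx; exact: (cvgV fx cf). Qed.

(** [t^(z-1) e^(-c t)] as a single exponential. The rate [c] is needed in the Dirichlet integral,
    where it is first the radial variable and then [1 + \sum v]. *)
Definition gamma_kernel c z t : R[i] := cexp ((z - 1) * (ln t)%:C - (c * t)%:C).

Lemma cmeas_gamma_kernel c z : cmeas (fun t : TR => (pos t)%:C * gamma_kernel c z t).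
Proof.
apply: cmeasM; first by apply: cmeas_real; exact: measurable_pos.
apply: cmeas_cexp; apply: cmeasD.
  apply: cmeasM; first exact: cmeas_cst.
  by apply: cmeas_real; exact: (@measurable_ln R).
rewrite (_ : (fun _ => _) = (fun t : TR => ((- c) * t)%:C)); last first.
  by apply/funext => t; rewrite mulNr rmorphN.
by apply: cmeas_real; exact: measurable_funM.
Qed.

Lemma normc_gamma_kernel c z t :
  normc ((pos t)%:C * gamma_kernel c z t) =
  Re ((pos t)%:C * gamma_kernel c (Re z)%:C t).
Proof.
rewrite Normc.normcM normcR ger0_norm ?pos_ge0// normc_cexp ReMl; congr (_ * _).
rewrite /gamma_kernel -(rmorph1 (real_complex R)) -rmorphB -rmorphM -rmorphB cexpR /=.
by rewrite ReB ReM /= mulr0 subr0 ReB.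
Qed.

(** The majorant is a multiple of the derivative of [atan (t^x)], a bounded primitive that covers
    both ends of the half-line. The constant comes from [t^(2x) e^(-t) <= (2x)^(2x)], which is
    [ln u < u] at [u = t / (2x)]. *)
Lemma gamma_kernel_bound (x t : R) : 0 < x -> 0 < t ->
  expR ((x - 1) * ln t - t) <=
  ((1 + expR (2 * x * ln (2 * x))) / x) *
  ((1 + expR (x * ln t) ^+ 2)^-1 * (expR (x * ln t) * (x * t^-1))).
Proof.
move=> x0 t0; set E := expR (x * ln t).
have E0 : 0 < E by rewrite expR_gt0.
have -> : expR ((x - 1) * ln t - t) = E * t^-1 * expR (- t).
  by rewrite mulrBl mul1r 2!expRD [expR (- ln t)]expRN lnK ?posrE.
have -> : (1 + expR (2 * x * ln (2 * x))) / x * ((1 + E ^+ 2)^-1 * (E * (x * t^-1))) =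
   E * t^-1 * ((1 + expR (2 * x * ln (2 * x))) / (1 + E ^+ 2)).
  field; rewrite !gt_eqF//; by rewrite ltr_pwDl// sqr_ge0.
rewrite ler_pM2l ?mulr_gt0 ?invr_gt0// ler_pdivlMr; last by rewrite ltr_pwDl// sqr_ge0.
rewrite mulrDr mulr1 lerD//; first by rewrite -expR0 ler_expR oppr_le0 ltW.
rewrite /E -expRM_natl -expRD ler_expR.
have : ln (t / (2 * x)) < t / (2 * x) by apply: ln_sublinear; rewrite divr_gt0 ?mulr_gt0.
rewrite ln_div ?posrE ?mulr_gt0// ltr_pdivlMr ?mulr_gt0// => h; rewrite -[2%:R]/2; lra.
Qed.

Lemma gamma_integral_finite x : 0 < x ->
  (\int[leb]_t (pos t * expR ((x - 1) * ln t - t))%:E < +oo)%E.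
Proof.
move=> x0; have [ab ndab abI Iab] := exhaust0 R.
pose K := (1 + expR (2 * x * ln (2 * x))) / x.
pose f t := (1 + expR (x * ln t) ^+ 2)^-1 * (expR (x * ln t) * (x * t^-1)).
have K0 : 0 <= K by rewrite divr_ge0 ?ltW// addr_ge0// expR_ge0.
have dE t : 0 < t -> is_derive t 1 (fun t => expR (x * ln t)) (expR (x * ln t) * (x * t^-1)).
  move=> t0; apply: is_derive_fcomp; apply: is_derive_fZ; exact: is_derive1_ln.
have mE : measurable_fun setT (fun t : TR => expR (x * ln t) : TR).
  apply: (measurableT_comp (@measurable_expR R)).
  exact: (measurable_funM (measurable_cst x) (@measurable_ln R)).
have mf : measurable_fun [set: TR] (f : TR -> TR).
  apply: measurable_funM.
    apply: measurable_fun_inv; apply: measurable_funD => //; exact: measurable_funX.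
  by apply: measurable_funM => //; apply: measurable_funM => //; exact: measurable_fun_inv.
have f0 t : 0 < t -> 0 <= f t.
  move=> t0; rewrite /f mulr_ge0 ?invr_ge0 ?addr_ge0 ?sqr_ge0//.
  by rewrite !mulr_ge0 ?expR_ge0 ?invr_ge0 ?ltW.
have fi : (\int[leb]_(t in [set` `]0%R, +oo[]) (f t)%:E < +oo)%E.
  apply: (ge0_bounded_primitive ab ndab abI Iab (F := fun t => atan (expR (x * ln t)))
    (M := pi / 2) _ _ _ _ mf).
  - move=> t; rewrite in_itv/= andbT => t0.
    by apply: (is_derive_fcomp _ (dE _ t0)); exact: is_derive1_atan.
  - move=> t; rewrite in_itv/= andbT => t0.
    have cE := is_derive_continuous (dE _ t0).
    apply: continuousM.
      apply: continuous_inv; last by rewrite gt_eqF// ltr_pwDl// sqr_ge0.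
      by apply: continuousD; [exact: cst_continuous|apply: continuousM].
    apply: continuousM => //; apply: continuousM; first exact: cst_continuous.
    by apply: continuous_inv; rewrite ?gt_eqF//; exact: cvg_id.
  - by move=> t; rewrite in_itv/= andbT; exact: f0.
  - by move=> t _; exact: ltW (atan_bound _).
apply: (@le_lt_trans _ _ (\int[leb]_t (K%:E * ((pos t * f t)%:E)))%E).
  apply: ge0_le_integral => //.
  - by move=> t _; rewrite lee_fin mulr_ge0 ?pos_ge0 ?expR_ge0.
  - apply/measurable_EFinP; apply: measurable_funM; first exact: measurable_pos.
    apply: (measurableT_comp (@measurable_expR R)); apply: measurable_funB => //.
    exact: (measurable_funM (measurable_cst (x - 1)) (@measurable_ln R)).
  - apply/measurable_EFinP; apply: measurable_funM => //.
    by apply: measurable_funM => //; exact: measurable_pos.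
  - move=> t _; rewrite lee_fin /pos; case: ltP => t0; last by rewrite !mul0r mulr0.
    by rewrite !mul1r; exact: gamma_kernel_bound.
rewrite ge0_integralZl//.
- apply: lte_mul_pinfty => //.
  rewrite (_ : integral _ _ _ = \int[leb]_(t in [set` `]0%R, +oo[]) (f t)%:E)%E//.
  rewrite [RHS]integral_mkcond; apply: eq_integral => t _.
  by rewrite patchE -pos_itv; case: (t \in _); rewrite ?mul1r ?mul0r.
- by apply/measurable_EFinP; apply: measurable_funM => //; exact: measurable_pos.
- move=> t _; rewrite lee_fin /pos; case: ltP => t0; last by rewrite mul0r.
  by rewrite mul1r f0.
Qed.

Lemma Gamma_has_cint1 z : 0 < Re z ->
  has_cint leb (fun t : TR => (pos t)%:C * gamma_kernel 1 z t) (Gamma z).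
Proof.
move=> z0; rewrite Gamma_euler// /euler_integral cintegral_setT.
have -> : (fun t : TR => ((t \in `]0, +oo[%classic)%:R : R)%:C *
    (cpow t%:C (z - 1) * (expR (- t))%:C)) =
    (fun t : TR => (pos t)%:C * gamma_kernel 1 z t).
  apply/funext => t; rewrite pos_itv /pos; case: ltP => t0; last by rewrite !mul0r.
  by rewrite !mul1r cpowR// /gamma_kernel mul1r cexpD -cexpR rmorphN.
apply: cmeas_has_cint; first exact: cmeas_gamma_kernel.
apply: le_lt_trans (gamma_integral_finite z0); rewrite le_eqVlt; apply/orP; left; apply/eqP; apply: eq_integral => t _.
rewrite normc_gamma_kernel ReMl /gamma_kernel; congr (_ * _)%:E.
by rewrite -(rmorph1 (real_complex R)) -rmorphB -rmorphM -rmorphB cexpR /= mul1r.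
Qed.

Lemma Gamma_has_cint c z : 0 < c -> 0 < Re z ->
  has_cint leb (fun t : TR => (pos t)%:C * gamma_kernel c z t)
    (Gamma z * cexp (- z * (ln c)%:C)).
Proof.
move=> c0 z0.
have mc : measurable_fun setT (fun t : TR => (c * t : TR)) by exact: measurable_funM.
have := (@has_cint_transfer _ _ _ _ R leb leb (fun t : TR => c * t : TR) (cst c) (cst 1)
  (fun=> ltW c0) (fun=> ler01) mc (measurable_cst _) (measurable_cst _) _
  (fun t : TR => (pos t)%:C * gamma_kernel 1 z t) (Gamma z) (cmeas_gamma_kernel _ _)).
have hT (g : TR -> \bar R) : measurable_fun setT g -> (forall y, 0 <= g y)%E ->
    (\int[leb]_x (g (c * x)%R * (cst c x)%:E) = \int[leb]_y (g y * (cst 1 y)%:E))%E.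
  by move=> mg g0; rewrite (ge0_integral_scale1 c0)//; apply: eq_integral => x _; rewrite mule1.
move=> /(_ hT) [+ _].
have {}hG : has_cint leb (fun y : TR => (cst 1 y : R)%:C * ((pos y)%:C * gamma_kernel 1 z y)) (Gamma z).
  by apply: eq_has_cint (Gamma_has_cint1 z0) => // t; rewrite mul1r.
move=> /(_ hG) /(has_cintZ (cexp (- z * (ln c)%:C))).
apply: eq_has_cint => [t|]; last by rewrite mulrC.
rewrite /pos pmulr_rgt0//; case: ltP => t0; last by rewrite !(mul0r, mulr0).
have -> : (cst c t)%:C = cexp ((ln c)%:C) :> R[i] by rewrite cexpR lnK.
rewrite !mul1r /gamma_kernel mul1r -!cexpD lnE_pos//.
by congr cexp; rewrite rmorphD; ring.
Qed.

Lemma Gamma_has_cintN c z : 0 < c -> 0 < Re z ->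
  has_cintN leb (fun t : TR => (pos t)%:C * gamma_kernel c z t)
    (Gamma z * cexp (- z * (ln c)%:C))
    (Re (Gamma (Re z)%:C * cexp (- (Re z)%:C * (ln c)%:C))).
Proof.
move=> c0 z0; apply: has_cintN_Re; first exact: Gamma_has_cint.
- exact: Gamma_has_cint.
- by move=> t; exact: normc_gamma_kernel.
Qed.

(** The derivative of [t^z e^(-t)] integrates to 0. *)
Lemma Gamma_shift_pos z : 0 < Re z -> Gamma (z + 1) = z * Gamma z.
Proof.
move=> z0; have [ab ndab abI Iab] := exhaust0 R.
have z10 : 0 < Re (z + 1) by rewrite ReD addr_gt0 /= ?ltr01.
apply/eqP; rewrite eq_sym -subr_eq0; apply/eqP.
pose g (t : R) : R[i] := z * (ln t)%:C - t%:C.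
pose dg (t : R) : R[i] := z * (t^-1)%:C - 1.
refine (complex_FTC ab ndab abI Iab (g := g) (dg := dg) _ _ _ _ _ _ _).
- move=> t; rewrite in_itv/= andbT => t0.
  have := is_derive_fD (is_derive_fZ (Re z) (is_derive1_ln t0)) (is_derive_fN (is_derive_id t 1)).
  rewrite /dg ReB ReM /= mulr0 subr0.
  by congr (is_derive _ _ _ _); apply/funext => u; rewrite /g ReB ReM /= mulr0 subr0.
- move=> t; rewrite in_itv/= andbT => t0.
  have := is_derive_fZ (Im z) (is_derive1_ln t0).
  rewrite /dg ImB ImM /= mulr0 add0r subr0.
  by congr (is_derive _ _ _ _); apply/funext => u; rewrite /g ImB ImM /= mulr0 add0r subr0.
- move=> t; rewrite in_itv/= andbT => t0.
  rewrite (_ : (fun _ => _) = (fun t => Re z * t^-1 - 1)); last first.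
    by apply/funext => u; rewrite /dg ReB ReM /= mulr0 subr0.
  apply: continuousB; last exact: cst_continuous.
  apply: continuousM; first exact: cst_continuous.
  by apply: continuous_inv; rewrite ?gt_eqF//; exact: cvg_id.
- move=> t; rewrite in_itv/= andbT => t0.
  rewrite (_ : (fun _ => _) = (fun t => Im z * t^-1)); last first.
    by apply/funext => u; rewrite /dg ImB ImM /= mulr0 add0r subr0.
  apply: continuousM; first exact: cst_continuous.
  by apply: continuous_inv; rewrite ?gt_eqF//; exact: cvg_id.
- have := has_cintD (has_cintZ z (Gamma_has_cint1 z0)) (has_cint_opp (Gamma_has_cint1 z10)).
  apply: eq_has_cint => // t; rewrite in_itv/= andbT /pos.
  case: ltP => t0; last by rewrite !(mul0r, mulr0) oppr0 addr0.
  rewrite /dg /g !mul1r /gamma_kernel mul1r.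
  have -> : (t^-1)%:C = cexp (- (ln t)%:C) :> R[i].
    by rewrite -rmorphN cexpR expRN lnK.
  by rewrite [RHS]mulrBl -[in RHS]mulrA -cexpD mul1r; congr (z * cexp _ - cexp _); ring.
- apply: (cvg_expR_linear (c := Re z) (K := 0)) => // n.
  rewrite /g ReB ReM /= mulr0 subr0 /exhaust0_lo expRK add0r mulrN lerBlDr lerDl.
  exact: expR_ge0.
(* By [ln u < u] at [u = t / (2 Re z)], the power costs at most [t / 2] plus the constant
   [Re z ln (2 Re z)]; the other half of [t] remains for decay. *)
- apply: (cvg_expR_linear (c := 2^-1) (K := Re z * ln (2 * Re z))) => // n.
  rewrite /g ReB ReM /= mulr0 subr0 /exhaust_hi expRK.
  set t := expR n.+1%:R.
  have : ln (t / (2 * Re z)) < t / (2 * Re z).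
    by apply: ln_sublinear; rewrite divr_gt0 ?mulr_gt0 ?expR_gt0.
  rewrite ln_div ?posrE ?mulr_gt0 ?expR_gt0// ltr_pdivlMr ?mulr_gt0// expRK => h.
  have : n.+1%:R <= t by apply: le_trans (expR_ge1Dx _); rewrite lerDr.
  lra.
Qed.

(** This holds on the whole plane, poles included: for [Re z <= 0] the number of steps to the right
    half-plane drops by one from [z] to [z + 1], and the product in the definition loses its factor
    [z]. It carries Cauchy's formula to parameters of nonpositive real part. *)
Lemma invGamma_shift z : (Gamma z)^-1 = z * (Gamma (z + 1))^-1.
Proof.
have [z0|z0] := ltP 0 (Re z).
  rewrite Gamma_shift_pos// (invfM z) mulVKf//.
  by apply: contraTneq z0 => ->; rewrite /= ltxx.
rewrite /Gamma ReD /=.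
have e : Num.truncn (1 - Re z) = (Num.truncn (1 - (Re z + 1))).+1.
  have h0 : 0 <= - Re z by rewrite oppr_ge0.
  rewrite opprD addrCA subrr addr0.
  by rewrite (truncnD (rpred1 _) h0) truncn1 add1n.
rewrite e; set m := Num.truncn _.
rewrite big_nat_recl// addr0 -natr1 [m%:R + 1]addrC addrA !invf_div.
rewrite mulrA; congr (_ / _); congr (_ * _).
by apply: eq_bigr => k _; rewrite -natr1 [k%:R + 1]addrC addrA.
Qed.

Lemma Gamma_real_gt0 x : 0 < x -> 0 < Re (Gamma x%:C).
Proof.
move=> x0; have [_ _ e _] := @Gamma_has_cint1 x%:C x0.
(* On [[1, 2]] both [ln t] and [t] are at most 2 and [ln t >= 0], so the exponent [(x - 1) ln t - t]
   is at least [- 2 |x - 1| - 2]. *)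
pose c := expR (- (2 * `|x - 1|) - 2).
have h : (\int[leb]_t (c * \1_(`[1%R, 2%R]%classic : set TR) t)%:E <=
    \int[leb]_t (Re ((pos t)%:C * gamma_kernel 1 x%:C t))%:E)%E.
  apply: ge0_le_integral => //.
  - by move=> t _; rewrite lee_fin mulr_ge0 ?expR_ge0.
  - by apply/measurable_EFinP; apply: measurable_funM => //; exact: measurable_indic.
  - by apply/measurable_EFinP; case: (cmeas_gamma_kernel 1 x%:C).
  - move=> t _; rewrite lee_fin indicE ReMl /gamma_kernel.
    rewrite -(rmorph1 (real_complex R)) -rmorphB -rmorphM -rmorphB cexpR /= mul1r.
    have [/set_mem/=|_] := boolP (t \in _); last by rewrite mulr0 mulr_ge0 ?pos_ge0 ?expR_ge0.
    rewrite in_itv/= => /andP[t1 t2]; have t0 : 0 < t by rewrite (lt_le_trans ltr01).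
    rewrite mulr1 /pos t0 mul1r ler_expR.
    have l0 : 0 <= ln t by exact: ln_ge0.
    have l1 : ln t <= 2 by apply: le_trans t2; rewrite ltW// ln_sublinear.
    apply: lerB => //; rewrite lerNl -mulNr (le_trans (ler_norm _))// normrM normrN.
    by rewrite mulrC ler_pM// ger0_norm.
rewrite -lte_fin -e; apply: lt_le_trans h.
under eq_integral do rewrite EFinM.
rewrite integralZl//; last by apply: integrable_indic_itv.
have l12 : (leb `[1%R, 2%R]%classic = 1%:E)%E.
  by rewrite lebesgue_measure_itv/= lte_fin ltr1n -EFinB; congr _%:E; lra.
have -> : (\int[leb]_t (\1_(`[1%R, 2%R]%classic : set TR) t)%:E = 1%:E)%E.
  by rewrite integral_indic// setIT; exact: l12.
by rewrite -EFinM lte_fin mulr_gt0 ?expR_gt0//; lra.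
Qed.

Lemma Gamma_real_neq0 x : 0 < x -> Gamma x%:C != 0 :> R[i].
Proof. by move=> /Gamma_real_gt0; apply: contraTneq => ->; rewrite /= ltxx. Qed.

End gamma.

(** * The Dirichlet integral over the positive orthant, and the beta integral *)

Section dirichlet.
Context (R : realType).
Local Notation TR := (measurableTypeR R).
Local Notation leb := (@lebesgue_measure R).
Local Notation mu := (@tuple_lebesgue R).
Implicit Types (th : seq R[i]) (v : seq R).

Lemma has_cintN0 d (T : measurableType d) (m : {measure set T -> \bar R}) :
  has_cintN m (fun=> 0) 0 0.
Proof.
have n0 : (\int[m]_x (normc (0 : R[i]))%:E = 0)%E.
  by apply: integral0_eq => x _; rewrite Normc.normc0.
by split => //; split; rewrite ?n0 ?ltry//; exact: integral0_eq.
Qed.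

Lemma has_cintNZ d (T : measurableType d) (m : {measure set T -> \bar R})
    (c : R[i]) (f : T -> R[i]) (w : R[i]) M :
  has_cintN m f w M -> has_cintN m (fun x => c * f x) (c * w) (normc c * M).
Proof.
move=> [hf fM]; split; first exact: has_cintZ.
under eq_integral do rewrite Normc.normcM EFinM.
rewrite ge0_integralZl_EFin ?normc_ge0 ?fM//.
- by move=> x _; rewrite lee_fin normc_ge0.
- by apply/measurable_EFinP; apply: cmeas_normc; case: hf.
Qed.

Lemma has_cintN_tupleS N (f : seq R -> R[i]) (w : R[i]) M : tcmeas N.+1 f ->
  has_cintN (leb \x mu N)%E (fun z : TR * N.-tuple TR => f (z.1 :: z.2)) w M ->
  has_cintN (mu N.+1) (fun t : N.+1.-tuple TR => f t) w M.
Proof.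
move=> mf [hf hM]; split; first exact/(has_cint_tupleS _ mf).
rewrite (ge0_integral_tupleP (g := fun t => (normc (f t))%:E))//.
- by apply/measurable_EFinP; exact: cmeas_normc.
- by move=> t; rewrite lee_fin normc_ge0.
Qed.

Lemma big_zip_nth (I J : Type) (i0 : I) (j0 : J) (r : seq I) (s : seq J) (F : I * J -> R[i]) :
  size r = size s ->
  \prod_(p <- zip r s) F p = \prod_(0 <= i < size s) F (nth i0 r i, nth j0 s i).
Proof.
move=> rs; rewrite (big_nth (i0, j0)) size_zip rs minnn.
by apply: eq_big_nat => i /andP[_ ilt]; rewrite nth_zip.
Qed.

Lemma tcmeas_nth N i (f : R -> R[i]) : cmeas (f : TR -> R[i]) ->
  tcmeas N (fun v => f (nth 0 v i)).
Proof. by move=> mf; exact: (cmeas_comp mf (@measurable_nth R N i)). Qed.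

Lemma tcmeas_prod_zip N th (F : R[i] -> R -> R[i]) : size th = N ->
  (forall t, cmeas (F t : TR -> R[i])) ->
  tcmeas N (fun v => \prod_(p <- zip th v) F p.1 p.2).
Proof.
move=> sth mF; rewrite /tcmeas.
rewrite (_ : (fun _ => _) = (fun v : N.-tuple TR =>
    \prod_(0 <= i < N) F (nth 0 th i) (nth 0 v i))); last first.
  by apply/funext => v; rewrite (big_zip_nth 0 0) size_tuple.
by apply: cmeas_prod => i; exact: tcmeas_nth.
Qed.

Definition gammas_kernel c th v : R[i] :=
  \prod_(p <- zip th v) ((pos p.2)%:C * gamma_kernel c p.1 p.2).

(** The norm is recorded as a function of [c], because [c] becomes the variable of an outer
    integration. *)
Lemma gammas_has_cintN N c th : 0 < c -> size th = N -> all (fun t => 0 < Re t) th ->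
  has_cintN (mu N) (fun v : N.-tuple TR => gammas_kernel c th v)
    (\prod_(t <- th) (Gamma t * cexp (- t * (ln c)%:C)))
    (\prod_(t <- th) (Re (Gamma (Re t)%:C) * expR (- Re t * ln c))).
Proof.
move=> c0; elim: N th => [|N IH] [|t th]//=.
  move=> _ _; have := has_cint_tuple0 (gammas_kernel c [::]).
  by rewrite /gammas_kernel /= !big_nil Normc.normc1.
move=> [sth] /andP[t0 th0].
have mm n th' : size th' = n -> tcmeas n (gammas_kernel c th').
  move=> sth'; apply: (tcmeas_prod_zip (F := fun t x => (pos x)%:C * gamma_kernel c t x)) => // t'.
  exact: cmeas_gamma_kernel.
have mS : tcmeas N.+1 (gammas_kernel c (t :: th)) by apply: mm; rewrite /= sth.
apply: has_cintN_tupleS => //.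
have [hG hGN] := Gamma_has_cintN c0 t0.
pose V := \prod_(t <- th) (Gamma t * cexp (- t * (ln c)%:C)).
pose M := \prod_(t <- th) (Re (Gamma (Re t)%:C) * expR (- Re t * ln c)).
apply: (@has_cintN_prod _ _ _ _ _ _ _ _
  (fun x : TR => ((pos x)%:C * gamma_kernel c t x) * V)
  (fun x : TR => normc ((pos x)%:C * gamma_kernel c t x) * M)).
- apply: (tcmeas_comp (M := N.+1) (Phi := fun z : TR * N.-tuple TR => z.1 :: z.2)) mS.
    by move=> z; rewrite /= size_tuple.
  case=> [|i] _ /=; first exact: measurable_fst.
  exact: (measurableT_comp (@measurable_nth R N i) measurable_snd).
- move=> x; rewrite (_ : (fun _ => _) = (fun y : N.-tuple TR =>
      ((pos x)%:C * gamma_kernel c t x) * gammas_kernel c th y)).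
    exact: has_cintNZ (IH _ sth th0).
  by apply/funext => y; rewrite /gammas_kernel /= big_cons.
- rewrite big_cons -/V; have := has_cintZ V hG.
  by apply: eq_has_cint => [x|]; rewrite mulrC.
- rewrite big_cons -/M.
  under eq_integral do rewrite mulrC EFinM.
  rewrite ge0_integralZl_EFin.
  + rewrite hGN -EFinM mulrC; congr (_ * _)%:E.
    by rewrite -rmorphN -rmorphM cexpR ReM /= mulr0 subr0.
  + by [].
  + by move=> x _; rewrite lee_fin normc_ge0.
  + by apply/measurable_EFinP; apply: cmeas_normc; exact: cmeas_gamma_kernel.
  + rewrite /M big_seq; apply: prodr_ge0 => t' t'th; rewrite mulr_ge0 ?expR_ge0//.
    by apply/ltW/Gamma_real_gt0; exact: (allP th0).
Qed.

(** [\prod v_i^(th_i - 1) (1 + \sum v_i)^(-s)] on the positive orthant: the Dirichlet integrand in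
    unbounded coordinates. *)
Definition dirichlet_kernel s th v : R[i] :=
  (\prod_(p <- zip th v) ((pos p.2)%:C * cexp ((p.1 - 1) * (ln p.2)%:C))) *
  cexp (- s * (ln (1 + \sum_(x <- v) x))%:C).

Lemma tcmeas_sum_ln N (s : R[i]) :
  tcmeas N (fun v => cexp (s * (ln (1 + \sum_(x <- v) x))%:C)).
Proof.
apply: cmeas_cexp; apply: cmeasM; first exact: cmeas_cst.
apply: cmeas_real; apply: (measurableT_comp (@measurable_ln R)).
apply: measurable_funD => //.
rewrite (_ : (fun _ => _) = (fun v : N.-tuple TR => \sum_(0 <= i < N) (nth 0 v i : TR))); last first.
  by apply/funext => v; rewrite (big_nth 0) size_tuple.
by apply: measurable_sum => i; exact: measurable_nth.
Qed.

Lemma tcmeas_dirichlet_kernel N s th : size th = N -> tcmeas N (dirichlet_kernel s th).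
Proof.
move=> sth; apply: cmeasM.
  apply: (tcmeas_prod_zip (F := fun t x => (pos x)%:C * cexp ((t - 1) * (ln x)%:C))) => // t.
  apply: cmeasM; first by apply: cmeas_real; exact: measurable_pos.
  apply: cmeas_cexp; apply: cmeasM; first exact: cmeas_cst.
  by apply: cmeas_real; exact: (@measurable_ln R).
exact: tcmeas_sum_ln.
Qed.

Lemma gammas_kernelE c th v : size th = size v ->
  gammas_kernel c th v =
  (\prod_(p <- zip th v) ((pos p.2)%:C * cexp ((p.1 - 1) * (ln p.2)%:C))) *
  cexp (- (c * \sum_(x <- v) x)%:C).
Proof.
elim: th v => [|t th IH] [|x v]//=.
  by rewrite /gammas_kernel !big_nil mulr0 oppr0 cexp0 mulr1.
move=> [e]; rewrite /gammas_kernel /= !big_cons -/(gammas_kernel c th v) IH//=.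
rewrite mulrDr rmorphD opprD cexpD /gamma_kernel cexpD; ring.
Qed.

Lemma prod_pos_eq0 th v : size th = size v -> ~~ all (fun x => 0 < x) v ->
  \prod_(p <- zip th v) ((pos p.2)%:C * cexp ((p.1 - 1) * (ln p.2)%:C)) = 0.
Proof.
elim: th v => [|t th IH] [|x v]//= [e]; rewrite negb_and big_cons /= => /orP[|/(IH _ e) ->].
  by rewrite /pos => /negbTE ->; rewrite !mul0r.
by rewrite mulr0.
Qed.

Lemma sum_pos_gt0 v : all (fun x => 0 < x) v -> 0 < 1 + \sum_(x <- v) x.
Proof.
move=> v0; rewrite ltr_pwDl// big_seq sumr_ge0// => x xv.
by apply: ltW; exact: (allP v0).
Qed.

(** Write [Gamma s (1 + S)^(-s)], where [S] is the sum of [v], as the integral of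
    [r^(s-1) e^(-r(1+S))] over [r > 0]. With [r] fixed the integral over [v] is a product of Gamma
    integrals of rate [r], and what remains in [r] is a Gamma integral with parameter [s - \sum th].
    The factor [Gamma s] stays inside, since it is not yet known to be nonzero. *)
Lemma Gamma_dirichlet_has_cint N s th : size th = N -> all (fun t => 0 < Re t) th ->
  \sum_(t <- th) Re t < Re s ->
  has_cint (mu N) (fun v : N.-tuple TR => Gamma s * dirichlet_kernel s th v)
    ((\prod_(t <- th) Gamma t) * Gamma (s - \sum_(t <- th) t)).
Proof.
move=> sth th0 ss.
have s0 : 0 < Re s.
  apply: le_lt_trans ss; rewrite big_seq sumr_ge0// => t tth.
  by apply: ltW; exact: (allP th0).
have d0 : 0 < Re (s - \sum_(t <- th) t) by rewrite ReB Re_sum subr_gt0.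
pose f (z : N.-tuple TR * TR) : R[i] :=
  ((pos z.2)%:C * gamma_kernel 1 s z.2) * gammas_kernel z.2 th z.1.
have mf : cmeas f.
  have m2 : cmeas (fun z : N.-tuple TR * TR => (pos z.2)%:C * gamma_kernel 1 s z.2).
    exact: (cmeas_comp (cmeas_gamma_kernel 1 s) measurable_snd).
  rewrite (_ : f = (fun z : N.-tuple TR * TR => ((pos z.2)%:C * gamma_kernel 1 s z.2) *
     ((\prod_(p <- zip th z.1) ((pos p.2)%:C * cexp ((p.1 - 1) * (ln p.2)%:C))) *
     cexp ((- (z.2 * \sum_(x <- z.1) x))%:C)))); last first.
    by apply/funext => z; rewrite /f gammas_kernelE ?size_tuple// rmorphN.
  apply: cmeasM => //; apply: cmeasM.
    have mz := tcmeas_prod_zip sth (F := fun t x => (pos x)%:C * cexp ((t - 1) * (ln x)%:C)).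
    apply: (cmeas_comp (mz _) measurable_fst) => t.
    apply: cmeasM; first by apply: cmeas_real; exact: measurable_pos.
    apply: cmeas_cexp; apply: cmeasM; first exact: cmeas_cst.
    by apply: cmeas_real; exact: (@measurable_ln R).
  apply: cmeas_cexp; apply: cmeas_real; apply: measurableT_comp => //.
  apply: measurable_funM => //.
  rewrite (_ : (fun _ => _) = (fun z : N.-tuple TR * TR => \sum_(0 <= i < N) (nth 0 z.1 i : TR))); last first.
    by apply/funext => z; rewrite (big_nth 0) size_tuple.
  apply: measurable_sum => i.
  exact: (measurableT_comp (@measurable_nth R N i) measurable_fst).
have hf : has_cint (mu N \x leb)%E f
    ((\prod_(t <- th) Gamma t) * Gamma (s - \sum_(t <- th) t)).
  (* With [r] outside, the iterated integral and its norm are explicit; the other order is used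
     afterwards to read off the integral over [v]. *)
  apply: has_cint_swap.
  pose k (r : TR) : R[i] := (\prod_(t <- th) Gamma t) *
    ((pos r)%:C * gamma_kernel 1 (s - \sum_(t <- th) t) r).
  pose n (r : TR) : R := (\prod_(t <- th) Re (Gamma (Re t)%:C)) *
    Re ((pos r)%:C * gamma_kernel 1 (Re (s - \sum_(t <- th) t))%:C r).
  have hk : has_cint leb k ((\prod_(t <- th) Gamma t) * Gamma (s - \sum_(t <- th) t)).
    by apply: has_cintZ; exact: Gamma_has_cint1.
  have p0 : 0 <= \prod_(t <- th) Re (Gamma (Re t)%:C).
    rewrite big_seq; apply: prodr_ge0 => t tth.
    by apply/ltW/Gamma_real_gt0; exact: (allP th0).
  have d0' : 0 < Re ((Re (s - \sum_(t <- th) t))%:C) by [].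
  have hn : (\int[leb]_r (n r)%:E = ((\prod_(t <- th) Re (Gamma (Re t)%:C)) *
      Re (Gamma (Re (s - \sum_(t <- th) t))%:C))%:E)%E.
    have [_ _ e _] := Gamma_has_cint1 d0'.
    rewrite EFinM -e -ge0_integralZl_EFin//.
    + move=> r _; rewrite lee_fin -normc_gamma_kernel; exact: normc_ge0.
    + by apply/measurable_EFinP; case: (cmeas_gamma_kernel 1 (Re (s - \sum_(t <- th) t))%:C).
  have msw : measurable_fun setT (fun z : TR * N.-tuple TR => (z.2, z.1)).
    by apply: measurable_fun_pair.
  have [] // := @has_cintN_prod _ _ _ _ _ leb (mu N) (fun z : TR * N.-tuple TR => f (z.2, z.1))
    k n _ _ (cmeas_comp mf msw) _ hk hn.
  move=> r; rewrite /f /=; case: (ltP 0 r) => r0; last first.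
    rewrite /k /n /pos ltNge r0/= !mul0r !mulr0 /=.
    rewrite subrr mulr0; under eq_fun do rewrite mul0r.
    exact: has_cintN0.
  have := has_cintNZ ((pos r)%:C * gamma_kernel 1 s r) (gammas_has_cintN r0 sth th0).
  have e1 : (pos r)%:C * gamma_kernel 1 s r *
     (\prod_(t <- th) (Gamma t * cexp (- t * (ln r)%:C))) = k r.
    rewrite /k big_split/= -cexp_sum mulrCA; congr (_ * _).
    rewrite -mulrA; congr (_ * _).
    rewrite /gamma_kernel -cexpD; congr cexp.
    by rewrite -mulr_suml sumrN; ring.
  have e2 : normc ((pos r)%:C * gamma_kernel 1 s r) *
     (\prod_(t <- th) (Re (Gamma (Re t)%:C) * expR (- Re t * ln r))) = n r.
    have kR (x : R) : Re (gamma_kernel 1 x%:C r) = expR ((x - 1) * ln r - r).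
      by rewrite /gamma_kernel -(rmorph1 (real_complex R)) -rmorphB -rmorphM -rmorphB cexpR /= mul1r.
    rewrite /n normc_gamma_kernel !ReMl /pos r0 !mul1r !kR big_split/= -expR_sum.
    rewrite mulrCA; congr (_ * _); rewrite -expRD; congr expR.
    rewrite -mulr_suml sumrN ReB Re_sum; ring.
  by rewrite e1 e2.
apply: (has_cint_prod1 _ _ hf).
  by apply: cmeasM; [exact: cmeas_cst|exact: tcmeas_dirichlet_kernel].
move=> v; rewrite /f /=.
have [v0|v0] := boolP (all (fun x => 0 < x) v); last first.
  rewrite /dirichlet_kernel prod_pos_eq0 ?size_tuple// mul0r mulr0.
  under eq_fun do rewrite gammas_kernelE ?size_tuple// prod_pos_eq0 ?size_tuple// mul0r mulr0.
  exact: (has_cintN0 _).1.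
have S0 := sum_pos_gt0 v0.
rewrite /dirichlet_kernel; set P := \prod_(p <- _) _.
have := has_cintZ P (Gamma_has_cint S0 s0).
apply: eq_has_cint => [r|]; last by rewrite mulrCA.
rewrite gammas_kernelE ?size_tuple// -/P.
transitivity (P * ((pos r)%:C * (gamma_kernel 1 s r *
    cexp (- (r * \sum_(x <- v) x)%:C)))); last by ring.
congr (_ * (_ * _)); rewrite /gamma_kernel -cexpD; congr cexp.
by rewrite !rmorphM !rmorphD !rmorph1; ring.
Qed.

(** Absolute convergence does not follow from that of [Gamma s] times the kernel, as [Gamma s] might
    vanish. It follows from the real parameters [Re s], [Re th], whose kernel is the modulus and for
    which Gamma is positive. *)
Lemma dirichlet_has_cint N s th : size th = N -> all (fun t => 0 < Re t) th ->
  \sum_(t <- th) Re t < Re s ->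
  exists2 D, has_cint (mu N) (fun v : N.-tuple TR => dirichlet_kernel s th v) D &
    Gamma s * D = (\prod_(t <- th) Gamma t) * Gamma (s - \sum_(t <- th) t).
Proof.
move=> sth th0 ss.
have s0 : 0 < Re s.
  apply: le_lt_trans ss; rewrite big_seq sumr_ge0// => t tth.
  by apply: ltW; exact: (allP th0).
pose thr : seq R[i] := [seq (Re t)%:C | t <- th].
have hr : has_cint (mu N) (fun v : N.-tuple TR => Gamma (Re s)%:C * dirichlet_kernel (Re s)%:C thr v)
    ((\prod_(t <- thr) Gamma t) * Gamma ((Re s)%:C - \sum_(t <- thr) t)).
  apply: Gamma_dirichlet_has_cint; first by rewrite size_map.
    by rewrite all_map; apply: sub_all th0.
  by rewrite big_map.
have hr' := has_cintZ (Gamma (Re s)%:C)^-1 hr.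
have nE v : dirichlet_kernel (Re s)%:C thr v = (normc (dirichlet_kernel s th v))%:C.
  rewrite /dirichlet_kernel Normc.normcM normc_prod rmorphM rmorph_prod; congr (_ * _).
    rewrite /thr; elim: th v {sth th0 ss thr hr hr'} => [|t th IH] [|x v]; simpl map; simpl zip; rewrite ?big_nil//.
    rewrite !big_cons IH; congr (_ * _).
    simpl fst; simpl snd; rewrite Normc.normcM normcR ger0_norm ?pos_ge0// normc_cexp rmorphM; congr (_ * _).
    rewrite -(rmorph1 (real_complex R)) -rmorphB -rmorphM cexpR /=.
    by rewrite ReM /= mulr0 subr0 ReB.
  by rewrite normc_cexp -rmorphN -rmorphM cexpR /= ReM /= mulr0 subr0 ReN.
have mD := tcmeas_dirichlet_kernel s sth.
have fin : (\int[mu N]_v (normc (dirichlet_kernel s th v))%:E < +oo)%E.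
  have [_ + _ _] := hr'; congr (_ < _)%E; apply: eq_integral => v _.
  rewrite mulKf ?Gamma_real_neq0// nE normcR ger0_norm//; exact: normc_ge0.
exists (cintegral (mu N) setT (fun v : N.-tuple TR => dirichlet_kernel s th v)).
  exact: cmeas_has_cint.
apply: (has_cint_uniq (has_cintZ (Gamma s) (cmeas_has_cint mD fin))).
exact: Gamma_dirichlet_has_cint.
Qed.

(** The beta integrand on the half-line, [u^(p-1) (1+u)^(-p-q)]: the Dirichlet kernel in one
    variable with [s = p + q]. *)
Definition beta_kernel p q (u : R) : R[i] :=
  (pos u)%:C * cexp ((p - 1) * (ln u)%:C - (p + q) * (ln (1 + u))%:C).

Lemma beta_has_cint p q : 0 < Re p -> 0 < Re q ->
  exists2 B, has_cint leb (fun u : TR => beta_kernel p q u) B &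
    Gamma (p + q) * B = Gamma p * Gamma q.
Proof.
move=> p0 q0.
have [|||B hB BE] := @dirichlet_has_cint 1 (p + q) [:: p] => //=.
- by rewrite p0.
- by rewrite big_seq1 ReD ltrDl.
exists B; last by rewrite BE !big_seq1 addrAC subrr add0r.
have mD : tcmeas 1 (dirichlet_kernel (p + q) [:: p]) by exact: tcmeas_dirichlet_kernel.
move/(has_cint_tupleS _ mD) : hB.
have bE u : dirichlet_kernel (p + q) [:: p] [:: u] = beta_kernel p q u.
  by rewrite /dirichlet_kernel /beta_kernel /= !big_seq1 /= -mulrA -cexpD mulNr.
apply: has_cint_prod1.
  rewrite /beta_kernel; under eq_fun do rewrite -mulNr.
  apply: cmeasM; first by apply: cmeas_real; exact: measurable_pos.
  apply: cmeas_cexp; apply: cmeasD; apply: cmeasM; try exact: cmeas_cst.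
    by apply: cmeas_real; exact: (@measurable_ln R).
  apply: cmeas_real; apply: (measurableT_comp (@measurable_ln R)).
  exact: measurable_funD.
move=> u; have [] := has_cint_tuple0 (fun t => dirichlet_kernel (p + q) [:: p] (u :: t)).
by rewrite bE.
Qed.

End dirichlet.

(** * Cauchy's beta integral *)

Section complex_limits.
Context (R : realType).
Implicit Types (u v : nat -> R[i]) (l m : R[i]).

Definition ccvg u l := normc (u n - l) @[n --> \oo] --> (0 : R).

Lemma ccvgM u v l m : ccvg u l -> ccvg v m -> ccvg (fun n => u n * v n) (l * m).
Proof.
move=> ul vm.
have h : normc (u n - l) * (normc (v n - m) + normc m) + normc l * normc (v n - m)
    @[n --> \oo] --> (0 : R).
  rewrite -[X in _ --> X](addr0 0) -{1}(mul0r (0 + normc m)) -[X in _ --> _ + X](mulr0 (normc l)).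
  apply: cvgD; first by apply: cvgM => //; apply: cvgD => //; exact: cvg_cst.
  by apply: cvgM => //; exact: cvg_cst.
apply: (squeeze_cvgr _ (cvg_cst 0) h); apply: nearW => n; rewrite normc_ge0 /=.
have -> : u n * v n - l * m = (u n - l) * v n + l * (v n - m) by ring.
apply: le_trans (le_normcD _ _) _; rewrite !Normc.normcM lerD2r ler_wpM2l ?normc_ge0//.
by apply: le_trans (le_normcD _ _); rewrite subrK.
Qed.

Lemma ccvg_cst_eq l m : ccvg (fun=> l) m -> l = m.
Proof.
move=> h; have /Normc.eq0_normc/eqP : normc (l - m) = 0.
  exact: (cvg_unique (@norm_hausdorff _ R) (cvg_cst _) h).
by rewrite subr_eq0 => /eqP.
Qed.

Lemma ccvgP u l : (forall e : R, 0 < e -> exists N0, forall N, (N0 <= N)%N ->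
  normc (u N - l) <= e) -> ccvg u l.
Proof.
move=> h; apply/cvgrPdist_le => e e0; have [N0 hN] := h _ e0.
exists N0 => // n /= /hN; by rewrite sub0r normrN ger0_norm// normc_ge0.
Qed.
End complex_limits.

(* Laplace's method: the weights [phi ^ N * w] concentrate where [phi] is close to 1 *)
Section laplace.
Context d (T : measurableType d) (R : realType) (mu : {measure set T -> \bar R}).
Variables (phi w : T -> R) (g : T -> R[i]) (g0 : R[i]) (M : R).
Hypotheses (mphi : measurable_fun setT phi) (mw : measurable_fun setT w).
Hypotheses (phi01 : forall x, 0 <= phi x <= 1) (w0 : forall x, 0 <= w x)
  (gM : forall x, normc (g x) <= M).
Variables (A : nat -> R) (G : nat -> R[i]).
Hypothesis AE : forall N, (\int[mu]_x (phi x ^+ N * w x)%:E = (A N)%:E)%E.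
Hypothesis GE : forall N, has_cint mu (fun x => (phi x ^+ N * w x)%:C * g x) (G N).
Hypothesis near_g0 : forall e : R, 0 < e -> exists2 de, 0 <= de < 1 &
  forall x, 0 < w x -> de < phi x -> normc (g x - g0) <= e.
Hypothesis mass : forall de : R, 0 <= de < 1 -> exists2 c : R, 0 < c &
  forall N, c * de ^+ N <= A N.

Lemma laplace : ccvg (fun N => G N / (A N)%:C) g0.
Proof.
have A0 N : 0 < A N.
  have [|c c0 /(_ N)] := mass (de := 2^-1).
    by rewrite invr_ge0 ler0n invf_lt1// ltr1n.
  by apply: lt_le_trans; rewrite mulr_gt0// exprn_gt0.
have mpw N : measurable_fun setT (fun x => phi x ^+ N * w x).
  by apply: measurable_funM => //; exact: measurable_funX.
have pw0 N x : 0 <= phi x ^+ N * w x.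
  by rewrite mulr_ge0// exprn_ge0//; case/andP: (phi01 x).
pose K := M + normc g0.
have K0 : 0 <= K.
  rewrite addr_ge0 ?normc_ge0//.
  (* [M >= 0] follows from the bound at any point of [T]; if [T] were empty, all integrals would be
     0, against [A0]. *)
  have [[x _]|h] := pselect (exists x : T, True).
    by apply: le_trans (gM x); exact: normc_ge0.
  have := AE 0; have := A0 0%N.
  rewrite integral0_eq; first by move=> + [e]; rewrite -e ltxx.
  by move=> x _; exfalso; apply: h; exists x.
have hc N : has_cint mu (fun x => (phi x ^+ N * w x)%:C) (A N)%:C.
  split; first exact: cmeas_real.
  - by under eq_integral do rewrite normcR ger0_norm//; rewrite AE ltry.
  - by rewrite -AE.
  - exact: integral0_eq.
(* The first term bounds the part where [phi > de] and [g] is close to [g0], the second the part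
   where [phi ^ N <= de ^ N]. The factor 2 comes from estimating real and imaginary part
   separately. *)
have bound N (e de : R) : 0 < e -> 0 <= de < 1 ->
    (forall x, 0 < w x -> de < phi x -> normc (g x - g0) <= e) ->
    normc (G N - g0 * (A N)%:C) <= 2 * (e * A N + K * de ^+ N * A 0).
  move=> e0 /andP[de0 de1] hde.
  have hD := has_cintD (GE N) (has_cint_opp (has_cintZ g0 (hc N))).
  have fE x : (phi x ^+ N * w x)%:C * g x - g0 * (phi x ^+ N * w x)%:C =
      (phi x ^+ N * w x)%:C * (g x - g0) by ring.
  have pb x : normc ((phi x ^+ N * w x)%:C * g x - g0 * (phi x ^+ N * w x)%:C) <=
      e * (phi x ^+ N * w x) + K * de ^+ N * w x.
    rewrite fE Normc.normcM normcR ger0_norm//.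
    have [->|wx] := eqVneq (w x) 0; first by rewrite !(mulr0, mul0r) addr0.
    have {}wx : 0 < w x by rewrite lt_def wx w0.
    have [dx|xd] := ltP de (phi x).
      rewrite mulrC -[leLHS]addr0 lerD//; first by rewrite ler_wpM2r// hde.
      by rewrite !mulr_ge0// ?exprn_ge0// ltW.
    rewrite -[leLHS]add0r lerD//; first by rewrite mulr_ge0// ltW.
    have -> : K * de ^+ N * w x = de ^+ N * w x * K by ring.
    apply: ler_pM; rewrite ?normc_ge0//; last first.
      by apply: le_trans (le_normcD _ _) _; rewrite normcN lerD2r.
    rewrite ler_wpM2r//; apply: lerXn2r => //; rewrite nnegrE//.
    by case/andP: (phi01 x).
  have [mD _ e1 e2] := hD; have [mD1 mD2] := mD.
  have rb (h : T -> R) (r : R) : measurable_fun setT h ->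
      (forall x, `|h x| <= e * (phi x ^+ N * w x) + K * de ^+ N * w x) ->
      (\int[mu]_x (h x)%:E = r%:E)%E -> `|r| <= e * A N + K * de ^+ N * A 0%N.
    move=> mh hb hr; rewrite -lee_fin.
    apply: (@le_trans _ _ (\int[mu]_x (`|h x|%:E))%E).
      rewrite -[X in (X <= _)%E]/(`|r%:E|)%E -hr; apply: le_abse_integral => //.
      exact/measurable_EFinP.
    apply: (@le_trans _ _ (\int[mu]_x ((e * (phi x ^+ N * w x))%:E + (K * de ^+ N * w x)%:E))%E).
      apply: ge0_le_integral => //.
      - by apply/measurable_EFinP; exact: measurableT_comp.
      - by apply: emeasurable_funD; apply/measurable_EFinP; apply: measurable_funM.
      - by move=> x _; rewrite -EFinD lee_fin.
    have kd0 : 0 <= K * de ^+ N by rewrite mulr_ge0// exprn_ge0.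
    rewrite ge0_integralD//.
    - under eq_integral do rewrite EFinM.
      under [X in (_ + X)%E]eq_integral do rewrite EFinM.
      rewrite !ge0_integralZl_EFin//.
     + rewrite AE; have := AE 0; under eq_integral do rewrite expr0 mul1r.
        by move=> ->; rewrite EFinD !EFinM.
      + by move=> x _; rewrite lee_fin.
      + exact/measurable_EFinP.
      + by move=> x _; rewrite lee_fin.
      + exact/measurable_EFinP.
      + exact: ltW.
    - by move=> x _; rewrite lee_fin mulr_ge0// ltW.
    - by apply/measurable_EFinP; exact: measurable_funM.
    - by move=> x _; rewrite lee_fin mulr_ge0.
    - by apply/measurable_EFinP; exact: measurable_funM.
  apply: le_trans (normc_le _) _; rewrite mulr2n mulrDl !mul1r lerD//.
  - by apply: (rb _ _ mD1) => // x; apply: le_trans (pb x); exact: Re_le_normc.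
  - by apply: (rb _ _ mD2) => // x; apply: le_trans (pb x); exact: Im_le_normc.
apply: ccvgP => e e0.
have e40 : 0 < e / 4 by rewrite divr_gt0.
have [de de01 hde] := near_g0 e40; have /andP[de0 de1] := de01.
(* A level strictly between [de] and 1: the mass is at least [c de' ^ N], so the part with
   [phi <= de] is smaller by a factor of order [(de / de') ^ N]. *)
pose de' := (1 + de) / 2.
have de'01 : 0 <= de' < 1 by rewrite /de'; apply/andP; split; lra.
have dede' : de < de' by rewrite /de'; lra.
have de'0 : 0 < de' by apply: le_lt_trans dede'.
have [c c0 hA] := mass de'01.
have geo : (2 * K * A 0%N / c) * (de / de') ^+ N @[N --> \oo] --> (0 : R).
  rewrite -(mulr0 (2 * K * A 0%N / c)); apply: cvgMr; apply: cvg_expr.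
  have dd0 : 0 <= de / de' by rewrite divr_ge0// ltW.
  by rewrite (ger0_norm dd0) ltr_pdivrMr// mul1r.
move/cvgrPdist_le : geo => /(_ (e / 2)); rewrite divr_gt0// => /(_ isT)[N0 _ hN0].
exists N0 => N /hN0 /=; rewrite sub0r normrN => hN.
have hN' := le_trans (ler_norm _) hN.
have -> : G N / (A N)%:C - g0 = (G N - g0 * (A N)%:C) / (A N)%:C.
  rewrite mulrBl mulfK//; apply/eqP => /complexI AN.
  by have := A0 N; rewrite AN ltxx.
rewrite Normc.normcM Normc.normcV normcR gtr0_norm// ler_pdivrMr//.
apply: le_trans (bound N _ _ e40 de01 hde) _.
have cA := hA N.
have dN : de ^+ N = (de / de') ^+ N * de' ^+ N.
  by rewrite -exprMn divfK// gt_eqF.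
have : K * de ^+ N * A 0%N <= (e / 4) * A N.
  apply: (@le_trans _ _ ((e / 4) * (c * de' ^+ N))); last by rewrite ler_wpM2l// ltW.
  rewrite dN.
  have d'N : 0 <= de' ^+ N by rewrite exprn_ge0// ltW.
  have -> : K * ((de / de') ^+ N * de' ^+ N) * A 0%N =
    (2 * K * A 0%N / c * (de / de') ^+ N) * (c / 2 * de' ^+ N).
    by field; rewrite gt_eqF.
  have -> : e / 4 * (c * de' ^+ N) = (e / 2) * (c / 2 * de' ^+ N) by field.
  by apply: ler_wpM2r => //; rewrite mulr_ge0// divr_ge0// ltW.
lra.
Qed.
End laplace.

(** * The kernel [(1 + i y)^-s (1 - i y)^-t]: convergence and recursions *)

Section cauchy_kernel.
Context (R : realType).
Local Notation TR := (measurableTypeR R).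
Local Notation leb := (@lebesgue_measure R).
Implicit Types (s t : R[i]) (y : R).

Definition half_ln y : R := ln (1 + y ^+ 2) / 2.

Definition cauchy_kernel s t y : R[i] := cexp (- s * cln1i y - t * cln1i (- y)).

Lemma cauchy_kernelM s t s' t' y :
  cauchy_kernel s t y * cauchy_kernel s' t' y = cauchy_kernel (s + s') (t + t') y.
Proof. by rewrite /cauchy_kernel -cexpD; congr cexp; ring. Qed.

Lemma cauchy_kernel_u y : cauchy_kernel (-1) 0 y = 1 +i* y.
Proof. by rewrite /cauchy_kernel opprK mul1r mul0r subr0 cexp_cln1i. Qed.

Lemma cauchy_kernel_v y : cauchy_kernel 0 (-1) y = 1 -i* y.
Proof. by rewrite /cauchy_kernel oppr0 mul0r mulN1r opprK add0r cexp_cln1i. Qed.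

Lemma Re_cauchy s t y : Re (- s * cln1i y - t * cln1i (- y)) =
  - (Re s + Re t) * half_ln y + (Im s - Im t) * atan y.
Proof. by rewrite cln1iN ReB !ReM ReN ImN /= -/(half_ln y); ring. Qed.

Lemma normc_cauchy s t y : normc (cauchy_kernel s t y) =
  expR (- (Re s + Re t) * half_ln y + (Im s - Im t) * atan y).
Proof. by rewrite normc_cexp Re_cauchy. Qed.

Lemma half_ln_ge0 y : 0 <= half_ln y.
Proof. by rewrite divr_ge0// ln1sqr_ge0. Qed.

Lemma atan_part_bound (a : R) y : a * atan y <= `|a| * pi.
Proof.
apply: le_trans (ler_norm _) _; rewrite normrM ler_wpM2l//.
apply: le_trans (ltW (atan_bound y)) _; have := pi_ge0 R; lra.
Qed.

Lemma measurable_half_ln : measurable_fun setT (half_ln : TR -> TR).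
Proof.
apply: measurable_funM => //; apply: (measurableT_comp (@measurable_ln R)).
by apply: measurable_funD => //; exact: measurable_funX.
Qed.

Lemma cmeas_cln1i (f : TR -> TR) : measurable_fun setT f ->
  cmeas (fun y : TR => cln1i (f y)).
Proof.
move=> mf; split; first exact: (measurableT_comp measurable_half_ln).
exact: measurable_fun_atan.
Qed.

Lemma cmeas_cauchy s t : cmeas (fun y : TR => cauchy_kernel s t y).
Proof.
apply: cmeas_cexp; apply: cmeasD.
  by apply: cmeasM; [exact: cmeas_cst|exact: cmeas_cln1i].
under eq_fun do rewrite -mulNr.
apply: cmeasM; [exact: cmeas_cst|apply: cmeas_cln1i].
exact: oppr_measurable.
Qed.

Lemma is_derive_ext (f g : R -> R) y (a b : R) : (forall x, f x = g x) -> a = b ->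
  is_derive y 1 f a -> is_derive y 1 g b.
Proof. by move=> /funext -> ->. Qed.

Lemma is_derive_half_ln y : is_derive y 1 half_ln (y * (1 + y ^+ 2)^-1).
Proof.
have dq : is_derive y 1 (fun y : R => 1 + y * y) (0 + (1 * y + y * 1)).
  exact: (is_derive_fD (is_derive_cst (1 : R) y (1 : R)) (is_derive_fM (is_derive_id y (1 : R)) (is_derive_id y (1 : R)))).
have h := onesqr_gt0 y; rewrite expr2 in h.
have := is_derive_fZ 2^-1 (@is_derive_fcomp _ (@ln R) (fun y : R => 1 + y * y) y _ _ (is_derive1_ln h) dq).
have -> : (fun t : R => 2^-1 * ln (1 + t * t)) = half_ln.
  by apply/funext => t; rewrite /half_ln mulrC expr2.
congr (is_derive _ _ _ _); rewrite expr2; field; by rewrite gt_eqF.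
Qed.

Lemma exp_half_ln y : expR (- half_ln y) ^+ 2 = (1 + y ^+ 2)^-1.
Proof.
by rewrite -expRM_natl mulrN mulrC divfK ?pnatr_eq0// expRN lnK// posrE onesqr_gt0.
Qed.

(** [(1 + y^2)^(-c/2)] is compared with the derivative of an explicit bounded function, because the
    arctangent alone would serve only for [c >= 2]. *)
Lemma cauchy_finite (c : R) : 1 < c ->
  (\int[leb]_y (expR (- c * half_ln y))%:E < +oo)%E.
Proof.
move=> c1; have [ab ndab abI Iab] := exhaustT R.
pose e2 := c - 1.
have e20 : 0 < e2 by rewrite subr_gt0.
pose e y := expR (- half_ln y); pose E y := expR (- e2 * half_ln y).
(* The derivative of [y e (2 - E)], which is bounded by 2. As [E <= 1], the term [2 - E] dominates
   [E], while [e2 y^2 E] dominates [y^2 E] up to [1 / e2]; together they bound [(1 + y^2) E]. *)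
pose f y := e y * (1 + y ^+ 2)^-1 * (2 - E y + e2 * (y * y) * E y).
have E01 y : 0 < E y <= 1.
  by rewrite expR_gt0 /= -expR0 ler_expR mulNr oppr_le0 mulr_ge0 ?half_ln_ge0// ltW.
have a0 y : 0 < (1 + y ^+ 2)^-1 :> R by rewrite invr_gt0 onesqr_gt0.
have de y : is_derive y 1 e (e y * - (y * (1 + y ^+ 2)^-1)).
  apply: is_derive_fcomp; apply: is_derive_fN; exact: is_derive_half_ln.
have dE y : is_derive y 1 E (E y * (- e2 * (y * (1 + y ^+ 2)^-1))).
  apply: is_derive_fcomp; apply: is_derive_fZ; exact: is_derive_half_ln.
have ca y : {for y, continuous (fun y : R => (1 + y ^+ 2)^-1)}.
  apply: continuous_inv; last by rewrite gt_eqF// onesqr_gt0.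
  by apply: continuousD; [exact: cst_continuous|exact: exprn_continuous].
have f0 y : 0 <= f y.
  have /andP[h1 h2] := E01 y.
  have yy : 0 <= y * y by rewrite -expr2 sqr_ge0.
  have p1 : 0 <= e y * (1 + y ^+ 2)^-1 by exact: mulr_ge0 (expR_ge0 _) (ltW (a0 y)).
  have p2 : 0 <= e2 * (y * y) * E y by exact: mulr_ge0 (mulr_ge0 (ltW e20) yy) (ltW h1).
  by rewrite /f; apply: (mulr_ge0 p1); apply: addr_ge0 p2; lra.
have me : measurable_fun setT (e : TR -> TR).
  apply: (measurableT_comp (@measurable_expR R)); apply: measurableT_comp => //.
  exact: measurable_half_ln.
have mE : measurable_fun setT (E : TR -> TR).
  apply: (measurableT_comp (@measurable_expR R)).
  exact: (measurable_funM (measurable_cst (- e2)) measurable_half_ln).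
have mf : measurable_fun [set: TR] (f : TR -> TR).
  have ma : measurable_fun [set: TR] (fun y : TR => (1 + y ^+ 2)^-1 : TR).
    by apply: measurable_fun_inv; apply: measurable_funD => //; exact: exprn_measurable.
  have my2 : measurable_fun [set: TR] (fun y : TR => e2 * (y * y) : TR).
    by apply: measurable_funM => //; exact: measurable_funM.
  apply: (measurable_funM (measurable_funM me ma)).
  exact: (measurable_funD (measurable_funB (measurable_cst (2 : R)) mE) (measurable_funM my2 mE)).
have fi : (\int[leb]_(y in [set` `]-oo, +oo[%R]) (f y)%:E < +oo)%E.
  apply: (ge0_bounded_primitive ab ndab abI Iab (F := fun y => y * (e y * (2 - E y))) (M := 2)
    _ _ (fun y _ => f0 y) _ mf).
  - move=> y _.
    have hd := is_derive_fM (is_derive_id y 1) (is_derive_fM (de y)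
      (is_derive_fD (is_derive_cst (2 : R) y (1 : R)) (is_derive_fN (dE y)))).
    apply: (is_derive_ext _ _ hd) => //; rewrite /f /cst /=.
    by field; rewrite gt_eqF// onesqr_gt0.
  - move=> y _; apply: continuousM.
      by apply: continuousM => //; exact: is_derive_continuous (de y).
    have cE := is_derive_continuous (dE y).
    apply: continuousD; first by apply: continuousB => //; exact: cst_continuous.
    apply: continuousM => //; apply: continuousM; first exact: cst_continuous.
    by apply: continuousM; exact: cvg_id.
  - move=> y _; rewrite !normrM mulrA -[leRHS]mul1r ler_pM//.
      rewrite -[leRHS](@ger0_norm _ 1)// -ler_sqr ?nnegrE ?mulr_ge0// normr1 expr1n.
      rewrite exprMn !real_normK ?num_real// exp_half_ln ler_pdivrMr ?onesqr_gt0// mul1r.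
      by rewrite lerDr.
    have /andP[h1 h2] := E01 y; rewrite ger0_norm ?lerBlDr ?lerDl ?(ltW h1)//.
    by rewrite subr_ge0 (le_trans h2)// ler1n.
have K0 : 0 <= 1 + e2^-1 by rewrite addr_ge0// invr_ge0 ltW.
apply: (@le_lt_trans _ _ (\int[leb]_y ((1 + e2^-1)%:E * (f y)%:E))%E).
  apply: ge0_le_integral => //.
  - apply/measurable_EFinP; apply: (measurableT_comp (@measurable_expR R)).
    exact: (measurable_funM (measurable_cst (- c)) measurable_half_ln).
  - by apply/measurable_EFinP; exact: measurable_funM.
  - move=> y _; rewrite -EFinM lee_fin.
    have -> : expR (- c * half_ln y) = e y * E y.
      by rewrite /e /E -expRD; congr expR; rewrite /e2; ring.
    have /andP[h1 h2] := E01 y.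
    have e0 : 0 < e y by rewrite expR_gt0.
    have y2 : 0 <= y ^+ 2 by exact: sqr_ge0.
    have -> : e y * E y = e y * (1 + y ^+ 2)^-1 * ((1 + y ^+ 2) * E y).
      by field; rewrite gt_eqF// onesqr_gt0.
    rewrite /f [leRHS]mulrCA ler_pM2l ?mulr_gt0// -expr2.
    have -> : (1 + e2^-1) * (2 - E y + e2 * y ^+ 2 * E y) =
      (1 + e2^-1) * (2 - E y) + e2 * (y ^+ 2 * E y) + y ^+ 2 * E y.
      by field; rewrite gt_eqF.
    rewrite mulrDl mul1r lerD2r -[leLHS]addr0 lerD//; last by exact: mulr_ge0 (ltW e20) (mulr_ge0 y2 (ltW h1)).
    rewrite -[leLHS]mul1r ler_pM// ?(ltW h1)//; last by lra.
    by rewrite lerDl invr_ge0 ltW.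
rewrite ge0_integralZl//; last 2 first.
- exact/measurable_EFinP.
- by move=> y _; rewrite lee_fin.
apply: lte_mul_pinfty => //; move: fi.
by rewrite (_ : [set` `]-oo, +oo[%R] = setT :> set R)//; apply/seteqP; split => // x _ /=; rewrite in_itv.
Qed.

Definition cauchy_integral s t : R[i] := cintegral leb setT (cauchy_kernel s t).

Lemma cauchy_has_cint s t : 1 < Re s + Re t ->
  has_cint leb (fun y : TR => cauchy_kernel s t y) (cauchy_integral s t).
Proof.
move=> st; pose K := expR (`|Im s - Im t| * pi).
rewrite /cauchy_integral.
apply: (has_cint_dominated (h := fun y : TR => K * expR (- (Re s + Re t) * half_ln y))).
- exact: cmeas_cauchy.
- apply: measurable_funM => //; apply: (measurableT_comp (@measurable_expR R)).
  exact: (measurable_funM (measurable_cst _) measurable_half_ln).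
- move=> y; rewrite normc_cauchy -expRD ler_expR addrC lerD2r.
  exact: atan_part_bound.
- under eq_integral do rewrite EFinM.
  rewrite ge0_integralZl//.
  + by apply: lte_mul_pinfty; rewrite ?lee_fin ?expR_ge0//; exact: cauchy_finite.
  + apply/measurable_EFinP; apply: (measurableT_comp (@measurable_expR R)).
    exact: (measurable_funM (measurable_cst _) measurable_half_ln).
  + by rewrite lee_fin expR_ge0.
Qed.

Lemma cauchy_kernel_split_u s t y :
  cauchy_kernel s t y = cauchy_kernel (-1) 0 y * cauchy_kernel (s + 1) t y.
Proof. by rewrite cauchy_kernelM add0r addrC addrK. Qed.

Lemma cauchy_kernel_split_v s t y :
  cauchy_kernel s t y = cauchy_kernel 0 (-1) y * cauchy_kernel s (t + 1) y.
Proof. by rewrite cauchy_kernelM add0r [-1 + _]addrC addrK. Qed.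

(** This is [(1 + i y) + (1 - i y) = 2] multiplied by the kernel at [(s + 1, t + 1)]. *)
Lemma cauchy_sum s t : 0 < Re s + Re t ->
  cauchy_integral s (t + 1) + cauchy_integral (s + 1) t = 2 * cauchy_integral (s + 1) (t + 1).
Proof.
move=> st.
have h1 : 1 < Re s + Re (t + 1) by rewrite ReD /=; lra.
have h2 : 1 < Re (s + 1) + Re t by rewrite ReD /=; lra.
have h3 : 1 < Re (s + 1) + Re (t + 1) by rewrite !ReD /=; lra.
apply: (has_cint_uniq (has_cintD (cauchy_has_cint h1) (cauchy_has_cint h2))).
apply: eq_has_cint (has_cintZ 2 (cauchy_has_cint h3)) => // y.
rewrite (cauchy_kernel_split_u s) (cauchy_kernel_split_v (s + 1) t) cauchy_kernel_u cauchy_kernel_v -mulrDl; congr (_ * _).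
by apply: eqc; rewrite ?Re_nat ?Im_nat /=; ring.
Qed.

(** The derivative of the kernel at [(s, t)] is [-i s] times the kernel at [(s + 1, t)] plus [i t]
    times the one at [(s, t + 1)], and its integral is 0. *)
Lemma cauchy_diff s t : 0 < Re s + Re t ->
  s * cauchy_integral (s + 1) t = t * cauchy_integral s (t + 1).
Proof.
move=> st; have [ab ndab abI Iab] := exhaustT R.
have h1 : 1 < Re s + Re (t + 1) by rewrite ReD /=; lra.
have h2 : 1 < Re (s + 1) + Re t by rewrite ReD /=; lra.
pose g y : R[i] := - s * cln1i y - t * cln1i (- y).
pose a y : R := (1 + y ^+ 2)^-1.
(* [dl] and [dl'] are the derivatives of [cln1i y] and [cln1i (- y)], that is, [i / (1 + i y)] and
   [- i / (1 - i y)] split into parts. *)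
pose dl y : R[i] := (y * a y) +i* a y.
pose dl' y : R[i] := (y * a y) -i* a y.
pose dg y := - s * dl y - t * dl' y.
have aE y : a y * (1 + y ^+ 2) = 1 by rewrite mulVf// gt_eqF// onesqr_gt0.
have ii : ('i%C : R[i]) * 'i%C = -1 by rewrite -expr2 sqr_i.
have dlE y : dl y = 'i%C * cauchy_kernel 1 0 y.
  have : dl y * cauchy_kernel (-1) 0 y = 'i%C.
    rewrite cauchy_kernel_u; apply: eqc; rewrite ?ReM ?ImM /=; first ring.
    by rewrite -[RHS](aE y); ring.
  move=> <-; rewrite -mulrA cauchy_kernelM addNr addr0 /cauchy_kernel oppr0 !mul0r subr0.
  by rewrite cexp0 mulr1.
have dlE' y : dl' y = - 'i%C * cauchy_kernel 0 1 y.
  have : dl' y * cauchy_kernel 0 (-1) y = - 'i%C.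
    rewrite cauchy_kernel_v; apply: eqc; rewrite ?ReM ?ImM ?ReN ?ImN /=; first ring.
    by transitivity (- (a y * (1 + y ^+ 2))); [ring|rewrite aE].
  move=> <-; rewrite -mulrA cauchy_kernelM addNr addr0 /cauchy_kernel oppr0 !mul0r subr0.
  by rewrite cexp0 mulr1.
have ca y : {for y, continuous a}.
  apply: continuous_inv; last by rewrite gt_eqF// onesqr_gt0.
  by apply: continuousD; [exact: cst_continuous|exact: exprn_continuous].
have gRe : (fun y => Re (g y)) = (fun y => - (Re s + Re t) * half_ln y + (Im s - Im t) * atan y).
  by apply/funext => y; rewrite Re_cauchy.
have gIm : (fun y => Im (g y)) = (fun y => - (Im s + Im t) * half_ln y + (Re t - Re s) * atan y).
  by apply/funext => y; rewrite /g cln1iN ImB !ImM ReN ImN /= -/(half_ln y); ring.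
have dgRe y : Re (dg y) = - (Re s + Re t) * (y * a y) + (Im s - Im t) * a y.
  by rewrite /dg ReB !ReM ReN ImN /=; ring.
have dgIm y : Im (dg y) = - (Im s + Im t) * (y * a y) + (Re t - Re s) * a y.
  by rewrite /dg ImB !ImM ReN ImN /=; ring.
have key : (- s * 'i%C) * cauchy_integral (s + 1) t + (t * 'i%C) * cauchy_integral s (t + 1) = 0.
  refine (complex_FTC ab ndab abI Iab (g := g) (dg := dg) _ _ _ _ _ _ _).
  - move=> y _; rewrite gRe dgRe; apply: is_derive_fD; apply: is_derive_fZ.
    exact: is_derive_half_ln.
  - move=> y _; rewrite gIm dgIm; apply: is_derive_fD; apply: is_derive_fZ.
    exact: is_derive_half_ln.
  - move=> y _; rewrite (funext dgRe).
    apply: continuousD; apply: continuousM; try exact: cst_continuous; last exact: ca.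
    by apply: continuousM; [exact: cvg_id|exact: ca].
  - move=> y _; rewrite (funext dgIm).
    apply: continuousD; apply: continuousM; try exact: cst_continuous; last exact: ca.
    by apply: continuousM; [exact: cvg_id|exact: ca].
  - have := has_cintD (has_cintZ (- s * 'i%C) (cauchy_has_cint h2))
      (has_cintZ (t * 'i%C) (cauchy_has_cint h1)).
    apply: eq_has_cint => // y; rewrite in_itv/= mul1r -/(cauchy_kernel s t y) /dg.
    have -> : cauchy_kernel (s + 1) t y = cauchy_kernel 1 0 y * cauchy_kernel s t y.
      by rewrite cauchy_kernelM add0r addrC.
    have -> : cauchy_kernel s (t + 1) y = cauchy_kernel 0 1 y * cauchy_kernel s t y.
      by rewrite cauchy_kernelM add0r [1 + t]addrC.
    by rewrite dlE dlE'; ring.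
  - apply: (cvg_expR_linear (c := Re s + Re t) (K := `|Im s - Im t| * pi)) => // n.
    rewrite /g Re_cauchy addrC; apply: lerD; first exact: atan_part_bound.
    rewrite mulNr lerN2 ler_pM2l// /half_ln /exhaustT_lo sqrrN.
    rewrite ler_pdivlMr// -[leLHS]expRK ler_ln ?posrE ?expR_gt0 ?onesqr_gt0//.
    by rewrite mulrC expRM_natl lerDr.
  - apply: (cvg_expR_linear (c := Re s + Re t) (K := `|Im s - Im t| * pi)) => // n.
    rewrite /g Re_cauchy addrC; apply: lerD; first exact: atan_part_bound.
    rewrite mulNr lerN2 ler_pM2l// /half_ln /exhaust_hi.
    rewrite ler_pdivlMr// -[leLHS]expRK ler_ln ?posrE ?expR_gt0 ?onesqr_gt0//.
    by rewrite mulrC expRM_natl lerDr.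
have i0 : ('i%C : R[i]) != 0.
  by apply/eqP => /(congr1 (@complex.Im R))/= /eqP; rewrite oner_eq0.
apply: (mulIf i0); apply/eqP; rewrite -subr_eq0 -oppr_eq0; apply/eqP.
rewrite -[RHS]key; ring.
Qed.

(** The two relations at [(s, t - 1)] are linear in the integrals at [(s, t)] and [(s + 1, t - 1)];
    eliminating the latter gives the recursion. *)
Lemma cauchy_shift_l s t : 1 < Re s + Re t ->
  2 * s * cauchy_integral (s + 1) t = (s + t - 1) * cauchy_integral s t.
Proof.
move=> st; have st' : 0 < Re s + Re (t - 1) by rewrite ReB /=; lra.
have := cauchy_sum st'; have := cauchy_diff st'; rewrite subrK => h1 h2.
rewrite [2 * s]mulrC -mulrA -h2 mulrDr h1; ring.
Qed.

Lemma cauchy_shift_r s t : 1 < Re s + Re t ->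
  2 * t * cauchy_integral s (t + 1) = (s + t - 1) * cauchy_integral s t.
Proof.
move=> st; have st' : 0 < Re (s - 1) + Re t by rewrite ReB /=; lra.
have := cauchy_sum st'; have := cauchy_diff st'; rewrite subrK => h1 h2.
rewrite [2 * t]mulrC -mulrA -h2 mulrDr -h1; ring.
Qed.

Lemma cauchy_kernel11 y : cauchy_kernel 1 1 y = ((1 + y ^+ 2)^-1)%:C.
Proof.
rewrite /cauchy_kernel cln1iN -exp_half_ln -expRM_natl -cexpR; congr cexp.
by apply: eqc; rewrite ?ReB ?ImB ?ReM ?ImM ?ReN ?ImN /= -?/(half_ln y); ring.
Qed.

Lemma cauchy_integral11 : cauchy_integral 1 1 = pi%:C.
Proof.
have [ab ndab abI Iab] := exhaustT R.
have h : 1 < Re (1 : R[i]) + Re (1 : R[i]) by rewrite /=; lra.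
have hc := cauchy_has_cint h; have [_ _ e1 e2] := hc.
have [i1 _] := has_cint_integrable hc.
have sT : [set` `]-oo, +oo[%R] = setT :> set R.
  by apply/seteqP; split => // x _ /=; rewrite in_itv.
have hi : exhaust_hi R n @[n --> \oo] --> +oo.
  apply/cvgryPge => K; exists (Num.truncn `|K|) => // n /= nK.
  apply: le_trans (expR_ge1Dx _); rewrite ler_wpDl//.
  apply: le_trans (ler_norm _) _; apply: (le_trans (ltW (truncnS_gt _))).
  by rewrite ler_nat ltnS.
have ahi : atan (exhaust_hi R n) @[n --> \oo] --> (pi / 2 : R).
  exact: (cvg_comp _ _ hi (@cvgy_atan R)).
have alo : atan (exhaustT_lo R n) @[n --> \oo] --> (- (pi / 2) : R).
  by under eq_fun do rewrite atanN; exact: cvgN.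
apply: eqc.
- have := @improper_FTC _ _ _ _ ab ndab abI Iab atan (fun y => (1 + y ^+ 2)^-1) _ _ _ _ _ alo ahi.
  rewrite sT opprK -splitr /= => hh; have {hh} : (Re (cauchy_integral 1 1))%:E = (pi : R)%:E; last by move=> [].
  rewrite -e1; under eq_integral do rewrite cauchy_kernel11 /=.
  apply: hh.
  + move=> y _; apply: continuous_inv; last by rewrite gt_eqF// onesqr_gt0.
    by apply: continuousD; [exact: cst_continuous|exact: exprn_continuous].
  + by move: i1; under eq_fun do rewrite cauchy_kernel11 /=.
- have {e2} : (Im (cauchy_integral 1 1))%:E = 0%:E; last by move=> [].
  by rewrite -e2; apply: integral0_eq => y _; rewrite cauchy_kernel11.
Qed.

End cauchy_kernel.

(** * Recursions and the value at [(1, 1)] of Euler's beta integral *)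

Section beta_recursion.
Context (R : realType).
Local Notation TR := (measurableTypeR R).
Local Notation leb := (@lebesgue_measure R).
Implicit Types (p q s t z : R[i]) (u : R).

Definition beta_integral p q : R[i] := cintegral leb setT (beta_kernel p q).

Lemma beta_integral_has_cint p q : 0 < Re p -> 0 < Re q ->
  has_cint leb (fun u : TR => beta_kernel p q u) (beta_integral p q).
Proof.
move=> p0 q0; have [B hB _] := beta_has_cint p0 q0.
by rewrite /beta_integral (has_cint_cintegral hB).
Qed.

Lemma beta_integral_Gamma p q : 0 < Re p -> 0 < Re q ->
  Gamma (p + q) * beta_integral p q = Gamma p * Gamma q.
Proof.
move=> p0 q0; have [B hB <-] := beta_has_cint p0 q0.
by rewrite /beta_integral (has_cint_cintegral hB).
Qed.

Lemma Re_add1_gt0 z : 0 < Re z -> 0 < Re (z + 1).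
Proof. by move=> z0; rewrite ReD addr_gt0 /= ?ltr01. Qed.

Lemma cexp_lnC u : 0 < u -> cexp ((ln u)%:C : R[i]) = u%:C.
Proof. by move=> u0; rewrite cexpR lnK. Qed.

(** The integrand is multiplied by [(u + 1) / (1 + u)]. The recursions are derived from the
    integrals rather than from the Gamma quotient, which would require [Gamma (p + q) != 0]. *)
Lemma beta_integral_sum p q : 0 < Re p -> 0 < Re q ->
  beta_integral p q = beta_integral (p + 1) q + beta_integral p (q + 1).
Proof.
move=> p0 q0.
apply: (has_cint_uniq (beta_integral_has_cint p0 q0)).
apply: eq_has_cint (has_cintD (beta_integral_has_cint (Re_add1_gt0 p0) q0)
  (beta_integral_has_cint p0 (Re_add1_gt0 q0))) => // u.
rewrite /beta_kernel /pos; case: ltP => u0; last by rewrite !mul0r addr0.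
have u1 : 0 < 1 + u by rewrite addr_gt0.
rewrite !mul1r.
set X := (p - 1) * _ - (p + q) * _.
have -> : (p + 1 - 1) * (ln u)%:C - (p + 1 + q) * (ln (1 + u))%:C =
    (ln u)%:C + (X - (ln (1 + u))%:C) by rewrite /X; ring.
have -> : (p - 1) * (ln u)%:C - (p + (q + 1)) * (ln (1 + u))%:C =
    X - (ln (1 + u))%:C by rewrite /X; ring.
have XE : cexp X = (1 + u)%:C * cexp (X - (ln (1 + u))%:C).
  by rewrite -(cexp_lnC u1) -cexpD; congr cexp; rewrite addrC subrK.
have e : (1 + u)%:C = 1 + u%:C :> R[i] by apply: eqc; rewrite /= ?addr0.
by rewrite XE cexpD cexp_lnC// e mulrDl mul1r addrC.
Qed.

(** The derivative of [u^p (1 + u)^(-p-q)] integrates to 0. *)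
Lemma beta_integral_ibp p q : 0 < Re p -> 0 < Re q ->
  p * beta_integral p q = (p + q) * beta_integral (p + 1) q.
Proof.
move=> p0 q0; have [ab ndab abI Iab] := exhaust0 R.
apply/eqP; rewrite -subr_eq0; apply/eqP.
pose g (u : R) : R[i] := p * (ln u)%:C - (p + q) * (ln (1 + u))%:C.
pose dg (u : R) : R[i] := p * (u^-1)%:C - (p + q) * ((1 + u)^-1)%:C.
have ReL z w (x y : R) : Re (z * x%:C - w * y%:C) = Re z * x - Re w * y.
  by rewrite ReB !ReM /= !mulr0 !subr0.
have ImL z w (x y : R) : Im (z * x%:C - w * y%:C) = Im z * x - Im w * y.
  by rewrite ImB !ImM /= !mulr0 !add0r.
have dl (a b u : R) : 0 < u ->
    is_derive u 1 (fun v => a * ln v - b * ln (1 + v)) (a * u^-1 - b * (1 + u)^-1).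
  move=> u0; have u1 : 0 < 1 + u by rewrite addr_gt0.
  have d1 : is_derive u 1 (fun v : R => 1 + v) (0 + 1).
    exact: (is_derive_fD (is_derive_cst (1 : R) u (1 : R)) (is_derive_id u (1 : R))).
  have := is_derive_fD (is_derive_fZ a (is_derive1_ln u0))
    (is_derive_fN (is_derive_fZ b (@is_derive_fcomp _ (@ln R) (fun v : R => 1 + v) u _ _ (is_derive1_ln u1) d1))).
  by rewrite add0r mulr1.
have cl (a b u : R) : 0 < u -> {for u, continuous (fun v : R => a * v^-1 - b * (1 + v)^-1)}.
  move=> u0; apply: continuousB; (apply: continuousM; first exact: cst_continuous).
    by apply: continuous_inv; rewrite ?gt_eqF//; exact: cvg_id.
  apply: continuous_inv; last by rewrite gt_eqF// addr_gt0.
  by apply: continuousD; [exact: cst_continuous|exact: cvg_id].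
refine (complex_FTC ab ndab abI Iab (g := g) (dg := dg) _ _ _ _ _ _ _).
- move=> u; rewrite in_itv/= andbT => u0; rewrite /g /dg ReL.
  by under eq_fun do rewrite ReL; exact: dl.
- move=> u; rewrite in_itv/= andbT => u0; rewrite /g /dg ImL.
  by under eq_fun do rewrite ImL; exact: dl.
- move=> u; rewrite in_itv/= andbT => u0; rewrite /dg.
  have -> : (fun t : R => Re (p * (t^-1)%:C - (p + q) * ((1 + t)^-1)%:C)) =
      (fun v => Re p * v^-1 - Re (p + q) * (1 + v)^-1) by apply/funext => v; rewrite ReL.
  exact: cl.
- move=> u; rewrite in_itv/= andbT => u0; rewrite /dg.
  have -> : (fun t : R => Im (p * (t^-1)%:C - (p + q) * ((1 + t)^-1)%:C)) =
      (fun v => Im p * v^-1 - Im (p + q) * (1 + v)^-1) by apply/funext => v; rewrite ImL.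
  exact: cl.
- have := has_cintD (has_cintZ p (beta_integral_has_cint p0 q0))
    (has_cint_opp (has_cintZ (p + q) (beta_integral_has_cint (Re_add1_gt0 p0) q0))).
  apply: eq_has_cint => // u; rewrite in_itv/= andbT /beta_kernel /pos.
  case: ltP => u0; last by rewrite !(mul0r, mulr0) oppr0 addr0.
  have u1 : 0 < 1 + u by rewrite addr_gt0.
  rewrite /dg !mul1r.
  have -> : (u^-1)%:C = cexp (- (ln u)%:C) :> R[i].
    by rewrite -rmorphN cexpR expRN lnK.
  have -> : ((1 + u)^-1)%:C = cexp (- (ln (1 + u))%:C) :> R[i].
    by rewrite -rmorphN cexpR expRN lnK.
  rewrite [RHS]mulrBl -!(mulrA _ (cexp _) (cexp _)) -!cexpD /g.
  by congr (p * cexp _ - (p + q) * cexp _); ring.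
- apply: (cvg_expR_linear (c := Re p) (K := 0)) => // n.
  rewrite /g ReL /exhaust0_lo expRK add0r mulrN lerBlDr lerDl.
  by rewrite mulr_ge0 ?ln_ge0 ?lerDl ?expR_ge0// ReD addr_ge0// ltW.
- apply: (cvg_expR_linear (c := Re q) (K := 0)) => // n.
  rewrite /g ReL /exhaust_hi expRK add0r ReD.
  have : n.+1%:R <= ln (1 + expR n.+1%:R) :> R.
    by rewrite -[leLHS]expRK ler_ln ?posrE ?expR_gt0 ?addr_gt0 ?expR_gt0// lerDr.
  move=> h; rewrite lerBlDr mulrDl.
  have := ler_wpM2l (ltW p0) h; have := ler_wpM2l (ltW q0) h; lra.
Qed.

Lemma beta_integral_shift p q : 0 < Re p -> 0 < Re q ->
  p * q * beta_integral p q = (p + q) * (p + q + 1) * beta_integral (p + 1) (q + 1).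
Proof.
move=> p0 q0; have p1 := Re_add1_gt0 p0.
have h0 := beta_integral_ibp p0 q0.
have h1 := beta_integral_ibp p1 q0; have h2 := beta_integral_sum p1 q0.
move: h0 h1 h2; move: (beta_integral p q) (beta_integral (p + 1) q) (beta_integral (p + 1 + 1) q)
  (beta_integral (p + 1) (q + 1)).
move=> B0 B1 B2 B3 h0 h1 h2.
have h : q * B1 = (p + 1 + q) * B3.
  apply: (addIr ((p + 1) * B1)); rewrite {2}h1 -mulrDr [B3 + _]addrC -h2; ring.
have -> : p * q * B0 = q * (p * B0) by ring.
by rewrite h0 mulrCA h; ring.
Qed.

Lemma beta_kernel11 u : beta_kernel 1 1 u = (pos u * ((1 + u) ^+ 2)^-1)%:C.
Proof.
rewrite /beta_kernel subrr mul0r add0r /pos; case: ltP => u0; last by rewrite !mul0r.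
have u1 : 0 < 1 + u by rewrite addr_gt0.
rewrite !mul1r; transitivity (cexp (- ln (1 + u))%:C * cexp (- ln (1 + u))%:C : R[i]).
  by rewrite -cexpD rmorphN; congr cexp; ring.
by rewrite cexpR expRN lnK// -rmorphM expr2 invfM.
Qed.

Lemma beta_integral11 : beta_integral 1 1 = 1.
Proof.
have [ab ndab abI Iab] := exhaust0 R.
have hc := @beta_integral_has_cint 1 1 ltr01 ltr01; have [_ _ e1 e2] := hc.
have [i1 _] := has_cint_integrable hc.
pose F u := - (1 + u)^-1 : R.
have cv : expR (- n.+1%:R) @[n --> \oo] --> (0 : R).
  by apply: (cvg_expR_linear (c := 1) (K := 0)) => // n; rewrite mul1r add0r.
have ahi : F (exhaust_hi R n) @[n --> \oo] --> (0 : R).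
  apply: norm_cvg0; apply: (squeeze_cvgr _ (cvg_cst 0) cv); apply: nearW => n.
  have h : 0 < expR n.+1%:R :> R by exact: expR_gt0.
  rewrite normr_ge0 /= /F normrN /exhaust_hi gtr0_norm ?invr_gt0 ?addr_gt0//.
  by rewrite expRN lef_pV2 ?posrE ?addr_gt0// lerDr.
have alo : F (exhaust0_lo R n) @[n --> \oo] --> (-1 : R).
  apply/cvgrPdist_le => e e0; move/cvgrPdist_le : cv => /(_ _ e0)[N _ hN].
  exists N => // n /hN /=; rewrite sub0r normrN; apply: le_trans.
  have h : 0 < expR (- n.+1%:R) :> R by exact: expR_gt0.
  rewrite /F /exhaust0_lo [leRHS]gtr0_norm// opprK; move: h; set a := expR _ => h.
  have -> : -1 + (1 + a)^-1 = - (a / (1 + a)).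
    by field; rewrite gt_eqF// addr_gt0.
  rewrite normrN ger0_norm ?divr_ge0 ?addr_ge0 ?(ltW h)//.
  by rewrite ler_pdivrMr ?addr_gt0// ler_peMr ?(ltW h)// lerDl ltW.
have dF u : u \in `]0, +oo[ -> is_derive u 1 F (((1 + u) ^+ 2)^-1).
  rewrite in_itv/= andbT => u0; have u1 : 0 < 1 + u by rewrite addr_gt0.
  have d1 : is_derive u 1 (fun v : R => 1 + v) (0 + 1).
    exact: (is_derive_fD (is_derive_cst (1 : R) u (1 : R)) (is_derive_id u (1 : R))).
  have u1n : 1 + u != 0 by rewrite gt_eqF.
  have := is_derive_fN (@is_deriveV R (fun v : R => 1 + v) _ _ _ u1n d1).
  by rewrite add0r /GRing.scale /= mulr1 opprK -exprVn.
have ii : leb.-integrable [set` `]0, +oo[%R] (EFin \o (fun u : R => ((1 + u) ^+ 2)^-1)).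
  apply: (@eq_integrable _ _ _ leb _ _ (EFin \o (fun u : TR => Re (beta_kernel 1 1 u)))) => //.
    move=> u uI; have u0 : 0 < u by move: uI; rewrite inE /= in_itv/= andbT.
    by rewrite /comp beta_kernel11 /pos u0 mul1r.
  by apply: (integrableS _ _ _ i1).
apply: eqc.
- have := @improper_FTC _ _ _ _ ab ndab abI Iab F (fun u : R => ((1 + u) ^+ 2)^-1) _ _ dF _ ii alo ahi.
  move=> hh; have : (Re (beta_integral 1 1))%:E = 1%:E; last by move=> [].
  move: hh; rewrite sub0r opprK => hh; rewrite -e1 -hh.
    rewrite [RHS]integral_mkcond; apply: eq_integral => u _.
    rewrite beta_kernel11 patchE -pos_itv.
    by case: (u \in _); rewrite /= ?mul1r ?mul0r.
  move=> u; rewrite in_itv/= andbT => u0.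
  apply: continuous_inv; last by rewrite gt_eqF// exprn_gt0// addr_gt0.
  apply: (continuous_comp (f := fun v : R => 1 + v) (g := fun v : R => v ^+ 2)).
    by apply: continuousD; [exact: cst_continuous|exact: cvg_id].
  exact: exprn_continuous.
- have {e2} : (Im (beta_integral 1 1))%:E = 0%:E; last by move=> [].
  by rewrite -e2; apply: integral0_eq => y _; rewrite beta_kernel11.
Qed.
End beta_recursion.

(** * Concentration of the Cauchy and beta kernels under large shifts *)

Section laplace_applications.
Context (R : realType).
Local Notation TR := (measurableTypeR R).
Local Notation leb := (@lebesgue_measure R).
Implicit Types (p q s t z : R[i]) (u y : R).

Lemma eq_continuous_at (f h : R -> R) (x : R) : f =1 h ->
  {for x, continuous f} -> {for x, continuous h}.
Proof. by move=> /funext ->. Qed.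

Lemma has_cint_real d (T : measurableType d) (mu : {measure set T -> \bar R})
    (f : T -> R) (v : R[i]) : has_cint mu (fun x => (f x)%:C) v ->
  (\int[mu]_x (f x)%:E = (Re v)%:E)%E /\ v = (Re v)%:C.
Proof.
move=> [_ _ e1 e2]; split; first exact: e1.
apply: eqc => //=; have : (Im v)%:E = 0%:E; last by move=> [].
by rewrite -e2; exact: integral0_eq.
Qed.

Lemma integral_mass (f : TR -> TR) (a b m v : R) : a < b -> 0 <= m ->
  measurable_fun setT f -> (forall x, 0 <= f x) ->
  (forall x, a <= x <= b -> m <= f x) ->
  (\int[leb]_x (f x)%:E = v%:E)%E -> m * (b - a) <= v.
Proof.
move=> ab m0 mf f0 fm; rewrite -lee_fin => <-.
have l12 : (leb `[a, b]%classic = (b - a)%:E)%E.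
  by rewrite lebesgue_measure_itv/= lte_fin ab -EFinB.
have -> : (m * (b - a))%:E = (\int[leb]_x (m * \1_(`[a, b]%classic : set TR) x)%:E)%E.
  under eq_integral do rewrite EFinM.
  rewrite integralZl//; last by apply: integrable_indic_itv.
  by rewrite integral_indic// setIT EFinM; congr (_ * _)%E; symmetry; exact: l12.
apply: ge0_le_integral => //.
- by move=> x _; rewrite lee_fin mulr_ge0.
- by apply/measurable_EFinP; apply: measurable_funM => //; exact: measurable_indic.
- exact/measurable_EFinP.
- move=> x _; rewrite lee_fin indicE.
  have [/set_mem/=|_] := boolP (x \in _); last by rewrite mulr0.
  by rewrite in_itv/= mulr1; exact: fm.
Qed.

Lemma continuous_cexp_near (h : R -> R[i]) x (e : R) : 0 < e ->
  {for x, continuous (fun y => Re (h y))} -> {for x, continuous (fun y => Im (h y))} ->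
  exists2 eta : R, 0 < eta & forall y, `|y - x| < eta -> normc (cexp (h y) - cexp (h x)) <= e.
Proof.
move=> e0 cR cI; have e20 : 0 < e / 2 by rewrite divr_gt0.
have cE : {for x, continuous (fun y => expR (Re (h y)))}.
  by apply: (continuous_comp cR); exact: continuous_expR.
have c1 : {for x, continuous (fun y => Re (cexp (h y)))}.
  by apply: (continuousM cE); apply: (continuous_comp cI); exact: continuous_cos.
have c2 : {for x, continuous (fun y => Im (cexp (h y)))}.
  by apply: (continuousM cE); apply: (continuous_comp cI); exact: continuous_sin.
move/cvgrPdist_le : c1 => /(_ _ e20)/nbhs_ballP[r1 /= r10 h1].
move/cvgrPdist_le : c2 => /(_ _ e20)/nbhs_ballP[r2 /= r20 h2].
exists (Num.min r1 r2); first by rewrite lt_min r10 r20.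
move=> y; rewrite lt_min => /andP[y1 y2].
have := h1 y; rewrite /ball/= distrC => /(_ y1) H1.
have := h2 y; rewrite /ball/= distrC => /(_ y2) H2.
rewrite -[leLHS]/(normc (cexp (h y) - cexp (h x))).
apply: le_trans (normc_le _) _; rewrite ReB ImB [e]splitr lerD//.
  by rewrite distrC.
by rewrite distrC.
Qed.

Lemma cauchy_kernel_add1 s t y :
  cauchy_kernel (s + 1) (t + 1) y = ((1 + y ^+ 2)^-1)%:C * cauchy_kernel s t y.
Proof. by rewrite -cauchy_kernel11 cauchy_kernelM addrC [t + 1]addrC. Qed.

Lemma cauchy_kernel_addn s t y N :
  cauchy_kernel (s + N%:R) (t + N%:R) y =
  ((1 + y ^+ 2)^-1 ^+ N)%:C * cauchy_kernel s t y.
Proof.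
elim: N => [|N IH]; first by rewrite !addr0 expr0 mul1r.
by rewrite -!natr1 !addrA cauchy_kernel_add1 IH (exprS (1 + y ^+ 2)^-1 N) rmorphM mulrA.
Qed.

(** Shifting both parameters by [N] multiplies the kernel by [(1 + y^2)^(-N)], which peaks at
    [y = 0]. Real parts at least 1 keep the remaining factor at [(s - 1, t - 1)] bounded, and its
    value at 0 is 1. *)
Lemma cauchy_laplace s t : 1 <= Re s -> 1 <= Re t ->
  ccvg (fun N => cauchy_integral (s + N%:R) (t + N%:R) /
                 cauchy_integral (1 + N%:R) (1 + N%:R)) 1.
Proof.
move=> s1 t1.
pose phi y : R := (1 + y ^+ 2)^-1.
have phi0 y : 0 < phi y by rewrite invr_gt0 onesqr_gt0.
have phi1 y : phi y <= 1 by rewrite invf_le1 ?onesqr_gt0// lerDl sqr_ge0.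
have mphi : measurable_fun setT (phi : TR -> TR).
  by apply: measurable_fun_inv; apply: measurable_funD => //; exact: exprn_measurable.
have h1 N : 1 < Re (1 + N%:R : R[i]) + Re (1 + N%:R : R[i]).
  by rewrite ReD Re_nat /=; have : 0 <= N%:R :> R by []; lra.
have hA N : has_cint leb (fun y : TR => (phi y ^+ N * phi y)%:C) (cauchy_integral (1 + N%:R) (1 + N%:R)).
  apply: eq_has_cint (cauchy_has_cint (h1 N)) => // y.
  by rewrite cauchy_kernel_addn cauchy_kernel11 -rmorphM.
have AE N := (has_cint_real (hA N)).2.
rewrite (_ : (fun _ => _) = (fun N => cauchy_integral (s + N%:R) (t + N%:R) /
   (Re (cauchy_integral (1 + N%:R) (1 + N%:R)))%:C)); last first.
  by apply/funext => N; rewrite -AE.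
apply: (@laplace _ TR _ leb phi phi (cauchy_kernel (s - 1) (t - 1)) _
   (expR (`|Im s - Im t| * pi))).
- exact: mphi.
- exact: mphi.
- by move=> y; rewrite (ltW (phi0 y)) phi1.
- by move=> y; exact: ltW.
- move=> y; rewrite normc_cauchy ler_expR !ReB !ImB /= !subr0.
  rewrite -[leRHS]add0r lerD ?atan_part_bound// mulNr oppr_le0 mulr_ge0 ?half_ln_ge0//; lra.
- by move=> N; case: (has_cint_real (hA N)).
- move=> N; have h : 1 < Re (s + N%:R) + Re (t + N%:R).
    by rewrite !ReD Re_nat /=; have : 0 <= N%:R :> R by []; lra.
  apply: eq_has_cint (cauchy_has_cint h) => // y.
  rewrite cauchy_kernel_addn rmorphM -mulrA; congr (_ * _).
  by rewrite -cauchy_kernel_add1 !subrK.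
- move=> e e0.
  pose hh y : R[i] := - (s - 1) * cln1i y - (t - 1) * cln1i (- y).
  have chl : continuous (@half_ln R).
    by move=> y; exact: is_derive_continuous (is_derive_half_ln y).
  have [||eta eta0 heta] := @continuous_cexp_near hh 0 e e0.
  + apply: (@eq_continuous_at (fun y => - (Re (s - 1) + Re (t - 1)) * half_ln y +
      (Im (s - 1) - Im (t - 1)) * atan y)) => [y|]; first by rewrite /hh Re_cauchy.
    apply: continuousD; apply: continuousM; try exact: cst_continuous; first exact: chl.
    exact: continuous_atan.
  + apply: (@eq_continuous_at (fun y => - (Im (s - 1) + Im (t - 1)) * half_ln y +
      (Re (t - 1) - Re (s - 1)) * atan y)) => [y|].
      rewrite /hh cln1iN [RHS]ImB [X in _ = X - _]ImM [X in _ = _ - X]ImM !(ReN (s - 1)) !(ImN (s - 1)).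
      by rewrite /= -/(half_ln y); ring.
    apply: continuousD; apply: continuousM; try exact: cst_continuous; first exact: chl.
    exact: continuous_atan.
  (* The value of [phi] at distance [eta] from the peak. *)
  exists (1 + eta ^+ 2)^-1.
    rewrite invr_ge0 (ltW (onesqr_gt0 _))/= invf_lt1 ?onesqr_gt0// ltrDl exprn_gt0//.
  move=> y _; rewrite /phi ltf_pV2 ?posrE ?onesqr_gt0// ltrD2l => yeta.
  have hh0 : hh 0 = 0.
    rewrite /hh oppr0 (_ : cln1i 0 = 0) ?mulr0 ?subrr//.
    by apply: eqc; rewrite /cln1i /= ?atan0// expr0n addr0 ln1 mul0r.
  have e1 : cexp (hh 0) = 1 by rewrite hh0 cexp0.
  rewrite -[X in normc (_ - X)]e1; apply: heta; rewrite subr0.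
  by rewrite -(ltr_sqr) ?nnegrE ?(ltW eta0)// real_normK ?num_real.
(* On [[0, 1 - de]], an interval of length [1 - de], one has [phi y >= 1 - y >= de] and
   [phi y >= 1/2]. *)
- move=> de /andP[de0 de1]; exists (2^-1 * (1 - de)); first by rewrite mulr_gt0 ?subr_gt0.
  move=> N; have -> : 2^-1 * (1 - de) * de ^+ N = de ^+ N * 2^-1 * (1 - de - 0) by ring.
  apply: (integral_mass (f := fun y => phi y ^+ N * phi y)).
  + by rewrite subr_gt0.
  + by rewrite mulr_ge0 ?exprn_ge0.
  + by apply: measurable_funM => //; exact: measurable_funX.
  + by move=> y; rewrite mulr_ge0 ?exprn_ge0// ltW.
  + move=> y /andP[y0 y1].
    have yy : y ^+ 2 <= y by rewrite expr2 ler_piMl//; lra.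
    have yle : 1 - y <= phi y.
      rewrite /phi -[leRHS]mul1r ler_pdivlMr ?onesqr_gt0//.
      by have := mulr_ge0 y0 (sqr_ge0 (y - 2^-1)); rewrite !expr2; nra.
    apply: ler_pM; rewrite ?exprn_ge0// ?invr_ge0//.
      by rewrite lerXn2r ?nnegrE ?(ltW (phi0 y))//; lra.
    by rewrite lef_pV2 ?posrE ?onesqr_gt0//; lra.
  + by case: (has_cint_real (hA N)).
Qed.

Lemma beta_kernel_addn p q u N :
  beta_kernel (p + N%:R) (q + N%:R) u = ((u / (1 + u) ^+ 2) ^+ N)%:C * beta_kernel p q u.
Proof.
rewrite /beta_kernel /pos; case: ltP => u0; last by rewrite !mul0r mulr0.
have u1 : 0 < 1 + u by rewrite addr_gt0.
have -> : ((u / (1 + u) ^+ 2) ^+ N)%:C =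
    cexp (N%:R * ((ln u)%:C - (ln (1 + u))%:C - (ln (1 + u))%:C)) :> R[i].
  rewrite -!rmorphB -natC -rmorphM cexpR expRM_natl; congr (_ ^+ N)%:C.
  by rewrite !expRD !expRN !lnK// expr2 invfM mulrA.
by rewrite !mul1r -cexpD; congr cexp; ring.
Qed.

(** Here the peak is at [u = 1], and the limit is the value there of [u^(p-1) (1+u)^(2-p-q)]. This
    is the origin of the power of 2 in Cauchy's formula. *)
Lemma beta_laplace p q : 1 <= Re p -> 1 <= Re q ->
  ccvg (fun N => beta_integral (p + N%:R) (q + N%:R) /
                 beta_integral (1 + N%:R) (1 + N%:R))
       (cexp ((2 - p - q) * (ln 2)%:C)).
Proof.
move=> p1 q1.
(* The factor 4 normalises the maximum of [u / (1 + u)^2], attained at [u = 1], to 1. *)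
pose phi u : R := pos u * (4 * (u / (1 + u) ^+ 2)).
pose w u : R := pos u * ((1 + u) ^+ 2)^-1.
pose g u : R[i] := (pos u)%:C * cexp ((p - 1) * (ln u)%:C - (p + q - 2) * (ln (1 + u))%:C).
have u1 u : 0 < u -> 0 < 1 + u by move=> u0; rewrite addr_gt0.
have phiE u : 0 < u -> phi u = 1 - ((u - 1) / (u + 1)) ^+ 2.
  move=> u0; rewrite /phi /pos u0 mul1r; field; rewrite addrC gt_eqF ?u1//=.
have phi0 u : 0 <= phi u.
  rewrite /phi /pos; case: ltP => u0; last by rewrite mul0r.
  by rewrite mul1r mulr_ge0// divr_ge0 ?(ltW u0)// exprn_ge0// ltW// u1.
have phi1 u : phi u <= 1.
  have [u0|u0] := ltP 0 u; first by rewrite phiE// gerBl sqr_ge0.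
  by rewrite /phi /pos ltNge u0 mul0r.
have w0 u : 0 <= w u by rewrite mulr_ge0 ?pos_ge0// invr_ge0 sqr_ge0.
have mi : measurable_fun setT (fun u : TR => ((1 + u) ^+ 2)^-1 : TR).
  apply: measurable_fun_inv; apply: measurable_funX; exact: measurable_funD.
have mpos : measurable_fun setT (fun u : TR => pos u : TR) by exact: measurable_pos.
have mw : measurable_fun setT (w : TR -> TR) by exact: (measurable_funM mpos mi).
have mphi : measurable_fun setT (phi : TR -> TR).
  apply: (measurable_funM mpos); apply: measurable_funM => //; exact: measurable_funM.
have hN p' q' N : 1 <= Re p' -> 1 <= Re q' ->
    has_cint leb (fun u : TR => (phi u ^+ N)%:C * beta_kernel p' q' u)
      ((4 ^+ N)%:C * beta_integral (p' + N%:R) (q' + N%:R)).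
  move=> p1' q1'.
  have p0 : 0 < Re (p' + N%:R) by rewrite ReD Re_nat ltr_pwDl// (lt_le_trans ltr01).
  have q0 : 0 < Re (q' + N%:R) by rewrite ReD Re_nat ltr_pwDl// (lt_le_trans ltr01).
  apply: eq_has_cint (has_cintZ (4 ^+ N)%:C (beta_integral_has_cint p0 q0)) => // u.
  rewrite beta_kernel_addn mulrA -rmorphM -exprMn /phi.
  rewrite /beta_kernel /pos; case: ltP => u0; last by rewrite !mul0r !mulr0.
  by rewrite !mul1r.
have hA N : has_cint leb (fun u : TR => (phi u ^+ N * w u)%:C)
    ((4 ^+ N)%:C * beta_integral (1 + N%:R) (1 + N%:R)).
  apply: eq_has_cint (@hN 1 1 N _ _) => //= u.
  by rewrite beta_kernel11 -rmorphM.
have AE N := (has_cint_real (hA N)).2.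
have n4 N : ((4 ^+ N : R)%:C : R[i]) != 0.
  by apply/eqP => /complexI/eqP; rewrite expf_eq0 pnatr_eq0 andbF.
rewrite (_ : (fun _ => _) = (fun N => (4 ^+ N)%:C * beta_integral (p + N%:R) (q + N%:R) /
   (Re ((4 ^+ N)%:C * beta_integral (1 + N%:R) (1 + N%:R)))%:C)); last first.
  by apply/funext => N; rewrite -AE -mulf_div divff// mul1r.
have pos1 : pos (1 : R) = 1 by rewrite /pos ltr01.
apply: (@laplace _ TR _ leb phi w g _ 1).
- exact: mphi.
- exact: mw.
- by move=> u; rewrite phi0 phi1.
- exact: w0.
- move=> u; rewrite /g Normc.normcM normcR normc_cexp /pos.
  case: ltP => u0; last by rewrite normr0 mul0r.
  rewrite normr1 mul1r -[leRHS]expR0 ler_expR ReB !ReM /= !mulr0 !subr0 !ReB ReD /=.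
  have l1 : ln u <= ln (1 + u) by rewrite ler_ln ?posrE ?u1// lerDr.
  have l2 : 0 <= ln (1 + u) by rewrite ln_ge0// lerDl ltW.
  have := ler_wpM2l (x := Re p - 1) _ l1; rewrite subr_ge0 => /(_ p1).
  have := mulr_ge0 (x := Re q - 1) _ l2; rewrite subr_ge0 => /(_ q1).
  lra.
- by move=> N; case: (has_cint_real (hA N)).
- move=> N; apply: eq_has_cint (@hN p q N p1 q1) => // u.
  rewrite rmorphM -mulrA; congr (_ * _).
  rewrite /beta_kernel /w /g /pos; case: ltP => u0; last by rewrite !mul0r.
  rewrite !mul1r.
  have eE : (((1 + u) ^+ 2)^-1)%:C = cexp (- 2 * (ln (1 + u))%:C) :> R[i].
    by rewrite -(natC R 2) -rmorphN -rmorphM cexpR mulNr expRN expRM_natl lnK// posrE u1.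
  transitivity (cexp (- 2 * (ln (1 + u))%:C) *
    cexp ((p - 1) * (ln u)%:C - (p + q - 2) * (ln (1 + u))%:C)); last by rewrite -eE.
  by rewrite -cexpD; congr cexp; ring.
- move=> e e0.
  pose hh u : R[i] := (p - 1) * (ln u)%:C - (p + q - 2) * (ln (1 + u))%:C.
  have cl1 : {for (1 : R), continuous (fun u : R => ln u)} by exact: continuous_ln.
  have cl2 : {for (1 : R), continuous (fun u : R => ln (1 + u))}.
    apply: (continuous_comp (f := fun v : R => 1 + v) (g := @ln R)).
      by apply: continuousD; [exact: cst_continuous|exact: cvg_id].
    by apply: continuous_ln; rewrite addr_gt0.
  have [||eta eta0 heta] := @continuous_cexp_near hh 1 e e0.
  + apply: (@eq_continuous_at (fun u => Re (p - 1) * ln u - Re (p + q - 2) * ln (1 + u))) => [u|].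
      by rewrite /hh [RHS]ReB (ReM (p - 1)) (ReM (p + q - 2)); simpl Im; rewrite !mulr0 !subr0.
    by apply: continuousB; apply: continuousM => //; exact: cst_continuous.
  + apply: (@eq_continuous_at (fun u => Im (p - 1) * ln u - Im (p + q - 2) * ln (1 + u))) => [u|].
      by rewrite /hh [RHS]ImB (ImM (p - 1)) (ImM (p + q - 2)) [Im (ln u)%:C]/= [Re (ln u)%:C]/= [Im (ln (1 + u))%:C]/= [Re (ln (1 + u))%:C]/= !mulr0 !add0r.
    by apply: continuousB; apply: continuousM => //; exact: cst_continuous.
  have eta2 : 0 < eta + 2 by rewrite addr_gt0.
  have ee : 0 < (eta / (eta + 2)) ^+ 2 by rewrite exprn_gt0// divr_gt0.
  (* If [|u - 1| >= eta], then [u + 1 <= |u - 1| + 2] and the monotonicity of [x / (x + 2)] give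
     [|u - 1| / (u + 1) >= eta / (eta + 2)], so [phi u] is at most this level. *)
  exists (1 - (eta / (eta + 2)) ^+ 2).
    rewrite gtrBl ee andbT subr_ge0 exprn_ile1 ?divr_ge0 ?(ltW eta0) ?(ltW eta2)//.
    by rewrite ler_pdivrMr// mul1r lerDl.
  move=> u wu; have u0 : 0 < u.
    by rewrite ltNge; apply/negP => u0; move: wu; rewrite /w /pos (ltNge 0 u) u0 mul0r ltxx.
  rewrite phiE// ltrD2l ltrN2 => hu.
  have gE : g u = cexp (hh u) by rewrite /g /pos u0 mul1r.
  have -> : (2 - p - q) * (ln 2)%:C = hh 1.
    by rewrite /hh ln1 mulr0 sub0r; have -> : 1 + 1 = 2 :> R by []; ring.
  rewrite gE; apply: heta; rewrite ltNge; apply/negP => eu.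
  move: hu; apply/negP; rewrite -leNgt -[leRHS]real_normK ?num_real//.
  rewrite lerXn2r ?nnegrE ?divr_ge0 ?(ltW eta0) ?(ltW eta2)//.
  rewrite normrM normfV [`|u + 1|]gtr0_norm ?addr_gt0//.
  rewrite ler_pdivrMr// mulrAC ler_pdivlMr ?addr_gt0//.
  have : u + 1 <= `|u - 1| + 2 by have := ler_norm (u - 1); lra.
  by move: eu; set a := `|u - 1|; nra.
(* On [[1, 2 - de]] one has [phi u >= 1 - (u - 1) >= de], and [u <= 2] gives [w u >= 1/9]. *)
- move=> de /andP[de0 de1]; exists (9^-1 * (1 - de)); first by rewrite mulr_gt0 ?subr_gt0.
  move=> N; have -> : 9^-1 * (1 - de) * de ^+ N = de ^+ N * 9^-1 * ((2 - de) - 1) by ring.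
  apply: (integral_mass (f := fun y => phi y ^+ N * w y)).
  + by lra.
  + by rewrite mulr_ge0 ?exprn_ge0.
  + by apply: measurable_funM => //; exact: measurable_funX.
  + by move=> y; rewrite mulr_ge0 ?exprn_ge0.
  + move=> u /andP[ua ub]; have u0 : 0 < u by lra.
    apply: ler_pM; rewrite ?exprn_ge0// ?invr_ge0//.
      rewrite lerXn2r ?nnegrE//; rewrite phiE//.
      have : ((u - 1) / (u + 1)) ^+ 2 <= u - 1.
        have u10 : 0 < u + 1 by lra.
        by rewrite expr_div_n ler_pdivrMr ?exprn_gt0// !expr2; nra.
      lra.
    rewrite /w /pos u0 mul1r lef_pV2 ?posrE ?exprn_gt0 ?u1//.
    by rewrite expr2; nra.
  + by case: (has_cint_real (hA N)).
Qed.
End laplace_applications.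

(** * The closed form of Cauchy's integral *)

Section cauchy_formula.
Context (R : realType).
Implicit Types (p q s t z : R[i]).

Lemma Re_neq0 z : 0 < Re z -> z != 0.
Proof. by apply: contraTneq => ->; rewrite /= ltxx. Qed.

Lemma cauchy_beta_step s t : 1 <= Re s -> 1 <= Re t ->
  (s + t - 1) * cauchy_integral s t * beta_integral s t =
  4 * ((s + 1 + (t + 1) - 1) * cauchy_integral (s + 1) (t + 1) * beta_integral (s + 1) (t + 1)).
Proof.
move=> s1 t1.
have s0 : 0 < Re s by exact: lt_le_trans s1.
have t0 : 0 < Re t by exact: lt_le_trans t1.
have st : 1 < Re s + Re t by lra.
have st' : 1 < Re (s + 1) + Re t by rewrite ReD /=; lra.
have hl := cauchy_shift_l st; have hr := cauchy_shift_r st'.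
have hb := beta_integral_shift s0 t0.
have n1 := Re_neq0 s0; have n2 := Re_neq0 t0.
have n3 : s + t != 0 by apply: Re_neq0; rewrite ReD addr_gt0.
move: hl hr hb; move: (cauchy_integral s t) (cauchy_integral (s + 1) t)
  (cauchy_integral (s + 1) (t + 1)) (beta_integral s t) (beta_integral (s + 1) (t + 1)).
move=> C0 C1 C2 B0 B1 hl hr hb.
apply: (mulfI n1); apply: (mulfI n2); apply: (mulfI n3).
have -> : (s + t) * (t * (s * ((s + t - 1) * C0 * B0))) =
  (s + t) * ((s + t - 1) * C0) * (s * t * B0) by ring.
have -> : (s + t) * (t * (s * (4 * ((s + 1 + (t + 1) - 1) * C2 * B1)))) =
  2 * s * (2 * t * C2) * ((s + t) * (s + t + 1) * B1) by ring.
rewrite hb hr -hl; ring.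
Qed.

Lemma cauchy_beta_stepn s t N : 1 <= Re s -> 1 <= Re t ->
  (s + t - 1) * cauchy_integral s t * beta_integral s t =
  4 ^+ N * ((s + N%:R + (t + N%:R) - 1) * cauchy_integral (s + N%:R) (t + N%:R)
    * beta_integral (s + N%:R) (t + N%:R)).
Proof.
move=> s1 t1; elim: N => [|N IH]; first by rewrite expr0 mul1r !addr0.
rewrite IH cauchy_beta_step.
- by rewrite exprSr -(mulrA (4 ^+ N)) -!(addrA _ N%:R 1) natr1.
- by rewrite ReD Re_nat ler_wpDr.
- by rewrite ReD Re_nat ler_wpDr.
Qed.

(** The quotient of the linear factors [s + t - 1] after [N] shifts, from [(s, t)] and from
    [(1, 1)], with [c = s + t - 2]. *)
Lemma cvg_shift_ratio (c : R[i]) :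
  ccvg (fun N => (c + N%:R + N%:R + 1) / (1 + N%:R + N%:R)) 1.
Proof.
have lim : normc c * N.+1%:R^-1 @[N --> \oo] --> (0 : R).
  rewrite -(mulr0 (normc c)); apply: cvgMr; exact: cvg_harmonic.
apply: (squeeze_cvgr _ (cvg_cst 0) lim); apply: nearW => N; rewrite normc_ge0 /=.
have dE : 1 + N%:R + N%:R = (N + N).+1%:R :> R[i] by rewrite -natr1 natrD; ring.
have d0 : (N + N).+1%:R != 0 :> R[i] by rewrite pnatr_eq0.
rewrite dE.
have -> : (c + N%:R + N%:R + 1) / (N + N).+1%:R - 1 = c / (N + N).+1%:R.
  apply: (mulIf d0); rewrite mulrBl !divfK// mul1r -dE; ring.
rewrite Normc.normcM Normc.normcV -(natC R (N + N).+1) normcR ler_wpM2l ?normc_ge0//.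
by rewrite gtr0_norm// lef_pV2 ?posrE// ler_nat ltnS leq_addr.
Qed.

(** In the quotient by the value [pi] at [(1, 1)] the powers of 4 cancel, so it is the same for
    every [N]. It splits into the quotients of linear factors, of Cauchy integrals and of beta
    integrals; the first two tend to 1. *)
Lemma cauchy_beta_product s t : 1 <= Re s -> 1 <= Re t ->
  (s + t - 1) * cauchy_integral s t * beta_integral s t =
  pi%:C * cexp ((2 - s - t) * (ln 2)%:C).
Proof.
move=> s1 t1.
have one : 1 <= Re (1 : R[i]) by [].
have Q1 N := cauchy_beta_stepn N one one.
have Q1E : (1 + 1 - 1) * cauchy_integral 1 1 * beta_integral 1 1 = pi%:C :> R[i].
  by rewrite cauchy_integral11 beta_integral11 addrK mul1r mulr1.
set Q := LHS; have QE N : Q = 4 ^+ N * _ := cauchy_beta_stepn N s1 t1.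
have pi0 : (pi : R)%:C != 0 :> R[i].
  by apply/eqP => /complexI/eqP; rewrite gt_eqF// pi_gt0.
suff : Q / pi%:C = 1 * 1 * cexp ((2 - s - t) * (ln 2)%:C).
  by rewrite !mul1r => <-; rewrite mulrC divfK.
apply: ccvg_cst_eq.
have := ccvgM (ccvgM (cvg_shift_ratio (s + t - 2)) (cauchy_laplace s1 t1)) (beta_laplace s1 t1).
congr ccvg; apply/funext => N.
have n4 : 4 ^+ N != 0 :> R[i] by rewrite expf_neq0// pnatr_eq0.
rewrite -Q1E (Q1 N) (QE N).
have -> : 1 + N%:R + (1 + N%:R) - 1 = 1 + N%:R + N%:R :> R[i] by ring.
have -> : s + N%:R + (t + N%:R) - 1 = s + t - 2 + N%:R + N%:R + 1 :> R[i] by ring.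
move: (cauchy_integral _ _) (cauchy_integral _ _) (beta_integral _ _) (beta_integral _ _).
move=> C0 C1 B0 B1.
by rewrite -[in RHS]mulf_div divff// mul1r -!mulf_div.
Qed.

Lemma cauchy_Gamma_product s t : 1 <= Re s -> 1 <= Re t ->
  cauchy_integral s t * (Gamma s * Gamma t) =
  pi%:C * cexp ((2 - s - t) * (ln 2)%:C) * Gamma (s + t - 1).
Proof.
move=> s1 t1.
have s0 : 0 < Re s by exact: lt_le_trans s1.
have t0 : 0 < Re t by exact: lt_le_trans t1.
have st1 : 0 < Re (s + t - 1) by rewrite ReB ReD /=; lra.
have n := Re_neq0 st1.
have hG := Gamma_shift_pos st1; rewrite subrK in hG.
have hB := beta_integral_Gamma s0 t0.
have hP := cauchy_beta_product s1 t1.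
apply: (mulfI n); rewrite -hB.
move: hP hG; move: (cauchy_integral _ _) (beta_integral _ _) (Gamma _) (Gamma _) (_ * cexp _).
move=> C0 B0 G1 G2 K hP hG.
have -> : (s + t - 1) * (C0 * (G2 * B0)) = (s + t - 1) * C0 * B0 * G2 by ring.
by rewrite hP hG; ring.
Qed.

(** For [t] the conjugate of [s], the number [s + t - 1 = 2 Re s - 1] is real and positive, so the
    right-hand side of the product formula is nonzero, and with it its factor [Gamma s]. *)
Lemma Gamma_neq0 s : 1 <= Re s -> Gamma s != 0.
Proof.
move=> s1; pose t : R[i] := Re s -i* Im s.
have t1 : 1 <= Re t by [].
have e : s + t - 1 = (2 * Re s - 1)%:C.
  by apply: eqc; rewrite ?ReB ?ImB ?ReD ?ImD /=; ring.
have n : Gamma (s + t - 1) != 0 by rewrite e Gamma_real_neq0//; lra.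
have pi0 : (pi : R)%:C != 0 :> R[i].
  by apply/eqP => /complexI/eqP; rewrite gt_eqF// pi_gt0.
apply/eqP => g0; have := cauchy_Gamma_product s1 t1; rewrite g0 mul0r mulr0 => /esym/eqP.
by apply/negP; rewrite mulf_eq0 negb_or n mulf_eq0 negb_or pi0 cexp_neq0.
Qed.

(** Written with [1 / Gamma], so that it keeps its meaning where [s] or [t] is a pole of Gamma. *)
Definition cauchy_value s t : R[i] :=
  pi%:C * cexp ((2 - s - t) * (ln 2)%:C) * Gamma (s + t - 1) * ((Gamma s)^-1 * (Gamma t)^-1).

Lemma cauchy_valueC s t : cauchy_value s t = cauchy_value t s.
Proof.
rewrite /cauchy_value [t + s]addrC [_ * (Gamma s)^-1 in RHS]mulrC.
by have -> : 2 - t - s = 2 - s - t by ring.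
Qed.

Lemma cauchy_value_shift s t : 1 < Re s + Re t ->
  2 * s * cauchy_value (s + 1) t = (s + t - 1) * cauchy_value s t.
Proof.
move=> st; have st1 : 0 < Re (s + t - 1) by rewrite ReB ReD /=; lra.
have hG := Gamma_shift_pos st1.
have hI := invGamma_shift s.
rewrite /cauchy_value.
have -> : s + 1 + t - 1 = s + t - 1 + 1 by ring.
rewrite hG hI.
have -> : cexp ((2 - s - t) * (ln 2)%:C) = 2 * cexp ((2 - (s + 1) - t) * (ln 2)%:C) :> R[i].
  have -> : 2 - s - t = (2 - (s + 1) - t) + 1 by ring.
  by rewrite [(_ + 1) * _]mulrDl mul1r cexpD cexp_lnC// (natC R 2) mulrC.
move: (Gamma _) (Gamma _)^-1 (Gamma _)^-1 (cexp _) (_%:C) => *; ring.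
Qed.

(** Both sides satisfy the recursions in [s] and in [t], whose factor [s + t - 1] has positive real
    part and can be divided out. From real parts at least 1 one descends first in [s], keeping
    [Re t >= 1], then in [t]. *)
Lemma cauchy_formula s t : 1 < Re s + Re t -> cauchy_integral s t = cauchy_value s t.
Proof.
have base s' t' : 1 <= Re s' -> 1 <= Re t' -> cauchy_integral s' t' = cauchy_value s' t'.
  move=> s1 t1; have n1 := Gamma_neq0 s1; have n2 := Gamma_neq0 t1.
  rewrite /cauchy_value -cauchy_Gamma_product//.
  by rewrite -mulrA -invfM divff ?mulr1// mulf_neq0.
have large (z : R[i]) : exists N : nat, 1 <= Re (z + N%:R).
  exists (Num.truncn `|1 - Re z|).+1; rewrite ReD Re_nat -lerBlDl.
  exact: le_trans (ler_norm _) (ltW (truncnS_gt _)).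
have nz s' t' : 1 < Re s' + Re t' -> s' + t' - 1 != 0.
  by move=> h; apply: Re_neq0; rewrite ReB ReD /=; lra.
have step1 N : forall s' t', 1 < Re s' + Re t' -> 1 <= Re t' -> 1 <= Re (s' + N%:R) ->
    cauchy_integral s' t' = cauchy_value s' t'.
  elim: N => [|N IH] s' t' st t1; first by rewrite addr0 => s1; exact: base.
  rewrite -natr1 [N%:R + 1]addrC addrA => s1.
  apply: (mulfI (nz _ _ st)); rewrite -cauchy_shift_l// -cauchy_value_shift// IH//.
  by rewrite ReD /=; lra.
have step2 N : forall s' t', 1 < Re s' + Re t' -> 1 <= Re (t' + N%:R) ->
    cauchy_integral s' t' = cauchy_value s' t'.
  elim: N => [|N IH] s' t' st.
    by rewrite addr0 => t1; have [M hM] := large s'; exact: (step1 M).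
  rewrite -natr1 [N%:R + 1]addrC addrA => t1.
  apply: (mulfI (nz _ _ st)); rewrite -cauchy_shift_r//.
  rewrite cauchy_valueC [s' + t']addrC -cauchy_value_shift; last by rewrite addrC.
  rewrite cauchy_valueC IH//.
  by rewrite ReD /=; lra.
by move=> st; have [N hN] := large t; exact: (step2 N).
Qed.
End cauchy_formula.

(** * The transformation of a row *)

Section pole_functions.
Context (R : realType).
Local Notation TR := (measurableTypeR R).
Local Notation leb := (@lebesgue_measure R).
Implicit Types (a b w : seq R) (x y c : R).

(** The coordinate that replaces the first entry [x] of a row when the weights at the poles [a] are
    held fixed. The scale [b] and the shift [c] allow one formula both when [x] is bounded below by
    a pole [l] and when it is not. *)
Definition pole_fun a b w c x : R :=
  x - c + \sum_(0 <= i < size a) nth 0 w i * nth 0 b i * (nth 0 a i - x)^-1.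

Definition pole_der a b w x : R :=
  1 + \sum_(0 <= i < size a) nth 0 w i * nth 0 b i * ((nth 0 a i - x)^-1 * (nth 0 a i - x)^-1).

Definition below x a := if a is y :: _ then x < y else true.

Definition upper_end a : itv_bound R := if a is y :: _ then BLeft y else +oo%O.

Lemma in_lower_upper x l a :
  (x \in Interval (BRight l) (upper_end a)) = (l < x) && below x a.
Proof. by case: a => [|y a]; rewrite in_itv. Qed.

Lemma in_upper x a : (x \in Interval -oo%O (upper_end a)) = below x a.
Proof. by case: a => [|y a]; rewrite in_itv. Qed.

Lemma sorted_below x a i : sorted <%R a -> below x a -> (i < size a)%N -> x < nth 0 a i.
Proof.
case: a => // y a /= sa xy; have := order_path_min lt_trans sa => /allP h.
by case: i => // i ia; apply: lt_trans xy (h _ (mem_nth _ _)).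
Qed.

Lemma big_nat_ge0 (n : nat) (F : nat -> R) : (forall i, (i < n)%N -> 0 <= F i) ->
  0 <= \sum_(0 <= i < n) F i.
Proof. by move=> F0; rewrite big_nat_cond sumr_ge0// => i /andP[/andP[_ /F0]]. Qed.

Section fixed.
Variables (a b w : seq R) (c : R).
Hypotheses (sa : sorted <%R a) (b0 : forall i, (i < size a)%N -> 0 < nth 0 b i)
  (w0 : forall i, (i < size a)%N -> 0 < nth 0 w i).
Local Notation F := (pole_fun a b w c).
Local Notation f := (pole_der a b w).

Lemma measurable_pole_inv (z : R) : measurable_fun [set: TR] (fun x : TR => (z - x)^-1 : TR).
Proof. by apply: measurable_fun_inv; exact: measurable_funB. Qed.

Lemma measurable_pole_fun : measurable_fun [set: TR] (F : TR -> TR).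
Proof.
apply: measurable_funD; first exact: measurable_funB.
by apply: measurable_sum => i; apply: measurable_funM => //; exact: measurable_pole_inv.
Qed.

Lemma measurable_pole_der : measurable_fun [set: TR] (f : TR -> TR).
Proof.
apply: measurable_funD => //; apply: measurable_sum => i; apply: measurable_funM => //.
by apply: measurable_funM; exact: measurable_pole_inv.
Qed.

Lemma pole_neq0 x i : below x a -> (i < size a)%N -> nth 0 a i - x != 0.
Proof. by move=> xa ia; rewrite subr_eq0 gt_eqF// (sorted_below sa). Qed.

Lemma pole_der_gt0 x : 0 < f x.
Proof.
rewrite ltr_pwDl// big_nat_ge0// => i ia.
by rewrite -expr2 mulr_ge0 ?sqr_ge0// mulr_ge0// ltW ?b0 ?w0.
Qed.

Lemma is_derive_pole_fun x : below x a -> is_derive x 1 F (f x).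
Proof.
move=> xa.
have d1 : is_derive x 1 (fun y : R => y - c) 1.
  have := is_derive_fD (is_derive_id x (1 : R)) (is_derive_cst (- c) x (1 : R)).
  by rewrite addr0.
apply: (is_derive_fD d1).
have : forall n, (n <= size a)%N ->
    is_derive x 1 (fun y => \sum_(0 <= i < n) nth 0 w i * nth 0 b i * (nth 0 a i - y)^-1)
      (\sum_(0 <= i < n) nth 0 w i * nth 0 b i * ((nth 0 a i - x)^-1 * (nth 0 a i - x)^-1)).
  elim=> [_|n IH na].
    under eq_fun do rewrite big_geq//; rewrite big_geq//; exact: is_derive_cst.
  under eq_fun do rewrite big_nat_recr//=; rewrite big_nat_recr//=.
  apply: is_derive_fD; first exact: IH (ltnW na).
  apply: is_derive_fZ.
  have n0 := pole_neq0 xa na.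
  have d2 : is_derive x 1 (fun y : R => nth 0 a n - y) (-1).
    have := is_derive_fD (is_derive_cst (nth 0 a n) x (1 : R)) (is_derive_fN (is_derive_id x (1 : R))).
    by rewrite add0r.
  have := @is_deriveV R (fun y : R => nth 0 a n - y) _ _ _ n0 d2.
  by rewrite /GRing.scale /= mulrN1 opprK expr2 invfM.
by move=> /(_ _ (leqnn _)).
Qed.

Lemma continuous_pole_der x : below x a -> {for x, continuous f}.
Proof.
move=> xa; apply: continuousD; first exact: cst_continuous.
have : forall n, (n <= size a)%N ->
    {for x, continuous (fun y => \sum_(0 <= i < n) nth 0 w i * nth 0 b i *
      ((nth 0 a i - y)^-1 * (nth 0 a i - y)^-1))}.
  elim=> [_|n IH na].
    rewrite (_ : (fun _ => _) = cst 0); first exact: cst_continuous.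
    by apply/funext => y; rewrite big_geq.
  rewrite (_ : (fun _ => _) = (fun y => \sum_(0 <= i < n) nth 0 w i * nth 0 b i *
    ((nth 0 a i - y)^-1 * (nth 0 a i - y)^-1) + nth 0 w n * nth 0 b n *
    ((nth 0 a n - y)^-1 * (nth 0 a n - y)^-1))); last first.
    by apply/funext => y; rewrite big_nat_recr.
  apply: continuousD; first exact: IH (ltnW na).
  have ci : {for x, continuous (fun y : R => (nth 0 a n - y)^-1)}.
    apply: continuous_inv; last exact: pole_neq0.
    by apply: continuousB; [exact: cst_continuous|exact: cvg_id].
  by apply: continuousM; [exact: cst_continuous|exact: continuousM].
by move=> /(_ _ (leqnn _)).
Qed.

Lemma pole_fun_IVT l u y : l <= u -> below u a -> F l <= y <= F u ->
  exists2 x, l <= x <= u & F x = y.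
Proof.
move=> lu ua /andP[ly yu].
have bl x : x <= u -> below x a by case: (a) ua => //= z a' uz xu; exact: le_lt_trans xu uz.
have [||x] := @IVT R F l u y lu.
- apply: continuous_in_subspaceT => x; rewrite inE/= in_itv/= => /andP[_ xu].
  exact: is_derive_continuous (is_derive_pole_fun (bl _ xu)).
- by rewrite ge_min ly/= le_max yu orbT.
- by rewrite in_itv/= => h <-; exists x.
Qed.

Lemma pole_term_ge0 x i : below x a -> (i < size a)%N ->
  0 <= nth 0 w i * nth 0 b i * (nth 0 a i - x)^-1.
Proof.
by move=> xa ia; rewrite !mulr_ge0 ?invr_ge0 ?subr_ge0 ?ltW ?b0 ?w0// (sorted_below sa).
Qed.

Lemma pole_fun_ge_head x : below x a -> (0 < size a)%N ->
  x - c + nth 0 w 0 * nth 0 b 0 * (nth 0 a 0 - x)^-1 <= F x.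
Proof.
move=> xa k0; rewrite /pole_fun lerD2l big_ltn// lerDl.
rewrite big_nat_cond sumr_ge0// => i /andP[/andP[_ ia] _]; exact: pole_term_ge0.
Qed.
End fixed.

Section case_bounded.
Variables (a w : seq R) (l : R).
Hypotheses (sa : sorted <%R (l :: a)) (w0 : forall i, (i < size a)%N -> 0 < nth 0 w i).
Let b := [seq z - l | z <- a].
Let c := l + \sum_(0 <= i < size a) nth 0 w i.

Let sa' : sorted <%R a. Proof. exact: path_sorted sa. Qed.

Lemma below_head : below l a. Proof. by case: (a) sa => //= y s /andP[]. Qed.

Let bE i : (i < size a)%N -> nth 0 b i = nth 0 a i - l.
Proof. by move=> ia; rewrite (nth_map 0). Qed.

Let b0 i : (i < size a)%N -> 0 < nth 0 b i.
Proof. by move=> ia; rewrite bE// subr_gt0 (sorted_below sa')// below_head. Qed.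

(** Scale and shift are chosen to make [F] vanish at [l]; on the interval from [l] to the next pole
    it then increases from 0 to infinity. *)
Lemma pole_fun_bounded x : below x a -> pole_fun a b w c x =
  (x - l) * (1 + \sum_(0 <= i < size a) nth 0 w i * (nth 0 a i - x)^-1).
Proof.
move=> xa; rewrite /pole_fun /c mulrDr mulr1 mulr_sumr.
have e (A B : R) : x - (l + A) + B = x - l + (B - A) by ring.
rewrite e -sumrB; congr (_ + _); apply: eq_big_nat => i /andP[_ ia]; rewrite bE//.
have n0 := pole_neq0 sa' xa ia; by field.
Qed.

Lemma ge0_substitution_bounded (g : TR -> \bar R) :
  measurable_fun setT g -> (forall x, 0 <= g x)%E ->
  (\int[leb]_x (g (pole_fun a b w c x) * (pole_der a b w x * ((l < x) && below x a)%:R)%:E) =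
   \int[leb]_x (g x * ((0 < x)%R%:R)%:E))%E.
Proof.
move=> mg g0.
have F0 x : l <= x -> below x a ->
    x - l <= pole_fun a b w c x.
  move=> lx xa; rewrite pole_fun_bounded// ler_peMr ?subr_ge0// lerDl big_nat_ge0// => i ia.
  by rewrite mulr_ge0 ?invr_ge0 ?subr_ge0 ?ltW ?w0// (sorted_below sa').
apply: etrans (ge0_substitution_gt0 (I := Interval (BRight l) (upper_end a))
  (measurable_pole_fun a b w c) (measurable_pole_der a b w) _ _ _ _ _ mg g0).
- by apply: eq_integral => x _; rewrite in_lower_upper.
- by move=> x; rewrite in_lower_upper => /andP[_ xa]; exact: is_derive_pole_fun.
- by move=> x; rewrite in_lower_upper => /andP[_ xa]; exact: continuous_pole_der.
- by move=> x _; exact: pole_der_gt0.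
- move=> x; rewrite in_lower_upper => /andP[lx xa].
  by apply: lt_le_trans (F0 _ (ltW lx) xa); rewrite subr_gt0.
move=> y y0.
have [u [lu ua yu]] : exists u, [/\ l <= u, below u a & y <= pole_fun a b w c u].
  have [k0|k0] := posnP (size a).
    move/size0nil : k0 => a0; exists (l + y); rewrite lerDl (ltW y0); split => //.
      by rewrite a0.
    rewrite -[leLHS](addKr l) addrC; apply: F0; first by rewrite lerDl ltW.
    by rewrite a0.
  have la : l < nth 0 a 0 by apply: (sorted_below sa') => //; exact: below_head.
  pose A := nth 0 a 0 - l; have A0 : 0 < A by rewrite subr_gt0.
  have W0 : 0 < nth 0 w 0 by exact: w0.
  (* At distance [de] below the first pole, [F] is at least [(A - de) w_0 / de]; the first bound on
     [de] makes this at least [(A / 2) w_0 / de], the second makes it at least [y]. *)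
  pose de := Num.min (A / 2) (A * nth 0 w 0 / (2 * y)).
  have de0 : 0 < de by rewrite lt_min !divr_gt0 ?mulr_gt0.
  have de1 : de <= A / 2 by rewrite ge_min lexx.
  have de2 : de <= A * nth 0 w 0 / (2 * y) by rewrite ge_min lexx orbT.
  have ub : below (nth 0 a 0 - de) a.
    by case: (a) k0 => //= z s _; rewrite ltrBlDr ltrDl.
  exists (nth 0 a 0 - de); split => //.
    by rewrite lerBrDr addrC -lerBrDr; apply: le_trans de1 _; rewrite -/A; lra.
  rewrite pole_fun_bounded// big_ltn//.
  have -> : nth 0 a 0 - de - l = A - de by rewrite /A; ring.
  have -> : nth 0 a 0 - (nth 0 a 0 - de) = de by ring.
  set S := \sum_(1 <= i < _) _.
  have S0 : 0 <= S.
    rewrite /S big_nat_cond sumr_ge0// => i /andP[/andP[_ ia] _].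
    by rewrite mulr_ge0 ?invr_ge0 ?subr_ge0 ?ltW ?w0// (sorted_below sa').
  apply: (@le_trans _ _ ((A / 2) * (nth 0 w 0 * de^-1))).
    rewrite mulrA ler_pdivlMr// -ler_pdivlMl//.
    by apply: le_trans de2 _; rewrite le_eqVlt; apply/orP; left; apply/eqP; field; rewrite gt_eqF.
  apply: ler_pM; rewrite ?mulr_ge0 ?invr_ge0 ?(ltW A0) ?(ltW W0) ?(ltW de0)//; first by lra.
  by rewrite addrCA lerDl addr_ge0.
have [|x /andP[lx xu] Fx] := @pole_fun_IVT a b w c sa' l u y lu ua.
- rewrite yu andbT pole_fun_bounded ?below_head// subrr mul0r; exact: ltW.
- exists x => //; rewrite in_lower_upper.
  apply/andP; split; last by case: (a) ua => //= z s uz; exact: le_lt_trans xu uz.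
  rewrite lt_neqAle lx andbT; apply/eqP => e; move: Fx; rewrite -e pole_fun_bounded ?below_head//.
  by rewrite subrr mul0r => e0; move: y0; rewrite -e0 ltxx.
Qed.
End case_bounded.

Section case_unbounded.
Variables (a w : seq R).
Hypotheses (sa : sorted <%R a) (w0 : forall i, (i < size a)%N -> 0 < nth 0 w i).
Let b := nseq (size a) (1 : R).

Let bE i : (i < size a)%N -> nth 0 b i = 1.
Proof. by move=> ia; rewrite nth_nseq ia. Qed.

Let b0 i : (i < size a)%N -> 0 < nth 0 b i.
Proof. by move=> ia; rewrite bE. Qed.

(** Without a lower pole, [x + \sum w_i / (a_i - x)] increases over the whole line as [x] runs from
    minus infinity to the first pole. *)
Lemma ge0_substitution_unbounded (g : TR -> \bar R) :
  measurable_fun setT g -> (forall x, 0 <= g x)%E ->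
  (\int[leb]_x (g (pole_fun a b w 0 x) * (pole_der a b w x * (below x a)%:R)%:E) =
   \int[leb]_x g x)%E.
Proof.
move=> mg g0.
refine (etrans _ (ge0_substitutionT (I := Interval -oo%O (upper_end a))
  (measurable_pole_fun a b w 0) (measurable_pole_der a b w) _ _ _ _ mg g0)).
- by apply: eq_integral => x _; rewrite in_upper.
- by move=> x; rewrite in_upper => xa; exact: is_derive_pole_fun.
- by move=> x; rewrite in_upper => xa; exact: continuous_pole_der.
- by move=> x _; exact: pole_der_gt0.
move=> y.
have [k0|k0] := posnP (size a).
  exists y; first by rewrite in_upper (size0nil k0).
  by rewrite /pole_fun k0 big_geq// subr0 addr0.
have W0 : 0 < nth 0 w 0 by exact: w0.
set a0 := nth 0 a 0.
pose S := \sum_(0 <= i < size a) nth 0 w i.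
(* At distance at least 1 from every pole the sum is at most [S], so [F lo <= lo + S <= y]. *)
pose lo := Num.min (a0 - 1) (y - S).
have lo1 : lo <= a0 - 1 by rewrite ge_min lexx.
have lo2 : lo <= y - S by rewrite ge_min lexx orbT.
(* Near the pole [F] is at least [a0 - de + w_0 / de >= a0 - 1 + D >= y]. *)
pose D := `|y| + `|a0| + 1.
have D0 : 0 < D by rewrite ltr_wpDl// addr_ge0.
pose de := Num.min 1 (nth 0 w 0 / D).
have de0 : 0 < de by rewrite lt_min ltr01 divr_gt0.
have de1 : de <= 1 by rewrite ge_min lexx.
have de2 : de <= nth 0 w 0 / D by rewrite ge_min lexx orbT.
have blw x : x < a0 -> below x a by rewrite /a0; case: (a) k0.
have ub : below (a0 - de) a by apply: blw; rewrite ltrBlDr ltrDl.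
have lb : below lo a by apply: blw; apply: le_lt_trans lo1 _; rewrite ltrBlDr ltrDl.
have lohi : lo <= a0 - de by apply: le_trans lo1 _; rewrite lerD2l lerN2.
have [|x /andP[lx xu] Fx] := @pole_fun_IVT a b w 0 sa lo (a0 - de) y lohi ub.
  apply/andP; split.
    rewrite /pole_fun subr0; apply: (@le_trans _ _ (lo + S)); last by lra.
    rewrite lerD2l /S big_nat_cond [leRHS]big_nat_cond; apply: ler_sum => i /andP[/andP[_ ia] _].
    rewrite bE// mulr1 -[leRHS]mulr1 ler_wpM2l ?(ltW (w0 ia))//.
    have ai : a0 <= nth 0 a i.
      have := sorted_leq_nth (@le_trans _ R) (@lexx _ R) 0 (sub_sorted ltW sa).
      by apply.
    by rewrite invf_le1; lra.
  apply: (le_trans _ (pole_fun_ge_head 0 sa b0 w0 ub k0)).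
  rewrite bE// mulr1 subr0 -/a0.
  have -> : a0 - (a0 - de) = de by ring.
  have : D <= nth 0 w 0 * de^-1.
    by rewrite ler_pdivlMr// mulrC -ler_pdivlMr.
  rewrite /D; have := ler_norm y; have := ler_norm (- a0); rewrite normrN; lra.
exists x => //; rewrite in_upper; apply: blw; apply: le_lt_trans xu _.
by rewrite ltrBlDr ltrDl.
Qed.
End case_unbounded.
End pole_functions.

(** * Partial fraction weights of interlacing sequences *)

Section interlacing_weights.
Context (R : realType).
Local Notation TR := (measurableTypeR R).
Local Notation leb := (@lebesgue_measure R).
Local Notation mu := (@tuple_lebesgue R).
Implicit Types (a b w x t s : seq R).

Fixpoint vdm x : R := if x is y :: t then (\prod_(z <- t) (z - y)) * vdm t else 1.

(** Interlacing of sequences of equal length, [a_1 < x_1 < a_2 < x_2 < ...]: the shape of a row once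
    its smallest entry has been removed. *)
Fixpoint chain a x : bool :=
  match a, x with
  | [::], [::] => true
  | l :: a', y :: x' => [&& l < y, below y a' & chain a' x']
  | _, _ => false
  end.

(** The numbers [w_i] with [\prod (z - x_i) / \prod (z - a_i) = 1 - \sum w_i / (z - a_i)]. A further
    factor [(z - y) / (z - l)] creates the weight at [l] and multiplies the one at [a_i] by
    [(a_i - y) / (a_i - l)]. *)
Fixpoint wts a x : seq R :=
  match a, x with
  | l :: a', y :: x' =>
    (y - l) * (1 + \sum_(0 <= i < size a') nth 0 (wts a' x') i * (nth 0 a' i - l)^-1) ::
    mulseq [seq (z - y) * (z - l)^-1 | z <- a'] (wts a' x')
  | _, _ => [::]
  end.

Lemma size_wts a x : size x = size a -> size (wts a x) = size a.
Proof.
elim: a x => [|l a IH] [|y x]//= [sx].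
by rewrite size_mulseq ?size_map IH.
Qed.

Lemma chain_size a x : chain a x -> size x = size a.
Proof. by elim: a x => [|l a IH] [|y x]//= /and3P[_ _ /IH ->]. Qed.

Lemma chain_sorted a x : chain a x -> sorted <%R a.
Proof.
elim: a x => [|l a IH] [|y x]//= /and3P[ly ya /[dup] ch /IH sa].
by case: a ya sa {IH ch} => //= z a yz ->; rewrite (lt_trans ly).
Qed.

Lemma wts_gt0 a x i : chain a x -> (i < size a)%N -> 0 < nth 0 (wts a x) i.
Proof.
elim: a x i => [|l a IH] [|y x]//= i /and3P[ly ya ch].
have sa := chain_sorted ch; have sx := chain_size ch.
have la : below l a by case: (a) ya => //= z s; exact: lt_trans ly.
case: i => [|i] /= ia.
  rewrite mulr_gt0 ?subr_gt0// ltr_pwDl// big_nat_ge0// => j ja.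
  by rewrite mulr_ge0 ?invr_ge0 ?subr_ge0 ?ltW ?IH// (sorted_below sa).
rewrite nth_mulseq ?size_map ?size_wts// (nth_map 0)// !mulr_gt0 ?invr_gt0 ?subr_gt0 ?IH//.
  exact: (sorted_below sa).
exact: (sorted_below sa).
Qed.

(* partial fractions of [\prod (z - y) / \prod (z - a)] *)
Lemma wts_prod (K : fieldType) (f : {rmorphism R -> K}) a x (z : K) : chain a x ->
  (forall i, (i < size a)%N -> z != f (nth 0 a i)) ->
  \prod_(y <- x) (z - f y) = \prod_(y <- a) (z - f y) *
    (1 - \sum_(0 <= i < size a) f (nth 0 (wts a x) i) / (z - f (nth 0 a i))).
Proof.
elim: a x => [|l a IH] [|y x]//=; first by move=> _ _; rewrite !big_nil subr0 mulr1.
move=> /and3P[ly ya ch] za.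
have sa := chain_sorted ch; have sx := chain_size ch.
have la : below l a by case: (a) ya => //= z' s; exact: lt_trans ly.
rewrite big_cons IH// => [|i ia]; last exact: (za i.+1).
rewrite big_cons big_nat_recl//= mulrCA -[RHS]mulrA [RHS]mulrCA; congr (_ * _).
have zl : z - f l != 0 by rewrite subr_eq0 (za 0%N).
have al i : (i < size a)%N -> nth 0 a i - l != 0.
  by move=> ia; rewrite subr_eq0 gt_eqF// (sorted_below sa).
have zz i : (i < size a)%N -> z - f (nth 0 a i) != 0.
  by move=> ia; rewrite subr_eq0 (za i.+1).
rewrite (rmorphM f (y - l)) (rmorphD f 1) rmorph1 (rmorph_sum f) (rmorphB f y l).
set S1 := \sum_(0 <= i < size a) f _ / _; set S2 := \sum_(0 <= i < size a) f (_ / _).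
set S3 := \sum_(0 <= i < size a) f (nth 0 (mulseq _ _) i) / _.
(* Term by term this is [(z - y)(a - l) = (y - l)(z - a) + (z - l)(a - y)]. *)
have key : (z - f y) * S1 = (f y - f l) * S2 + (z - f l) * S3.
  rewrite !mulr_sumr -big_split /=; apply: eq_big_nat => i /andP[_ ia].
  rewrite nth_mulseq ?size_map ?size_wts// (nth_map 0)// !rmorphM !fmorphV !rmorphB.
  have := al i ia; rewrite -(fmorph_eq0 f) rmorphB => n1; have n2 := zz i ia.
  by field; rewrite n1 n2.
rewrite mulrBr mulr1 key; by field.
Qed.

Lemma wts_sum_gt0 a x l : below l a -> chain a x ->
  0 < 1 + \sum_(0 <= i < size a) nth 0 (wts a x) i * (nth 0 a i - l)^-1.
Proof.
move=> la ch; have sa := chain_sorted ch; rewrite ltr_pwDl// big_nat_ge0// => i ia.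
by rewrite mulr_ge0 ?invr_ge0 ?subr_ge0 ?ltW ?wts_gt0// (sorted_below sa).
Qed.

(** The partial fraction identity at a point below all poles. It evaluates the factor that a new
    smallest entry adds to the Vandermonde product of a row. *)
Lemma chain_prod a x l : below l a -> chain a x ->
  \prod_(y <- x) (y - l) = \prod_(z <- a) (z - l) *
    (1 + \sum_(0 <= i < size a) nth 0 (wts a x) i * (nth 0 a i - l)^-1).
Proof.
move=> la ch; have sa := chain_sorted ch.
have lai i : (i < size a)%N -> l != nth 0 a i.
  by move=> ik; rewrite lt_eqF// (sorted_below sa).
have := @wts_prod R idfun a x l ch lai; rewrite /= => e.
have neg (s : seq R) : \prod_(y <- s) (y - l) = (-1) ^+ size s * \prod_(y <- s) (l - y).
  elim: s => [|y s IH]; first by rewrite !big_nil mulr1.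
  by rewrite !big_cons IH exprS /=; ring.
rewrite !neg (chain_size ch) e -mulrA; congr (_ * (_ * _)).
congr (1 + _); rewrite -sumrN; apply: eq_big_nat => i /andP[_ ik].
by rewrite -mulrN -invrN opprB.
Qed.

Definition apos w : R := \prod_(z <- w) pos z.

Lemma apos_all w : apos w = (all (fun z => 0 < z) w)%:R.
Proof.
elim: w => [|z w IH]; rewrite /apos ?big_nil// big_cons -/(apos w) IH /pos /=.
by case: (0 < z); rewrite ?mul1r ?mul0r.
Qed.

Lemma apos_ge0 w : 0 <= apos w.
Proof. by rewrite apos_all. Qed.

Lemma all_nth_gt0 w i : all (fun z => 0 < z) w -> (i < size w)%N -> 0 < nth 0 w i.
Proof. by move=> /(all_nthP 0) h iw; exact: h. Qed.

Lemma tmeasurable_prod N (F : R -> R) : measurable_fun [set: TR] (F : TR -> TR) ->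
  tmeasurable N (fun w => \prod_(z <- w) F z : TR).
Proof.
move=> mF; rewrite /tmeasurable.
rewrite (_ : (fun _ => _) = (fun w : N.-tuple TR => \prod_(i <- iota 0 N) F (nth 0 w i))); last first.
  by apply/funext => w; rewrite (big_nth 0) size_tuple /index_iota subn0.
by apply: measurable_prod => i _; exact: (measurableT_comp mF (@measurable_nth R N i)).
Qed.

Lemma tmeasurable_apos N : tmeasurable N (apos : seq R -> TR).
Proof. by apply: tmeasurable_prod; exact: measurable_pos. Qed.

Lemma tmeasurableS d (Y : measurableType d) N (f : seq R -> Y) :
  measurable_fun setT (fun z : TR * N.-tuple TR => f (z.1 :: z.2)) -> tmeasurable N.+1 f.
Proof.
move=> mf.
have mp : measurable_fun setT (fun t : N.+1.-tuple TR => (thead t, [tuple of behead t])).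
  by apply: measurable_fun_pair; [exact: measurable_tnth|exact: measurable_behead].
have := measurableT_comp mf mp.
by congr measurable_fun; apply/funext => t /=; rewrite {3}(tuple_eta t).
Qed.

End interlacing_weights.

(** * Removing the smallest entry of a row *)

Section peeling.
Context (R : realType).
Local Notation TR := (measurableTypeR R).
Local Notation leb := (@lebesgue_measure R).
Local Notation mu := (@tuple_lebesgue R).
Variables (a b : seq R) (c0 c1 : R) (inI : R -> bool) (J : R -> R).
Hypotheses (sa : sorted <%R a) (sb : size b = size a)
  (b0 : forall i, (i < size a)%N -> 0 < nth 0 b i).
Hypotheses (inI_below : forall x, inI x -> below x a)
  (mI : measurable_fun [set: TR] (fun x : TR => (inI x)%:R : TR)).
Hypothesis subst : forall w, size w = size a -> all (fun z => 0 < z) w ->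
  forall g : TR -> \bar R, measurable_fun setT g -> (forall x, 0 <= g x)%E ->
  (\int[leb]_x (g (pole_fun a b w (c0 + c1 * \sum_(0 <= i < size a) nth 0 w i) x) *
     (pole_der a b w x * (inI x)%:R)%:E) = \int[leb]_x (g x * (J x)%:E))%E.
Hypothesis weights : forall g : seq R -> \bar R, tmeasurable (size a) g ->
  (forall t, 0 <= g t)%E ->
  (\int[mu (size a)]_t (g (wts a t) * (vdm t * (chain a t)%:R)%:E) =
   (vdm a)%:E * \int[mu (size a)]_w (g w * (apos w)%:E))%E.

Local Notation k := (size a).

Definition peel_scale (x : R) := [seq (p.1 - x) * p.2^-1 | p <- zip a b].

(** The value at [x] of [pole_fun] with the rescaled weights [mulseq (peel_scale x) w], expressed
    through the weights [w] of the remaining entries. *)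
Definition peel_head (x : R) (w : seq R) : R :=
  x - (c0 + c1 * \sum_(0 <= i < k) nth 0 (mulseq (peel_scale x) w) i) +
  \sum_(0 <= i < k) nth 0 w i.

Definition peel_map (x : R) (w : seq R) := peel_head x w :: mulseq (peel_scale x) w.

Let size_scale x : size (peel_scale x) = k.
Proof. by rewrite size_map size_zip sb minnn. Qed.

Let nth_scale x i : (i < k)%N -> nth 0 (peel_scale x) i = (nth 0 a i - x) * (nth 0 b i)^-1.
Proof. by move=> ik; rewrite (nth_map (0, 0)) ?size_zip ?sb ?minnn// nth_zip. Qed.

Let bneq0 i : (i < k)%N -> nth 0 b i != 0.
Proof. by move=> /b0 h; rewrite gt_eqF. Qed.

Let scale_gt0 x i : below x a -> (i < k)%N -> 0 < nth 0 (peel_scale x) i.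
Proof. by move=> xa ik; rewrite nth_scale// divr_gt0 ?b0// subr_gt0 (sorted_below sa). Qed.

Let all_scale x : below x a -> all (fun z => 0 < z) (peel_scale x).
Proof. by move=> xa; apply/(all_nthP 0) => i; rewrite size_scale => ik; exact: scale_gt0. Qed.

Let prod_scale x : below x a ->
  \prod_(z <- a) (z - x) = (\prod_(z <- b) z) * \prod_(z <- peel_scale x) z.
Proof.
move=> xa; rewrite [LHS](big_nth 0) [X in X * _](big_nth 0) [X in _ * X](big_nth 0).
rewrite size_scale sb -big_split/=; apply: eq_big_nat => i /andP[_ ik].
by rewrite nth_scale// mulrCA mulfV ?bneq0// mulr1.
Qed.

Let all_mulseq x w : below x a -> size w = k ->
  all (fun z => 0 < z) (mulseq (peel_scale x) w) = all (fun z => 0 < z) w.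
Proof.
move=> xa sw; apply/(all_nthP 0)/(all_nthP 0); rewrite size_mulseq ?size_scale ?sw// => h i ik;
  have := h i ik; rewrite nth_mulseq ?size_scale ?sw// pmulr_rgt0//; exact: scale_gt0.
Qed.

(** [G] is the integrand in the weights of the remaining entries, [Gt] the one after rescaling. The
    absolute value keeps [G] nonnegative where [w] leaves the orthant. *)
Let G (g : seq R -> \bar R) (x : R) (w : seq R) : \bar R :=
  (g (peel_map x w) * (\prod_(z <- a) (z - x) *
    `|1 + \sum_(0 <= i < k) nth 0 w i * (nth 0 a i - x)^-1|)%:E)%E.

Let Gt (g : seq R -> \bar R) (x : R) (w : seq R) : \bar R :=
  (g (pole_fun a b w (c0 + c1 * \sum_(0 <= i < k) nth 0 w i) x :: w) *
   (pole_der a b w x * (inI x)%:R)%:E * (apos w)%:E)%E.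

Let Gt_ge0 g x w : (forall t, 0 <= g t)%E -> size w = k -> (0 <= Gt g x w)%E.
Proof.
move=> g0 sw; rewrite /Gt apos_all; case: (boolP (all _ _)) => wp; last by rewrite mule0.
rewrite mule1 mule_ge0// lee_fin mulr_ge0// ltW//; apply: pole_der_gt0 => // i ik.
by apply: all_nth_gt0 => //; rewrite sw.
Qed.

Let measurable_Gt g : tmeasurable k.+1 g ->
  measurable_fun setT (fun z : TR * k.-tuple TR => Gt g z.1 z.2).
Proof.
move=> mg.
have mn i : measurable_fun setT (fun z : TR * k.-tuple TR => nth 0 z.2 i : TR).
  exact: (measurableT_comp (@measurable_nth R k i) measurable_snd).
have mi i : measurable_fun setT (fun z : TR * k.-tuple TR => (nth 0 a i - z.1)^-1 : TR).
  exact: (measurableT_comp (measurable_pole_inv (nth 0 a i)) measurable_fst).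
apply: emeasurable_funM; last first.
  by apply/measurable_EFinP; exact: (measurableT_comp (@tmeasurable_apos R k) measurable_snd).
apply: emeasurable_funM; last first.
  apply/measurable_EFinP; apply: measurable_funM.
    apply: measurable_funD => //; apply: measurable_sum => i.
    exact: (measurable_funM (measurable_funM (mn i) (measurable_cst _)) (measurable_funM (mi i) (mi i))).
  exact: (measurableT_comp mI measurable_fst).
apply: (tmeasurable_comp (M := k.+1)) => //; first by move=> z /=; rewrite size_tuple.
move=> [|i] _ /=; last exact: mn.
apply: measurable_funD.
  apply: measurable_funB => //; apply: measurable_funD => //; apply: measurable_funM => //.
  by apply: measurable_sum => i; exact: mn.
apply: measurable_sum => i.
exact: (measurable_funM (measurable_funM (mn i) (measurable_cst _)) (mi i)).
Qed.

Let measurable_G g x : tmeasurable k.+1 g -> tmeasurable k (G g x).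
Proof.
move=> mg; have mn i := @measurable_nth R k i.
have ms i : measurable_fun setT (fun w : k.-tuple TR => nth 0 (mulseq (peel_scale x) w) i : TR).
  under eq_fun do rewrite nth_mulseq ?size_scale ?size_tuple//.
  exact: (measurable_funM (measurable_cst _) (mn i)).
apply: emeasurable_funM.
  apply: (tmeasurable_comp (M := k.+1)) => //.
    by move=> w /=; rewrite size_mulseq size_tuple.
  move=> [|i] _ /=; last exact: ms.
  apply: measurable_funD; last by apply: measurable_sum => i; exact: mn.
  apply: measurable_funB => //; apply: measurable_funD => //; apply: measurable_funM => //.
  by apply: measurable_sum => i; exact: ms.
apply/measurable_EFinP; apply: measurable_funM => //; apply: measurableT_comp => //.
apply: measurable_funD => //; apply: measurable_sum => i.
exact: (measurable_funM (mn i) (measurable_cst _)).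
Qed.

Let vdm_cons x t : below x a -> chain a t ->
  \prod_(y <- t) (y - x) = \prod_(z <- a) (z - x) *
    `|1 + \sum_(0 <= i < k) nth 0 (wts a t) i * (nth 0 a i - x)^-1|.
Proof. by move=> xa ch; rewrite (chain_prod xa ch) ger0_norm ?ltW ?wts_sum_gt0. Qed.

Let G_Gt g x w : inI x -> size w = k ->
  (G g x w * (apos w)%:E =
   (\prod_(z <- b) z)%:E * (Gt g x (mulseq (peel_scale x) w) * (\prod_(z <- peel_scale x) z)%:E))%E.
Proof.
move=> xI sw; have xa := inI_below xI.
rewrite /G /Gt !apos_all all_mulseq// xI mulr1.
case: (boolP (all _ _)) => wp; last by rewrite !mule0 mul0e mule0.
rewrite !mule1 prod_scale//.
have w0 i : (i < k)%N -> 0 < nth 0 w i by move=> ik; apply: all_nth_gt0 => //; rewrite sw.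
have e1 : pole_fun a b (mulseq (peel_scale x) w)
    (c0 + c1 * \sum_(0 <= i < k) nth 0 (mulseq (peel_scale x) w) i) x = peel_head x w.
  rewrite /pole_fun /peel_head; congr (_ + _); apply: eq_big_nat => i /andP[_ ik].
  rewrite nth_mulseq ?size_scale ?sw// nth_scale//.
  have n1 := bneq0 ik; have n2 := pole_neq0 sa xa ik; by field; rewrite n1 n2.
have e2 : pole_der a b (mulseq (peel_scale x) w) x =
    `|1 + \sum_(0 <= i < k) nth 0 w i * (nth 0 a i - x)^-1|.
  rewrite ger0_norm; last first.
    rewrite addr_ge0// big_nat_ge0// => i ik.
    by rewrite mulr_ge0 ?invr_ge0 ?subr_ge0 ?ltW ?w0// (sorted_below sa).
  rewrite /pole_der; congr (_ + _); apply: eq_big_nat => i /andP[_ ik].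
  rewrite nth_mulseq ?size_scale ?sw// nth_scale//.
  have n1 := bneq0 ik; have n2 := pole_neq0 sa xa ik; by field; rewrite n1 n2.
rewrite e1 e2 -/(peel_map x w) -[in RHS]muleA -EFinM [RHS]muleCA -EFinM.
by congr (_ * _%:E)%E; ring.
Qed.

(** For fixed [x] the hypothesis [weights] replaces the other entries by their weights. The factor
    that [x] adds to the Vandermonde product splits in two: [\prod (a_i - x)] is [\prod b] times the
    Jacobian of the rescaling by [peel_scale x], and the rest is the derivative of [pole_fun] at the
    rescaled weights. After Tonelli these are fixed, and one substitution in [x] remains. *)
Lemma peel (g : seq R -> \bar R) : tmeasurable k.+1 g -> (forall t, 0 <= g t)%E ->
  (\int[leb]_x \int[mu k]_t (g (peel_map x (wts a t)) *
     (vdm (x :: t) * (inI x && chain a t)%:R)%:E) =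
   (vdm a * \prod_(z <- b) z)%:E * \int[mu k]_w \int[leb]_y (g (y :: w) * (J y * apos w)%:E))%E.
Proof.
move=> mg g0.
have vdma0 : 0 <= vdm a.
  elim: (a) sa => //= y s IH ps; rewrite mulr_ge0 ?(IH (path_sorted ps))//.
  rewrite big_seq prodr_ge0// => z zs; rewrite subr_ge0 ltW//.
  by have /allP := order_path_min lt_trans ps; apply.
have b0' : 0 <= \prod_(z <- b) z.
  rewrite (big_nth 0) sb big_nat_cond prodr_ge0// => i /andP[/andP[_ ik] _].
  exact: ltW (b0 ik).
have mGt := measurable_Gt mg.
have Gt0 (z : TR * k.-tuple TR) : (0 <= Gt g z.1 z.2)%E by rewrite Gt_ge0// size_tuple.
transitivity (\int[leb]_x ((vdm a * \prod_(z <- b) z)%:E * \int[mu k]_w Gt g x w))%E.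
  apply: eq_integral => x _.
  have [xI|xI] := boolP (inI x); last first.
    rewrite integral0_eq; last by move=> t _; rewrite andFb mulr0 mule0.
    rewrite integral0_eq ?mule0// => w _.
    by rewrite /Gt (negbTE xI) mulr0 mule0 mul0e.
  have xa := inI_below xI.
  transitivity (\int[mu k]_t (G g x (wts a t) * (vdm t * (chain a t)%:R)%:E))%E.
    apply: eq_integral => t _; rewrite andTb.
    case: (boolP (chain a t)) => ch; last by rewrite !mulr0 !mule0.
    by rewrite /= vdm_cons// !mulr1 /G EFinM muleA.
  rewrite weights; last 2 first.
  - exact: measurable_G.
  - move=> t; rewrite mule_ge0// lee_fin mulr_ge0//.
    rewrite big_seq prodr_ge0// => z /(nthP 0)[i ik <-].
    by rewrite subr_ge0 ltW// (sorted_below sa).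
  rewrite EFinM -muleA; congr (_ * _)%E.
  pose h w := if size w == k then Gt g x w else 0%E.
  have h0 w : (0 <= h w)%E by rewrite /h; case: eqP => // sw; exact: Gt_ge0.
  have mh : tmeasurable k h.
    have := measurableT_comp mGt (measurable_pair1 x); congr measurable_fun.
    by apply/funext => w /=; rewrite /h size_tuple eqxx.
  have -> : (\int[mu k]_w Gt g x w = \int[mu k]_w h w)%E.
    by apply: eq_integral => w _; rewrite /h size_tuple eqxx.
  rewrite -(ge0_integral_mulseq (size_scale x) (all_scale xa) mh h0).
  have s0 : 0 <= \prod_(z <- peel_scale x) z.
    by rewrite big_seq prodr_ge0// => z /(allP (all_scale xa))/ltW.
  rewrite -ge0_integralZl//; last 2 first.
  - apply: emeasurable_funM => //; exact: tmeasurable_mulseq.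
  - by move=> w _; rewrite mule_ge0.
  apply: eq_integral => w _; rewrite G_Gt ?size_tuple//.
  by rewrite /h size_mulseq size_tuple ?eqxx// size_scale.
rewrite ge0_integralZl//; last 3 first.
- exact: (measurable_fun_fubini_tonelli_F (m2 := mu k) (fun z : TR * k.-tuple TR => Gt g z.1 z.2) mGt).
- by move=> x _; apply: integral_ge0 => w _; exact: (Gt0 (x, w)).
- by rewrite lee_fin mulr_ge0.
congr (_ * _)%E.
rewrite (fubini_tonelli (m1 := leb) (m2 := mu k) (fun z : TR * k.-tuple TR => Gt g z.1 z.2) mGt Gt0).
apply: eq_integral => w _; rewrite /Gt /= apos_all.
case: (boolP (all _ _)) => wp; last first.
  rewrite integral0_eq; last by move=> x _; rewrite mule0.
  by rewrite integral0_eq// => x _; rewrite mulr0 mule0.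
under eq_integral do rewrite mule1.
under [RHS]eq_integral do rewrite mulr1.
apply: (subst (size_tuple w) wp _ (fun y => g0 (y :: w))).
have := measurableT_comp (tmeasurable_pair mg) (measurable_pair2 (w : k.-tuple TR)).
exact.
Qed.
End peeling.

(** * The change of variables for a whole row *)

Section row_transformation.
Context (R : realType).
Local Notation TR := (measurableTypeR R).
Local Notation leb := (@lebesgue_measure R).
Local Notation mu := (@tuple_lebesgue R).
Implicit Types (a b w x t s v : seq R).

Lemma tmeasurable0 d (Y : measurableType d) (f : seq R -> Y) : tmeasurable 0 f.
Proof.
rewrite /tmeasurable (_ : (fun _ => _) = cst (f [::])); first exact: measurable_cst.
by apply/funext => t; rewrite tuple0.
Qed.

Lemma tmeasurable_snd d (Y : measurableType d) N (f : seq R -> Y) : tmeasurable N f ->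
  measurable_fun setT (fun z : TR * N.-tuple TR => f z.2).
Proof. by move=> mf; exact: (measurableT_comp mf measurable_snd). Qed.

Lemma measurable_affine (m c : R) :
  measurable_fun [set: TR] ((fun y : TR => (y - m) * c^-1) : TR -> TR).
Proof.
by apply: measurable_funM => //; exact: measurable_funB.
Qed.

Lemma tmeasurable_vdm N : tmeasurable N (@vdm R : seq R -> TR).
Proof.
elim: N => [|N IH]; first exact: tmeasurable0.
apply: tmeasurableS => /=; apply: measurable_funM; last exact: (tmeasurable_snd IH).
rewrite (_ : (fun _ => _) = (fun z : TR * N.-tuple TR => \prod_(i <- iota 0 N) (nth 0 z.2 i - z.1))).
  apply: measurable_prod => i _; apply: measurable_funB => //.
  exact: (tmeasurable_snd (f := fun s => nth 0 s i : TR) (@measurable_nth R N i)).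
by apply/funext => z; rewrite (big_nth 0) size_tuple /index_iota subn0.
Qed.

Lemma measurable_bool_lt (f g : TR -> TR) : measurable_fun setT f -> measurable_fun setT g ->
  measurable_fun setT (fun y : TR => (f y < g y)%R%:R : TR).
Proof.
move=> mf mg; rewrite (_ : (fun _ => _) = (fun y => pos (g y - f y))).
  by apply: measurable_pos; exact: measurable_funB.
by apply/funext => y; rewrite /pos subr_gt0.
Qed.

Lemma measurable_below a : measurable_fun [set: TR] (fun x : TR => (below x a)%:R : TR).
Proof.
case: a => [|z a] /=; first exact: measurable_cst.
by apply: measurable_bool_lt => //; exact: measurable_id.
Qed.

Lemma natrb_and (b1 b2 : bool) : (b1 && b2)%:R = b1%:R * b2%:R :> R.
Proof. by case: b1; rewrite ?mul1r ?mul0r. Qed.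

Lemma measurable_bounded_below l a :
  measurable_fun [set: TR] (fun x : TR => ((l < x) && below x a)%:R : TR).
Proof.
under eq_fun do rewrite natrb_and.
apply: measurable_funM; last exact: measurable_below.
by apply: measurable_bool_lt => //; exact: measurable_id.
Qed.

Lemma tmeasurable_chain a : tmeasurable (size a) (fun x => (chain a x)%:R : TR).
Proof.
elim: a => [|l a IH]; first exact: tmeasurable0.
apply: tmeasurableS => /=.
under eq_fun do rewrite andbA natrb_and.
apply: measurable_funM; last exact: (tmeasurable_snd IH).
exact: (measurableT_comp (measurable_bounded_below l a) measurable_fst).
Qed.

Lemma measurable_nth_wts a i : tmeasurable (size a) (fun x => nth 0 (wts a x) i : TR).
Proof.
elim: a i => [|l a IH] i; first exact: tmeasurable0.
have IH2 j := tmeasurable_snd (f := fun x => nth 0 (wts a x) j : TR) (IH j).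
apply: tmeasurableS; case: i => [|i] /=.
  apply: measurable_funM; first exact: measurable_funB.
  apply: measurable_funD => //; apply: measurable_sum => j.
  exact: (measurable_funM (IH2 j) (measurable_cst _)).
under eq_fun do rewrite nth_mulseq ?size_map ?size_wts ?size_tuple//.
have [ia|ai] := ltnP i (size a).
  under eq_fun do rewrite (nth_map 0)//.
  apply: measurable_funM; last exact: IH2.
  exact: (measurable_funM (measurable_funB (measurable_cst _) measurable_fst) (measurable_cst _)).
under eq_fun do rewrite nth_default ?size_map// mul0r.
exact: measurable_cst.
Qed.

Lemma tmeasurable_wts d (Y : measurableType d) a (g : seq R -> Y) :
  tmeasurable (size a) g -> tmeasurable (size a) (fun x => g (wts a x)).
Proof.
move=> mg; apply: (tmeasurable_comp (M := size a) (g := g)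
  (Phi := fun x : (size a).-tuple TR => wts a x)) => // [t|i _].
  by rewrite size_wts// size_tuple.
exact: measurable_nth_wts.
Qed.

Lemma vdm_ge0 x : sorted <%R x -> 0 <= vdm x.
Proof.
elim: x => //= y s IH ps; rewrite mulr_ge0 ?(IH (path_sorted ps))//.
rewrite big_seq prodr_ge0// => z zs; rewrite subr_ge0 ltW//.
by have /allP := order_path_min lt_trans ps; apply.
Qed.

Lemma vdm_gt0 x : sorted <%R x -> 0 < vdm x.
Proof.
elim: x => //= y s IH ps; rewrite mulr_gt0 ?(IH (path_sorted ps))//.
rewrite big_seq prodr_gt0// => z zs; rewrite subr_gt0//.
by have /allP := order_path_min lt_trans ps; apply.
Qed.

Lemma chain_sorted2 a x : chain a x -> sorted <%R x.
Proof.
elim: a x => [|l a IH] [|y x]//= /and3P[_ ya ch].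
case: x a ya ch IH => // z x [|m a] //= ym /and3P[mz za ch] IH.
by have := IH (z :: x); rewrite /= mz za ch => /(_ isT) ->; rewrite (lt_trans ym mz).
Qed.

Lemma chain_vdm_ge0 a x : 0 <= vdm x * (chain a x)%:R.
Proof.
by case: (boolP (chain a x)) => [/chain_sorted2/vdm_ge0 h|_]; rewrite ?mulr1 ?mulr0.
Qed.

Lemma tmeasurable_apos_behead N : tmeasurable N.+1 (fun z => apos (behead z) : TR).
Proof. by apply: tmeasurableS => /=; exact: (tmeasurable_snd (@tmeasurable_apos R N)). Qed.

(** Induction on the poles: peeling at the smallest pole [l] with [b_i = a_i - l] contributes
    [\prod (a_i - l)], the quotient of the Vandermonde products of [l :: a] and [a]. *)
Theorem row_chain a : sorted <%R a ->
  forall g : seq R -> \bar R, tmeasurable (size a) g -> (forall t, 0 <= g t)%E ->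
  (\int[mu (size a)]_t (g (wts a t) * (vdm t * (chain a t)%:R)%:E) =
   (vdm a)%:E * \int[mu (size a)]_w (g w * (apos w)%:E))%E.
Proof.
elim: a => [|l a IH] sla g mg g0.
  rewrite (ge0_integral_tuple0 (fun t => g (wts [::] t) * (vdm t * (chain [::] t)%:R)%:E)%E).
  rewrite (ge0_integral_tuple0 (fun w => g w * (apos w)%:E)%E) /= mul1r !mule1 mul1e.
  by rewrite /apos big_nil mule1.
have sa : sorted <%R a := path_sorted sla.
have la i : (i < size a)%N -> l < nth 0 a i.
  by move=> ia; apply: (sorted_below sa) => //; exact: below_head.
rewrite [LHS](ge0_integral_tupleS (N := size a)
  (g := fun t => g (wts (l :: a) t) * (vdm t * (chain (l :: a) t)%:R)%:E)%E); last 2 first.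
- apply: emeasurable_funM; first exact: (tmeasurable_wts (a := l :: a)).
  apply/measurable_EFinP; apply: measurable_funM; first exact: (@tmeasurable_vdm (size a).+1).
  exact: (@tmeasurable_chain (l :: a)).
- by move=> t; rewrite mule_ge0// lee_fin chain_vdm_ge0.
pose b := [seq z - l | z <- a].
have sb : size b = size a by rewrite size_map.
have b0 i : (i < size a)%N -> 0 < nth 0 b i by move=> ia; rewrite (nth_map 0)// subr_gt0 la.
rewrite [RHS](_ : _ = (vdm a * \prod_(z <- b) z)%:E * \int[mu (size a)]_w \int[leb]_y
    (g (y :: w) * (pos y * apos w)%:E))%E; last first.
  rewrite [X in (_ * X)%E](ge0_integral_tupleS2 (N := size a) (g := fun w => g w * (apos w)%:E)%E); last 2 first.
  - by apply: emeasurable_funM => //; apply/measurable_EFinP; exact: (@tmeasurable_apos R (size a).+1).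
  - by move=> t; rewrite mule_ge0// lee_fin apos_ge0.
  have be : vdm a * \prod_(z <- b) z = vdm (l :: a) by rewrite /= big_map mulrC.
  rewrite be; apply: (congr1 (fun X => ((vdm (l :: a))%:E * X)%E)).
  by apply: eq_integral => w _; apply: eq_integral => y _; rewrite /apos big_cons.
have hb : forall y, (l < y) && below y a -> below y a by move=> y /andP[].
have subst : forall w, size w = size a -> all (fun z => 0 < z) w ->
    forall h : TR -> \bar R, measurable_fun setT h -> (forall y : TR, 0 <= h y)%E ->
    (\int[leb]_y (h (pole_fun a b w (l + 1 * \sum_(0 <= i < size a) nth 0 w i) y) *
     (pole_der a b w y * ((l < y) && below y a)%:R)%:E) = \int[leb]_y (h y * (pos y)%:E))%E.
  move=> w sw wp h mh h0; rewrite mul1r.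
  apply: (ge0_substitution_bounded sla) => // i ia; apply: all_nth_gt0 => //.
  by rewrite sw.
have P := @peel R a b l 1 _ _ sa sb b0 hb (@measurable_bounded_below l a) subst (IH sa) g mg g0.
apply: etrans P.
apply: eq_integral => x _; apply: eq_integral => t _ /=; rewrite andbA; congr (g _ * _)%E.
rewrite /peel_map; congr (_ :: mulseq _ _).
  rewrite /peel_head mul1r; set A := \sum_(0 <= i < _) _; set B := \sum_(0 <= i < _) _.
  set C := \sum_(0 <= i < _) _.
  (* By [a_i - l = (a_i - x) + (x - l)] in each term; it identifies the head of [peel_map] with the
     first weight. *)
  have e : B = A + (x - l) * C.
    rewrite mulr_sumr -big_split /=; apply: eq_big_nat => i /andP[_ ia].
    rewrite nth_mulseq ?size_map ?size_zip ?sb ?minnn ?size_wts ?size_tuple//.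
    rewrite (nth_map (0, 0)) ?size_zip ?sb ?minnn// nth_zip//= (nth_map 0)//.
    have n0 : nth 0 a i - l != 0 by rewrite subr_eq0 gt_eqF// la.
    by field.
  by rewrite e; ring.
apply: (@eq_from_nth _ 0); first by rewrite !size_map size_zip sb minnn.
move=> i; rewrite size_map => ia; rewrite (nth_map 0)//.
by rewrite (nth_map (0, 0)) ?size_zip ?sb ?minnn// nth_zip//= (nth_map 0).
Qed.

(** The pair [(c, w)] of the partial fraction expansion: multiplying [1 - \sum u_i / (t - a_i)],
    with [u] the weights of the tail, by [t - x] gives [c = x + \sum u_i] and
    [w_i = (a_i - x) u_i]. *)
Definition row_map a z : seq R :=
  if z is x :: t then
    x + \sum_(0 <= i < size a) nth 0 (wts a t) i :: mulseq [seq y - x | y <- a] (wts a t)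
  else [::].

Definition interlace a z : bool := if z is x :: t then below x a && chain a t else false.

Lemma interlace_sorted a z : interlace a z -> sorted <%R z.
Proof.
case: z => //= x t /andP[xa ch]; have st := chain_sorted2 ch.
case: t a xa ch st => // y t [|l a] //= xl /and3P[ly _ _] st.
by rewrite (lt_trans xl ly).
Qed.

Lemma interlace_vdm_ge0 a z : 0 <= vdm z * (interlace a z)%:R.
Proof.
by case: (boolP (interlace a z)) => [/interlace_sorted/vdm_ge0 h|_]; rewrite ?mulr1 ?mulr0.
Qed.

Lemma tmeasurable_interlace a : tmeasurable (size a).+1 (fun z => (interlace a z)%:R : TR).
Proof.
apply: tmeasurableS => /=.
under eq_fun do rewrite natrb_and.
apply: measurable_funM; last exact: (tmeasurable_snd (@tmeasurable_chain a)).
exact: (measurableT_comp (measurable_below a) measurable_fst).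
Qed.

Lemma measurable_nth_row_map a i : tmeasurable (size a).+1 (fun z => nth 0 (row_map a z) i : TR).
Proof.
have IH j := tmeasurable_snd (f := fun x => nth 0 (wts a x) j : TR) (@measurable_nth_wts a j).
apply: tmeasurableS; case: i => [|i] /=.
  by apply: measurable_funD => //; apply: measurable_sum => j; exact: IH.
under eq_fun do rewrite nth_mulseq ?size_map ?size_wts ?size_tuple//.
have [ia|ai] := ltnP i (size a).
  under eq_fun do rewrite (nth_map 0)//.
  apply: measurable_funM; last exact: IH.
  exact: (measurable_funB (measurable_cst _) measurable_fst).
under eq_fun do rewrite nth_default ?size_map// mul0r.
exact: measurable_cst.
Qed.

Lemma size_row_map a z : size z = (size a).+1 -> size (row_map a z) = (size a).+1.
Proof. by case: z => //= x t [st]; rewrite size_mulseq ?size_map ?size_wts. Qed.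

Lemma tmeasurable_row_map d (Y : measurableType d) a (g : seq R -> Y) :
  tmeasurable (size a).+1 g -> tmeasurable (size a).+1 (fun z => g (row_map a z)).
Proof.
move=> mg; apply: (tmeasurable_comp (M := (size a).+1) (g := g) (Phi := fun x : (size a).+1.-tuple TR => row_map a x)) => // [t|i _].
  by rewrite size_row_map// size_tuple.
exact: measurable_nth_row_map.
Qed.

(** A last peeling with [b = 1] and no shift: no pole lies below the smallest entry, so its
    substitute [c] ranges over the whole line. *)
Theorem row_map_integral a : sorted <%R a ->
  forall g : seq R -> \bar R, tmeasurable (size a).+1 g -> (forall t, 0 <= g t)%E ->
  (\int[mu (size a).+1]_z (g (row_map a z) * (vdm z * (interlace a z)%:R)%:E) =
   (vdm a)%:E * \int[mu (size a)]_w \int[leb]_y (g (y :: w) * (apos w)%:E))%E.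
Proof.
move=> sa g mg g0.
rewrite [LHS](ge0_integral_tupleS (N := size a)
  (g := fun z => g (row_map a z) * (vdm z * (interlace a z)%:R)%:E)%E); last 2 first.
- apply: emeasurable_funM; first exact: tmeasurable_row_map.
  apply/measurable_EFinP; apply: measurable_funM; first exact: (@tmeasurable_vdm (size a).+1).
  exact: tmeasurable_interlace.
- by move=> t; rewrite mule_ge0// lee_fin interlace_vdm_ge0.
pose b := nseq (size a) (1 : R).
have sb : size b = size a by rewrite size_nseq.
have bE i : (i < size a)%N -> nth 0 b i = 1 by move=> ia; rewrite nth_nseq ia.
have be : vdm a * \prod_(z <- b) z = vdm a.
  by rewrite big_seq big1 ?mulr1// => z /nseqP[].
have b0 : forall i, (i < size a)%N -> 0 < nth 0 b i by move=> i ia; rewrite bE.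
have subst : forall w, size w = size a -> all (fun z => 0 < z) w ->
    forall h : TR -> \bar R, measurable_fun setT h -> (forall y : TR, 0 <= h y)%E ->
    (\int[leb]_y (h (pole_fun a b w (0 + 0 * \sum_(0 <= i < size a) nth 0 w i) y) *
     (pole_der a b w y * (below y a)%:R)%:E) = \int[leb]_y (h y * (cst 1 y)%:E))%E.
  move=> w sw wp h mh h0; rewrite mul0r addr0.
  under [RHS]eq_integral do rewrite mule1.
  apply: (ge0_substitution_unbounded sa) => // i ia; apply: all_nth_gt0 => //.
  by rewrite sw.
have P := @peel R a b 0 0 _ _ sa sb b0 (fun _ => id) (@measurable_below a) subst (row_chain sa) g mg g0.
apply: etrans (etrans _ P) _; last first.
  rewrite be; apply: (congr1 (fun X => ((vdm a)%:E * X)%E)).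
  apply: eq_integral => w _; apply: eq_integral => y _.
  by rewrite /cst mul1r.
apply: eq_integral => x _; apply: eq_integral => t _ /=; congr (g _ * _)%E.
rewrite /peel_map; congr (_ :: mulseq _ _); first by rewrite /peel_head mul0r addr0 subr0.
apply: (@eq_from_nth _ 0); first by rewrite !size_map size_zip sb minnn.
move=> i; rewrite size_map => ia; rewrite (nth_map 0)//.
by rewrite (nth_map (0, 0)) ?size_zip ?sb ?minnn// nth_zip//= bE// invr1 mulr1.
Qed.

Definition mass a v : R := 1 + \sum_(0 <= i < size a) nth 0 v i.

Definition moment a v : R := \sum_(0 <= i < size a) nth 0 v i * nth 0 a i.

Definition norm_scale a := [seq (1 + y ^+ 2)^-1 | y <- a].

Definition norm_map a z : seq R :=
  if z is c :: w then
    let v := mulseq (norm_scale a) w in ((c - moment a v) / mass a v) :: v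
  else [::].

Lemma mass_gt0 a v : size v = size a -> all (fun z => 0 < z) v -> 0 < mass a v.
Proof.
move=> sv vp; rewrite ltr_pwDl// big_nat_ge0// => i ia; apply/ltW/all_nth_gt0 => //.
by rewrite sv.
Qed.

Lemma norm_scale_gt0 a : all (fun z => 0 < z) (norm_scale a).
Proof. by apply/allP => z /mapP[y _ ->]; rewrite invr_gt0 onesqr_gt0. Qed.

Lemma measurable_mass a N : tmeasurable N (mass a : seq R -> TR).
Proof.
by apply: measurable_funD => //; apply: measurable_sum => j; exact: measurable_nth.
Qed.

Lemma measurable_moment a N : tmeasurable N (moment a : seq R -> TR).
Proof.
apply: measurable_sum => j.
exact: (measurable_funM (@measurable_nth R N j) (measurable_cst _)).
Qed.

Lemma size_norm_scale a : size (norm_scale a) = size a. Proof. by rewrite size_map. Qed.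

Lemma size_norm_map a z : size z = (size a).+1 -> size (norm_map a z) = (size a).+1.
Proof. by case: z => //= x t [st]; rewrite size_mulseq ?size_norm_scale ?st. Qed.

Lemma measurable_nth_norm_map a i :
  tmeasurable (size a).+1 (fun z => nth 0 (norm_map a z) i : TR).
Proof.
apply: tmeasurableS; case: i => [|i] /=.
  have h (f : seq R -> TR) : tmeasurable (size a) f ->
      measurable_fun setT (fun z : TR * (size a).-tuple TR => f (mulseq (norm_scale a) z.2)).
    by move=> mf; exact: (tmeasurable_snd (tmeasurable_mulseq (size_norm_scale a) mf)).
  apply: measurable_funM.
    by apply: measurable_funB => //; apply: h; exact: measurable_moment.
  by apply: measurable_fun_inv; apply: h; exact: measurable_mass.
have := @tmeasurable_mulseq R _ _ (size a) (fun s => nth 0 s i : TR) (norm_scale a)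
  (size_norm_scale a) (@measurable_nth R (size a) i).
exact: tmeasurable_snd.
Qed.

Lemma tmeasurable_norm_map d (Y : measurableType d) a (g : seq R -> Y) :
  tmeasurable (size a).+1 g -> tmeasurable (size a).+1 (fun z => g (norm_map a z)).
Proof.
move=> mg; apply: (tmeasurable_comp (M := (size a).+1) (g := g) (Phi := fun x : (size a).+1.-tuple TR => norm_map a x)) => // [t|i _].
  by rewrite size_norm_map// size_tuple.
exact: measurable_nth_norm_map.
Qed.

Lemma ge0_integral_affine (m c : R) (g : TR -> \bar R) : 0 < c ->
  measurable_fun setT g -> (forall x : TR, 0 <= g x)%E ->
  (\int[leb]_x (g ((x - m) / c)%R * (c^-1)%:E) = \int[leb]_x g x)%E.
Proof.
move=> c0 mg g0.
have mF := measurable_affine m c.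
have dF (x : R) : x \in `]-oo, +oo[ -> is_derive x 1 (fun x : R => (x - m) * c^-1) c^-1.
  move=> _.
  have := is_derive_fM (is_derive_fD (is_derive_id x (1 : R)) (is_derive_cst (- m) x (1 : R)))
    (is_derive_cst c^-1 x (1 : R)).
  by rewrite addr0 mul1r mulr0 addr0.
have surj (y : R) : exists2 x : R, x \in `]-oo, +oo[ & (x - m) * c^-1 = y.
  by exists (y * c + m) => //; rewrite addrK mulfK// gt_eqF.
rewrite -(ge0_substitutionT mF (measurable_cst c^-1) dF _ _ surj mg g0)//.
- by apply: eq_integral => x _; rewrite in_itv/= mulr1.
- by move=> x _; exact: cst_continuous.
- by move=> x _; rewrite invr_gt0.
Qed.

(** A diagonal scaling of [w] followed, for fixed [v], by an affine substitution in [c] with slope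
    [1 / A]. The absolute value of the mass matters only outside the orthant, where [apos]
    vanishes. *)
Theorem norm_map_integral a (h : seq R -> \bar R) :
  tmeasurable (size a).+1 h -> (forall t, 0 <= h t)%E ->
  (\int[mu (size a)]_w \int[leb]_c (h (norm_map a (c :: w)) *
     (`|mass a (behead (norm_map a (c :: w)))|^-1 * \prod_(z <- norm_scale a) z)%:E *
     (apos w)%:E) =
   \int[mu (size a)]_v \int[leb]_y (h (y :: v) * (apos v)%:E))%E.
Proof.
move=> mh h0; set s := norm_scale a.
have s0 : 0 < \prod_(z <- s) z.
  by rewrite big_seq prodr_gt0// => z /(allP (norm_scale_gt0 a)).
pose K (v : seq R) := (\int[leb]_y (h (y :: v)) * (apos v)%:E)%E.
have mK : tmeasurable (size a) K.
  apply: emeasurable_funM; first exact: tmeasurable_integral2.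
  by apply/measurable_EFinP; exact: tmeasurable_apos.
have K0 v : (0 <= K v)%E by rewrite mule_ge0 ?integral_ge0// lee_fin apos_ge0.
have mhv (v : (size a).-tuple TR) : measurable_fun setT (fun y : TR => h (y :: v)).
  have := measurableT_comp (tmeasurable_pair mh) (measurable_pair2 v); exact.
rewrite [RHS](_ : _ = \int[mu (size a)]_v K v)%E; last first.
  apply: eq_integral => v _; rewrite /K ge0_integralZr//.
  - by rewrite lee_fin apos_ge0.
rewrite -(ge0_integral_mulseq (size_norm_scale a) (norm_scale_gt0 a) mK K0) -/s.
apply: eq_integral => w _ /=; rewrite -/s.
have ss : size s = size w by rewrite size_norm_scale size_tuple.
have ap : all (fun z => 0 < z) (mulseq s w) = all (fun z => 0 < z) w.
  apply/(all_nthP 0)/(all_nthP 0); rewrite size_mulseq// => H i ik;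
    have := H i ik; rewrite nth_mulseq// pmulr_rgt0//;
    by apply: all_nth_gt0; rewrite ?norm_scale_gt0// ss.
rewrite /K !apos_all ap; case: (boolP (all _ _)) => wp; last first.
  by rewrite mule0 mul0e; apply: integral0_eq => c _; rewrite mule0.
have mv : size (mulseq s w) = size a by rewrite size_mulseq// size_tuple.
have A0 : 0 < mass a (mulseq s w) by apply: mass_gt0 => //; rewrite ap.
have mhm : measurable_fun setT (fun y : TR => h (y :: mulseq s w)).
  have := mhv (Tuple (introT eqP mv)); exact.
rewrite mule1 -(ge0_integral_affine (moment a (mulseq s w)) A0 mhm)//.
rewrite -ge0_integralZr//.
- by apply: eq_integral => c _; rewrite mule1 gtr0_norm// EFinM muleA.
- apply: emeasurable_funM => //; apply: (measurableT_comp mhm).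
  exact: measurable_affine.
- by move=> c _; rewrite mule_ge0// lee_fin invr_ge0 ltW.
- by rewrite lee_fin ltW.
Qed.

Definition row_psi a z := norm_map a (row_map a z).

(** The Jacobian of [row_psi]: the Vandermonde quotient from the partial fractions, [1 / A] from the
    affine step and the product of the scales [1 / (1 + a_i^2)]. *)
Definition row_jac a z : R :=
  (vdm z * (interlace a z)%:R) *
  ((vdm a)^-1 * (`|mass a (behead (row_psi a z))|^-1 * \prod_(y <- norm_scale a) y)).

Lemma row_psi_integral a (h : seq R -> \bar R) : sorted <%R a ->
  tmeasurable (size a).+1 h -> (forall t, 0 <= h t)%E ->
  (\int[mu (size a).+1]_z (h (row_psi a z) * (row_jac a z)%:E) =
   \int[mu (size a).+1]_z (h z * (apos (behead z))%:E))%E.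
Proof.
move=> sa mh h0; have va := vdm_gt0 sa.
have s0 : 0 <= \prod_(z <- norm_scale a) z.
  by rewrite big_seq prodr_ge0// => z /(allP (norm_scale_gt0 a))/ltW.
have mD : tmeasurable (size a).+1 (fun z => `|mass a (behead (norm_map a z))|^-1 : TR).
  apply: measurable_fun_inv; apply: measurableT_comp => //.
  apply: (tmeasurable_norm_map (g := fun z => mass a (behead z) : TR)).
  apply: tmeasurableS => /=.
  exact: (tmeasurable_snd (@measurable_mass a (size a))).
pose g z := (h (norm_map a z) * (`|mass a (behead (norm_map a z))|^-1 *
  \prod_(y <- norm_scale a) y)%:E)%E.
have mg : tmeasurable (size a).+1 g.
  apply: emeasurable_funM; first exact: tmeasurable_norm_map.
  by apply/measurable_EFinP; apply: measurable_funM.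
have g0 t : (0 <= g t)%E by rewrite mule_ge0// lee_fin mulr_ge0// invr_ge0.
transitivity ((vdm a)^-1%:E * \int[mu (size a).+1]_z
    (g (row_map a z) * (vdm z * (interlace a z)%:R)%:E))%E.
  rewrite -ge0_integralZl//.
  - apply: eq_integral => z _; rewrite /g /row_jac -/(row_psi a z).
    rewrite -muleA -EFinM muleCA -EFinM; congr (_ * _%:E)%E; ring.
  - apply: emeasurable_funM; first exact: tmeasurable_row_map.
    apply/measurable_EFinP; apply: measurable_funM; first exact: (@tmeasurable_vdm (size a).+1).
    exact: tmeasurable_interlace.
  - by move=> z _; rewrite mule_ge0// lee_fin interlace_vdm_ge0.
  - by rewrite lee_fin invr_ge0 ltW.
rewrite row_map_integral// muleA -EFinM mulVf ?gt_eqF// mul1e norm_map_integral//.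
rewrite [RHS](ge0_integral_tupleS2 (N := size a) (g := fun z => h z * (apos (behead z))%:E)%E)//.
- by apply: emeasurable_funM => //; apply/measurable_EFinP; exact: tmeasurable_apos_behead.
- by move=> t; rewrite mule_ge0// lee_fin apos_ge0.
Qed.

Lemma measurable_row_jac a : tmeasurable (size a).+1 (row_jac a : seq R -> TR).
Proof.
apply: measurable_funM.
  apply: measurable_funM; first exact: (@tmeasurable_vdm (size a).+1).
  exact: tmeasurable_interlace.
apply: measurable_funM => //; apply: measurable_funM => //.
apply: measurable_fun_inv; apply: measurableT_comp => //.
apply: (tmeasurable_row_map (g := fun z => mass a (behead (norm_map a z)) : TR)).
apply: (tmeasurable_norm_map (g := fun z => mass a (behead z) : TR)).
apply: tmeasurableS => /=.
exact: (tmeasurable_snd (@measurable_mass a (size a))).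
Qed.

Lemma row_jac_ge0 a z : sorted <%R a -> 0 <= row_jac a z.
Proof.
move=> sa; rewrite mulr_ge0 ?interlace_vdm_ge0// !mulr_ge0 ?invr_ge0 ?vdm_ge0//.
by rewrite big_seq prodr_ge0// => y /(allP (norm_scale_gt0 a))/ltW.
Qed.

Lemma size_row_psi a z : size z = (size a).+1 -> size (row_psi a z) = (size a).+1.
Proof. by move=> sz; rewrite size_norm_map// size_row_map. Qed.

Theorem row_has_cint a (f : seq R -> R[i]) u : sorted <%R a -> tcmeas (size a).+1 f ->
  has_cint (mu (size a).+1) (fun z : (size a).+1.-tuple TR => (apos (behead z))%:C * f z) u ->
  has_cint (mu (size a).+1) (fun z : (size a).+1.-tuple TR => (row_jac a z)%:C * f (row_psi a z)) u.
Proof.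
move=> sa mf.
(* [row_psi] as a map between tuples; the length is always right, so the default of [insubd] is
   never reached. *)
pose Phi (z : (size a).+1.-tuple TR) : (size a).+1.-tuple TR :=
  insubd [tuple of nseq (size a).+1 0] (row_psi a z).
have PhiE z : Phi z = row_psi a z :> seq R.
  by rewrite val_insubd size_row_psi ?size_tuple ?eqxx.
have mPhi : measurable_fun setT Phi.
  apply/measurable_fun_tnthP => i.
  rewrite (_ : _ \o _ = (fun z : (size a).+1.-tuple TR => nth 0 (row_psi a z) i)).
    apply: (tmeasurable_row_map (g := fun z => nth 0 (norm_map a z) i : TR)).
    exact: measurable_nth_norm_map.
  by apply/funext => z; rewrite /= (tnth_nth 0) PhiE.
have := @has_cint_transfer _ _ _ _ R (mu (size a).+1) (mu (size a).+1) Phi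
  (fun z => row_jac a z) (fun z => apos (behead z))
  (fun z => row_jac_ge0 z sa) (fun z => apos_ge0 _) mPhi (@measurable_row_jac a) (@tmeasurable_apos_behead (size a)) _
  (fun z => f z) u mf.
move=> H /H; under [X in (_ -> has_cint _ X _) -> _]eq_fun do rewrite PhiE.
apply => g mg g0.
pose g' (z : seq R) := g (insubd [tuple of nseq (size a).+1 0] z).
have gE z : g z = g' z.
  by rewrite /g'; congr g; apply: val_inj; rewrite val_insubd size_tuple eqxx.
have mg' : tmeasurable (size a).+1 g'.
  have gg : (fun z : (size a).+1.-tuple TR => g' z) = g by apply/funext => z; rewrite -gE.
  by rewrite /tmeasurable gg.
have g0' z : (0 <= g' z)%E by exact: g0.
have := @row_psi_integral a g' sa mg' g0'.
under eq_integral do rewrite gE PhiE.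
under [X in _ -> _ = X]eq_integral do rewrite gE.
by apply.
Qed.
End row_transformation.

(** * The integral over one row *)

Section row_integral.
Context (R : realType).
Local Notation TR := (measurableTypeR R).
Local Notation leb := (@lebesgue_measure R).
Local Notation mu := (@tuple_lebesgue R).
Implicit Types (a x v w : seq R) (th : seq R[i]).

(** Logarithms of products of powers with complex exponents. In this form the comparison of the
    integrands before and after the substitution is one additive identity. *)
Definition log_weight th w : R[i] :=
  \sum_(0 <= i < size w) (nth 0 th i - 1) * (ln (nth 0 w i))%:C.

Definition log_cross th a x : R[i] :=
  \sum_(0 <= i < size a) (nth 0 th i - 1) * (\sum_(y <- x) ln `|nth 0 a i - y|)%:C.

Fixpoint log_vdm th a : R[i] :=
  match th, a with
  | t :: th', l :: a' =>
    \sum_(0 <= i < size a') (t + nth 0 th' i - 2) * (ln (nth 0 a' i - l))%:C + log_vdm th' a'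
  | _, _ => 0
  end.

Lemma ln_prod_seq (r : seq R) (F : R -> R) : (forall y, y \in r -> 0 < F y) ->
  ln (\prod_(y <- r) F y) = \sum_(y <- r) ln (F y).
Proof.
elim: r => [|y r IH] F0; first by rewrite !big_nil ln1.
rewrite !big_cons lnM ?posrE ?IH//.
- by move=> z zr; rewrite F0// in_cons zr orbT.
- by rewrite F0// mem_head.
- by rewrite big_seq prodr_gt0// => z zr; rewrite F0// in_cons zr orbT.
Qed.

Lemma sorted_mem_gt (l : R) x y : sorted <%R (l :: x) -> y \in x -> l < y.
Proof. by move=> /(order_path_min lt_trans)/allP h /h. Qed.

Lemma chain_cons_sorted l a x : below l a -> chain a x -> sorted <%R (l :: x).
Proof.
move=> la ch; have := chain_sorted2 ch.
by case: x a la ch => [|y x] [|z a]//= lz /and3P[zy _ _] ->; rewrite (lt_trans lz).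
Qed.

Lemma chain_mem_neq (l : R) x y : sorted <%R (l :: x) -> y \in x -> 0 < y - l.
Proof. by move=> s h; rewrite subr_gt0 (sorted_mem_gt s). Qed.

(** Up to sign, [w_i] is the product of the [a_i - x_p] divided by the product of the [a_i - a_j],
    [j != i]. A pair of poles thus collects the exponents [th_i - 1] and [th_j - 1], whence
    [th_i + th_j - 2] in [log_vdm]. The recursive form of [wts] gives this by induction. *)
Lemma log_weight_wts th a x : size th = size a -> chain a x ->
  log_weight th (wts a x) = log_cross th a x - log_vdm th a.
Proof.
elim: a th x => [|l a IH] [|t th] [|y x]//=.
  by rewrite /log_weight /log_cross !big_geq// subr0.
move=> [sth] /and3P[ly ya ch].
have sa := chain_sorted ch; have sx := chain_size ch.
have la : below l a by case: (a) ya => //= z' s; exact: lt_trans ly.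
rewrite {1}/log_weight /= size_mulseq ?size_map ?size_wts//.
rewrite big_nat_recl//= {1}/log_cross /= big_nat_recl//=.
set S := 1 + _.
have S0 : 0 < S by exact: wts_sum_gt0.
have lS : ln S = \sum_(y' <- x) ln (y' - l) - \sum_(0 <= i < size a) ln (nth 0 a i - l).
  have : ln (\prod_(y' <- x) (y' - l)) = ln (\prod_(z <- a) (z - l)) + ln S.
    rewrite (chain_prod la ch) lnM ?posrE//.
    rewrite big_seq prodr_gt0// => z /(nthP 0)[i ia <-].
    by rewrite subr_gt0 (sorted_below sa).
  rewrite !ln_prod_seq => [-> ||].
  - by rewrite [X in _ = X + _ - _](big_nth 0) addrAC subrr add0r.
  - by move=> z /(nthP 0)[i ia <-]; rewrite subr_gt0 (sorted_below sa).
  - by move=> z; apply: chain_mem_neq; exact: chain_cons_sorted la ch.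
rewrite lnM ?posrE ?subr_gt0// lS big_cons.
have -> : ln `|l - y| = ln (y - l) by rewrite distrC gtr0_norm// subr_gt0.
have -> : \sum_(y' <- x) ln `|l - y'| = \sum_(y' <- x) ln (y' - l).
  rewrite big_seq [RHS]big_seq; apply: eq_bigr => y' yx; congr ln.
  by rewrite distrC gtr0_norm// (chain_mem_neq (chain_cons_sorted la ch)).
have IH' := IH th x sth ch.
have -> : \sum_(0 <= i < size a) (nth 0 th i - 1) *
    (ln (nth 0 (mulseq [seq (z - y) / (z - l) | z <- a] (wts a x)) i))%:C =
  log_weight th (wts a x) + \sum_(0 <= i < size a) (nth 0 th i - 1) *
    (ln (nth 0 a i - y) - ln (nth 0 a i - l))%:C.
  rewrite /log_weight size_wts// -big_split /=; apply: eq_big_nat => i /andP[_ ia].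
  have p1 : 0 < nth 0 a i - y by rewrite subr_gt0 (sorted_below sa).
  have p2 : 0 < nth 0 a i - l by rewrite subr_gt0 (sorted_below sa).
  rewrite nth_mulseq ?size_map ?size_wts// (nth_map 0)//.
  rewrite lnM ?posrE ?divr_gt0 ?wts_gt0// ln_div ?posrE//.
  by rewrite -mulrDr -rmorphD; congr (_ * _%:C); ring.
have -> : \sum_(0 <= i < size a) (nth 0 th i - 1) *
    (\sum_(y0 <- y :: x) ln `|nth 0 a i - y0|)%:C =
  log_cross th a x + \sum_(0 <= i < size a) (nth 0 th i - 1) * (ln (nth 0 a i - y))%:C.
  rewrite /log_cross -big_split /=; apply: eq_big_nat => i /andP[_ ia].
  have p1 : 0 < nth 0 a i - y by rewrite subr_gt0 (sorted_below sa).
  by rewrite big_cons gtr0_norm// -mulrDr -rmorphD; congr (_ * _%:C); exact: addrC.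
rewrite IH'.
have -> : \sum_(0 <= i < size a) (nth 0 th i - 1) * (ln (nth 0 a i - y) - ln (nth 0 a i - l))%:C =
  \sum_(0 <= i < size a) (nth 0 th i - 1) * (ln (nth 0 a i - y))%:C -
  \sum_(0 <= i < size a) (nth 0 th i - 1) * (ln (nth 0 a i - l))%:C.
  by rewrite -sumrB; apply: eq_bigr => i _; rewrite rmorphB mulrBr.
have -> : \sum_(0 <= i < size a) (t + nth 0 th i - 2) * (ln (nth 0 a i - l))%:C =
  (t - 1) * (\sum_(0 <= i < size a) ln (nth 0 a i - l))%:C +
  \sum_(0 <= i < size a) (nth 0 th i - 1) * (ln (nth 0 a i - l))%:C.
  rewrite rmorph_sum mulr_sumr -big_split /=; apply: eq_bigr => i _.
  by rewrite -mulrDl; congr (_ * _); ring.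
rewrite !rmorphD !rmorphN /=; ring.
Qed.

(** The arctangents increase along [z_1 < a_1 < z_2 < ...], so their alternating sum is at least
    that of [z_1] and at most that of the last entry of [z]. This keeps the argument of
    [\prod (1 + i z_p) / \prod (1 + i a_j)] in the principal strip. *)
Lemma interlace_atan_bound a z : interlace a z ->
  `|\sum_(y <- z) atan y - \sum_(y <- a) atan y| < pi / 2.
Proof.
case: z => //= x t /andP[xa ch].
have key y s : below y a -> chain a s ->
    0 <= \sum_(z <- s) atan z - \sum_(z <- a) atan z < pi / 2 - atan y.
  elim: (a) y s => [|l a' IH] y [|z s]//=.
    by rewrite !big_nil subrr lexx subr_gt0 atan_ltpi2.
  move=> yl /and3P[lz za' ch']; have /andP[h1 h2] := IH _ _ za' ch'.
  have h3 : atan y < atan l by exact: lt_atan.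
  have h4 : atan l < atan z by exact: lt_atan.
  rewrite !big_cons; apply/andP; split; lra.
have /andP[h1 h2] := key _ _ xa ch; rewrite big_cons ltr_norml.
have h3 := atan_gtNpi2 x; apply/andP; split; lra.
Qed.

Lemma im_factor (y : R) : 'i%C - y%:C = 'i%C * (1 +i* y) :> R[i].
Proof. by apply: eqc; rewrite ?ReB ?ImB ?ReM ?ImM /=; ring. Qed.

Lemma prod_im_factor (s : seq R) :
  \prod_(y <- s) ('i%C - y%:C) = 'i%C ^+ size s * \prod_(y <- s) (1 +i* y) :> R[i].
Proof.
elim: s => [|y s IH]; first by rewrite !big_nil mulr1.
by rewrite !big_cons IH im_factor exprS /= mulrACA.
Qed.

Lemma i_neq0 : ('i%C : R[i]) != 0.
Proof. by apply/eqP => /(congr1 (@complex.Im R))/= /eqP; rewrite oner_eq0. Qed.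

Lemma nth_row_psi a (x : R) (t : seq R) i : size t = size a -> (i < size a)%N ->
  nth 0 (behead (row_psi a (x :: t))) i =
  (1 + nth 0 a i ^+ 2)^-1 * ((nth 0 a i - x) * nth 0 (wts a t) i).
Proof.
move=> st ia.
have sw : size (mulseq [seq y - x | y <- a] (wts a t)) = size a.
  by rewrite size_mulseq ?size_map size_wts.
rewrite /row_psi /= nth_mulseq ?size_norm_scale ?sw// nth_mulseq ?size_map ?size_wts//.
by rewrite !(nth_map 0).
Qed.

Lemma row_psi_gt0 a z : interlace a z -> all (fun y => 0 < y) (behead (row_psi a z)).
Proof.
case: z => // x t /andP[xa ch]; have sa := chain_sorted ch; have st := chain_size ch.
have sv : size (behead (row_psi a (x :: t))) = size a.
  by rewrite size_behead size_row_psi //= st.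
apply/(all_nthP 0) => i; rewrite sv => ia; rewrite nth_row_psi//.
by rewrite mulr_gt0 ?invr_gt0 ?onesqr_gt0// mulr_gt0 ?wts_gt0// subr_gt0 (sorted_below sa).
Qed.

Lemma size_behead_row_psi a z : interlace a z -> size (behead (row_psi a z)) = size a.
Proof.
case: z => // x t /andP[xa ch].
by rewrite size_behead size_row_psi //= (chain_size ch).
Qed.

Lemma row_psi_prod a z : interlace a z ->
  \prod_(y <- z) (1 +i* y) = \prod_(y <- a) (1 +i* y) *
    ((mass a (behead (row_psi a z)))%:C * (1 +i* head 0 (row_psi a z))) :> R[i].
Proof.
move=> iz; have A0 : 0 < mass a (behead (row_psi a z)).
  by apply: mass_gt0; [exact: size_behead_row_psi|exact: row_psi_gt0].
case: z iz A0 => //= x t /andP[xa ch] A0.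
have sa := chain_sorted ch; have st := chain_size ch.
have ia' i : (i < size a)%N -> 'i%C != (nth 0 a i)%:C :> R[i].
  by move=> ia; apply/eqP => /(congr1 (@complex.Im R))/= /eqP; rewrite oner_eq0.
have := @wts_prod R R[i] (real_complex R) a t 'i%C ch ia'.
rewrite /= !prod_im_factor st -mulrA => /(mulfI (expf_neq0 _ i_neq0)) e.
rewrite big_cons e mulrCA; congr (_ * _).
set v := behead (row_psi a (x :: t)); rewrite -/v in A0.
have vE i : (i < size a)%N -> nth 0 v i = (1 + nth 0 a i ^+ 2)^-1 * ((nth 0 a i - x) * nth 0 (wts a t) i).
  by move=> ia; rewrite /v nth_row_psi.
rewrite -/v.
set A := mass a v; rewrite -/A in A0.
have -> : A%:C * (1 +i* ((x + \sum_(0 <= i < size a) nth 0 (wts a t) i - moment a v) / A)) =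
    A +i* (x + \sum_(0 <= i < size a) nth 0 (wts a t) i - moment a v).
  by apply: eqc; rewrite ?ReMl ?ImMl /= ?mulr1// mulrC divfK// gt_eqF.
rewrite mulrBr mulr1 mulr_sumr.
(* Rationalising [1 / (i - a_j)] produces the denominator [1 + a_j^2], which is the origin of
   [norm_scale]. *)
have term i : (i < size a)%N -> (1 +i* x) * ((nth 0 (wts a t) i)%:C / ('i%C - (nth 0 a i)%:C)) =
    - ((nth 0 v i) +i* (nth 0 (wts a t) i - nth 0 v i * nth 0 a i)) :> R[i].
  move=> ia; have n0 : 1 + nth 0 a i ^+ 2 != 0 by rewrite gt_eqF// onesqr_gt0.
  have d0 : 'i%C - (nth 0 a i)%:C != 0 :> R[i] by rewrite subr_eq0 ia'.
  rewrite mulrA; apply: (mulIf d0); rewrite divfK//.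
  have -> : nth 0 (wts a t) i - nth 0 v i * nth 0 a i =
     nth 0 (wts a t) i * (1 + nth 0 a i * x) * (1 + nth 0 a i ^+ 2)^-1.
    by rewrite vE//; field.
  rewrite vE//; move: (nth 0 a i) (nth 0 (wts a t) i) n0 => l u n0.
  by apply: eqc; rewrite ?ReM ?ImM /= ?ReM ?ImM /= ?ReM ?ImM /=; field.
rewrite (eq_big_nat _ _ (F2 := fun i => - ((nth 0 v i) +i* (nth 0 (wts a t) i - nth 0 v i * nth 0 a i)))); last first.
  by move=> i /andP[_ ia]; exact: term.
rewrite sumrN opprK; apply: eqc.
  rewrite ReD Re_sum /=; by [].
rewrite ImD /=.
have -> : Im (\sum_(0 <= i < size a) (nth 0 v i +i* (nth 0 (wts a t) i - nth 0 v i * nth 0 a i))) =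
  \sum_(0 <= i < size a) (nth 0 (wts a t) i - nth 0 v i * nth 0 a i).
  by apply: (big_morph (@complex.Im R)) => // u1 u2; exact: ImD.
by rewrite sumrB /moment addrA.
Qed.

(** The identity of products lifts to logarithms: once the sum over [a] is moved to the left, both
    sides have imaginary part below [pi / 2] in absolute value, where [cexp] is injective. *)
Lemma row_psi_log a z : interlace a z ->
  \sum_(y <- z) cln1i y = \sum_(y <- a) cln1i y +
    ((ln (mass a (behead (row_psi a z))))%:C + cln1i (head 0 (row_psi a z))).
Proof.
move=> iz; have A0 : 0 < mass a (behead (row_psi a z)).
  by apply: mass_gt0; [exact: size_behead_row_psi|exact: row_psi_gt0].
have ImS (s : seq R) : Im (\sum_(y <- s) cln1i y) = \sum_(y <- s) atan y.
  by apply: (big_morph (@complex.Im R)) => // u1 u2; exact: ImD.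
have pE (s : seq R) : \prod_(y <- s) (1 +i* y) = cexp (\sum_(y <- s) cln1i y) :> R[i].
  by rewrite cexp_sum; apply: eq_bigr => y _; rewrite cexp_cln1i.
have := row_psi_prod iz; rewrite !pE -(cexp_lnC A0) -cexp_cln1i -cexpD => e.
apply/eqP; rewrite addrC -subr_eq; apply/eqP.
rewrite -[LHS]cln_inj_cexp; last first.
  by rewrite ImB !ImS; exact: interlace_atan_bound.
rewrite -[RHS]cln_inj_cexp; last by rewrite ImD /= add0r atan_bound.
by rewrite [cexp (_ - _)]cexpD e cexpN mulrAC mulfV ?mul1r// cexp_neq0.
Qed.

Lemma row_psi_logN a z : interlace a z ->
  \sum_(y <- z) cln1i (- y) = \sum_(y <- a) cln1i (- y) +
    ((ln (mass a (behead (row_psi a z))))%:C + cln1i (- head 0 (row_psi a z))).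
Proof.
move=> /row_psi_log e.
have cj (y : R) : cln1i (- y) = ((cln1i y)^*)%C by rewrite cln1iN.
have cjS (r : seq R) : \sum_(y <- r) cln1i (- y) = ((\sum_(y <- r) cln1i y)^*)%C.
  by rewrite rmorph_sum; apply: eq_bigr => y _.
rewrite !cjS e !rmorphD cj; congr (_ + (_ + _)).
by apply: eqc; rewrite //= ?oppr0.
Qed.

(** The transformed integrand, separated into [y] and [v]. The products of [(1 + i x_p)^-s] and
    [(1 - i x_p)^-t] contribute [A^(-s-t)], and the Jacobian takes over one factor [1 / A], whence
    the exponent [s + t - 1]. *)
Definition row_kernel (s t : R[i]) th z : R[i] :=
  cauchy_kernel s t (head 0 z) * dirichlet_kernel (s + t - 1) th (behead z).

(** The Cauchy value times the Dirichlet value, with [Gamma (s + t - 1)] cancelled between them. *)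
Definition row_value (s t : R[i]) th : R[i] :=
  pi%:C * cexp ((2 - s - t) * (ln 2)%:C) *
  ((\prod_(u <- th) Gamma u) * Gamma (s + t - 1 - \sum_(u <- th) u)) *
  ((Gamma s)^-1 * (Gamma t)^-1).

Lemma apos_dirichlet_kernel s th v : size th = size v ->
  (apos v)%:C * dirichlet_kernel s th v = dirichlet_kernel s th v.
Proof.
move=> sv; rewrite apos_all; case: (boolP (all _ _)) => [_|]; first by rewrite mul1r.
rewrite -has_predC => /(has_nthP 0)[i iv /= vi].
rewrite mul0r /dirichlet_kernel (big_zip_nth 0 0)// (bigD1_seq i) ?iota_uniq ?mem_index_iota//=.
by rewrite /pos (negbTE vi) !mul0r.
Qed.

Lemma dirichlet_kernel_exp s th v : size th = size v -> all (fun y => 0 < y) v ->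
  dirichlet_kernel s th v =
  cexp (log_weight th v - s * (ln (1 + \sum_(y <- v) y))%:C).
Proof.
move=> sv vp; rewrite /dirichlet_kernel cexpD mulNr; congr (_ * _).
rewrite (big_zip_nth 0 0)// /log_weight cexp_sum; apply: eq_big_nat => i /andP[_ iv].
by rewrite /= /pos all_nth_gt0// mul1r.
Qed.

Lemma tcmeas_row_kernel s t th N : size th = N -> tcmeas N.+1 (row_kernel s t th).
Proof.
move=> sth; have mS f : cmeas (fun z : TR * N.-tuple TR => f (z.1 :: z.2)) -> tcmeas N.+1 f.
  by move=> [h1 h2]; split; [exact: (tmeasurableS (f := fun z => Re (f z)))|
    exact: (tmeasurableS (f := fun z => Im (f z)))].
apply: mS => /=; rewrite /row_kernel /=; apply: cmeasM.
  exact: (cmeas_comp (cmeas_cauchy s t) measurable_fst).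
exact: (cmeas_comp (tcmeas_dirichlet_kernel _ sth) measurable_snd).
Qed.

Lemma row_kernel_has_cint s t th : all (fun u => 0 < Re u) th ->
  0 < Re (s + t - 1 - \sum_(u <- th) u) ->
  has_cint (mu (size th).+1) (fun z : (size th).+1.-tuple TR => row_kernel s t th z)
    (row_value s t th).
Proof.
move=> th0 st; set N := size th.
have th0' : 0 <= \sum_(u <- th) Re u.
  by rewrite big_seq sumr_ge0// => u /(allP th0)/ltW.
have st' : \sum_(u <- th) Re u < Re (s + t - 1) by move: st; rewrite ReB Re_sum subr_gt0.
have st1 : 1 < Re s + Re t by move: (le_lt_trans th0' st'); rewrite ReB ReD /=; lra.
have [D hD DE] := @dirichlet_has_cint R N (s + t - 1) th erefl th0 st'.
have mk := tcmeas_row_kernel s t (erefl N).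
apply/(has_cint_tupleS _ mk).
have hC := cauchy_has_cint st1.
have vE : row_value s t th = cauchy_integral s t * D.
  rewrite cauchy_formula// /cauchy_value /row_value -DE; ring.
rewrite vE.
apply: (has_cint_prod (f := fun z : TR * N.-tuple TR => row_kernel s t th (z.1 :: z.2))
  (k := fun y => cauchy_kernel s t y * D)) => //.
- have := tcmeas_row_kernel s t (erefl N) => -[h1 h2]; split.
    exact: (tmeasurable_pair (g := fun z => Re (row_kernel s t th z)) h1).
  exact: (tmeasurable_pair (g := fun z => Im (row_kernel s t th z)) h2).
- rewrite /row_kernel /=.
  have [cD fD _ _] := hD; have [cC fC _ _] := hC.
  under eq_integral => y _.
    under eq_integral => v _ do rewrite Normc.normcM EFinM.
    rewrite ge0_integralZl//; last 3 first.
    - by apply/measurable_EFinP; exact: cmeas_normc.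
    - by move=> v _; rewrite lee_fin normc_ge0.
    - by rewrite lee_fin normc_ge0.
    over.
  rewrite ge0_integralZr//; last 3 first.
  - by apply/measurable_EFinP; exact: cmeas_normc.
  - by move=> y _; rewrite lee_fin normc_ge0.
  - by apply: integral_ge0 => v _; rewrite lee_fin normc_ge0.
  apply: lte_mul_pinfty => //.
    by apply: integral_ge0 => y _; rewrite lee_fin normc_ge0.
  by rewrite ge0_fin_numE// integral_ge0// => y _; rewrite lee_fin normc_ge0.
- by apply: aeW => y; exact: (has_cintZ (cauchy_kernel s t y) hD).
- have := has_cintZ D hC; apply: eq_has_cint => [y|]; exact: mulrC.
Qed.

(** The quotient of the integrands of two consecutive triangles as a function of the new row [z].
    The factors in [a] are included, because with them the integral over [z] does not depend on
    [a]. *)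
Definition row_integrand (s t : R[i]) th a z : R[i] :=
  ((interlace a z)%:R * (vdm z / vdm a))%:C *
  cexp (\sum_(0 <= i < size a) ((s - nth 0 th i) * cln1i (nth 0 a i) +
          (t - nth 0 th i) * cln1i (- nth 0 a i)) +
        (- s * \sum_(y <- z) cln1i y - t * \sum_(y <- z) cln1i (- y)) +
        (log_cross th a z - log_vdm th a)).

Lemma log_weight_row_psi th a z : size th = size a -> interlace a z ->
  log_weight th (behead (row_psi a z)) = log_cross th a z - log_vdm th a -
    \sum_(0 <= i < size a) (nth 0 th i - 1) * (cln1i (nth 0 a i) + cln1i (- nth 0 a i)).
Proof.
move=> sth iz; have sv := size_behead_row_psi iz.
case: z iz sv => // x t' /andP[xa ch] sv.
have sa := chain_sorted ch; have st' := chain_size ch.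
have := log_weight_wts sth ch; rewrite /log_weight /log_cross size_wts// sv => e.
rewrite [LHS](_ : _ = \sum_(0 <= i < size a) (nth 0 th i - 1) * (ln (nth 0 (wts a t') i))%:C +
  \sum_(0 <= i < size a) (nth 0 th i - 1) * (ln (nth 0 a i - x))%:C -
  \sum_(0 <= i < size a) (nth 0 th i - 1) * (cln1i (nth 0 a i) + cln1i (- nth 0 a i))).
  congr (_ - _); rewrite e addrAC; congr (_ - _).
  rewrite -big_split /=; apply: eq_big_nat => i /andP[_ ia].
  have p1 : 0 < nth 0 a i - x by rewrite subr_gt0 (sorted_below sa).
  by rewrite big_cons (gtr0_norm p1) -mulrDr -rmorphD; congr (_ * _%:C); exact: addrC.
rewrite -big_split /= -sumrB; apply: eq_big_nat => i /andP[_ ia].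
have p1 : 0 < nth 0 a i - x by rewrite subr_gt0 (sorted_below sa).
have w0 := wts_gt0 ch ia.
have q0 := onesqr_gt0 (nth 0 a i).
rewrite nth_row_psi// lnM ?posrE ?invr_gt0 ?mulr_gt0// lnM ?posrE// lnV ?posrE//.
have -> : cln1i (nth 0 a i) + cln1i (- nth 0 a i) = (ln (1 + nth 0 a i ^+ 2))%:C.
  by rewrite cln1iN; apply: eqc => /=; field.
rewrite -mulrDr -mulrBr -rmorphD -rmorphB; congr (_ * _%:C); ring.
Qed.

(** On interlacing rows every factor is an exponential, and the claim is a linear identity between
    exponents; elsewhere the indicator makes both sides 0. *)
Lemma row_integrandE s t th a z : size th = size a ->
  (row_jac a z)%:C * row_kernel s t th (row_psi a z) = row_integrand s t th a z.
Proof.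
move=> sth; rewrite /row_jac /row_integrand.
case: (boolP (interlace a z)) => iz; last by rewrite !(mulr0, mul0r).
rewrite mulr1 mul1r.
have vp := row_psi_gt0 iz; have sv := size_behead_row_psi iz.
have A0 := mass_gt0 sv vp.
rewrite (row_psi_log iz) (row_psi_logN iz) /row_kernel dirichlet_kernel_exp ?sv//.
set v := behead _ in vp sv A0 *; set y := head 0 _; set A := mass a v in A0 *.
have -> : 1 + \sum_(u <- v) u = A by rewrite /A /mass (big_nth 0) sv.
have lv := log_weight_row_psi sth iz; rewrite -/v in lv.
rewrite lv.
have iA : (`|A|^-1)%:C = cexp (- (ln A)%:C) :> R[i].
  by rewrite gtr0_norm// -rmorphN cexpR expRN lnK.
have pA : (\prod_(u <- norm_scale a) u)%:C =
    cexp (- \sum_(0 <= i < size a) (cln1i (nth 0 a i) + cln1i (- nth 0 a i))) :> R[i].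
  rewrite -sumrN cexp_sum rmorph_prod big_map (big_nth 0); apply: eq_bigr => i _.
  rewrite cln1iN -[RHS]/(cexp (- _)).
  have -> : cln1i (nth 0 a i) + ((ln (1 + nth 0 a i ^+ 2) / 2) -i* atan (nth 0 a i)) =
    (ln (1 + nth 0 a i ^+ 2))%:C by apply: eqc => /=; field.
  by rewrite -rmorphN cexpR expRN lnK// posrE onesqr_gt0.
transitivity ((vdm z / vdm a)%:C * ((`|A|^-1)%:C * (\prod_(u <- norm_scale a) u)%:C *
  (cauchy_kernel s t y * cexp (log_cross th a z - log_vdm th a -
    \sum_(0 <= i < size a) (nth 0 th i - 1) * (cln1i (nth 0 a i) + cln1i (- nth 0 a i)) -
    (s + t - 1) * (ln A)%:C)))).
  have RM (x y' : R) : (x * y')%:C = x%:C * y'%:C :> R[i] by exact: rmorphM.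
  by rewrite !RM !mulrA.
congr (_ * _); rewrite iA pA /cauchy_kernel -!cexpD; congr cexp.
have -> : \sum_(0 <= i < size a) ((s - nth 0 th i) * cln1i (nth 0 a i) +
     (t - nth 0 th i) * cln1i (- nth 0 a i)) =
  s * (\sum_(u <- a) cln1i u) + t * (\sum_(u <- a) cln1i (- u)) -
  \sum_(0 <= i < size a) (nth 0 th i - 1) * (cln1i (nth 0 a i) + cln1i (- nth 0 a i)) -
  \sum_(0 <= i < size a) (cln1i (nth 0 a i) + cln1i (- nth 0 a i)).
  have sE (F : R -> R[i]) : \sum_(u <- a) F u = \sum_(0 <= i < size a) F (nth 0 a i).
    exact: big_nth.
  rewrite !sE !mulr_sumr -big_split -!sumrB /=; apply: eq_bigr => i _; ring.
ring.
Qed.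

Theorem row_integrand_has_cint s t th a : sorted <%R a -> size th = size a ->
  all (fun u => 0 < Re u) th -> 0 < Re (s + t - 1 - \sum_(u <- th) u) ->
  has_cint (mu (size a).+1) (fun z : (size a).+1.-tuple TR => row_integrand s t th a z)
    (row_value s t th).
Proof.
move=> sa sth th0 st.
have := row_kernel_has_cint th0 st; rewrite sth => h.
have h' : has_cint (mu (size a).+1)
    (fun z : (size a).+1.-tuple TR => (apos (behead z))%:C * row_kernel s t th z)
    (row_value s t th).
  apply: eq_has_cint h => // z; rewrite /row_kernel [RHS]mulrCA apos_dirichlet_kernel//.
  by rewrite size_behead size_tuple.
have := row_has_cint sa (tcmeas_row_kernel s t sth) h'.
by apply: eq_has_cint => // z; exact: row_integrandE.
Qed.
End row_integral.

(** * Integration over triangles *)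

Section row_norm.
Context (R : realType).
Local Notation TR := (measurableTypeR R).
Local Notation mu := (@tuple_lebesgue R).
Implicit Types (a : seq R) (th : seq R[i]) (s t : R[i]).

Lemma has_cint_has_cintN d (T : measurableType d) (m : {measure set T -> \bar R})
    (f : T -> R[i]) v : has_cint m f v -> exists M, has_cintN m f v M.
Proof.
move=> hf; exists (fine (\int[m]_x (normc (f x))%:E)%E); split => //.
have [_ fi _ _] := hf; rewrite fineK// ge0_fin_numE// integral_ge0// => x _.
by rewrite lee_fin normc_ge0.
Qed.

(* The norm does not depend on [a], since the transformation to the kernel absorbs all of [a]. *)
Theorem row_integrand_has_cintN s t th : all (fun u => 0 < Re u) th ->
  0 < Re (s + t - 1 - \sum_(u <- th) u) ->
  exists2 M, 0 <= M & forall a, sorted <%R a -> size a = size th ->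
    has_cintN (mu (size th).+1) (fun z : (size th).+1.-tuple TR => row_integrand s t th a z)
      (row_value s t th) M.
Proof.
move=> th0 st.
have [_ fk _ _] := row_kernel_has_cint th0 st.
have mk := tcmeas_row_kernel s t (erefl (size th)).
pose g (z : seq R) : R[i] := (normc (row_kernel s t th z))%:C.
have mg : tcmeas (size th).+1 g by apply: cmeas_real; exact: cmeas_normc.
have [v hv] : exists v, has_cint (mu (size th).+1)
    (fun z : (size th).+1.-tuple TR => (apos (behead z))%:C * g z) v.
  exists (cintegral (mu (size th).+1) setT (fun z : (size th).+1.-tuple TR => g z)).
  have hg : has_cint (mu (size th).+1) (fun z : (size th).+1.-tuple TR => g z)
      (cintegral (mu (size th).+1) setT (fun z : (size th).+1.-tuple TR => g z)).
    apply: cmeas_has_cint => //; move: fk; congr (_ < _)%E; apply: eq_integral => z _.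
    by rewrite /g normcR ger0_norm// normc_ge0.
  apply: eq_has_cint hg => // z.
  have -> : g z = (normc ((apos (behead z))%:C * row_kernel s t th z))%:C.
    rewrite /g; congr (normc _)%:C; rewrite /row_kernel [RHS]mulrCA apos_dirichlet_kernel//.
    by rewrite size_behead size_tuple.
  rewrite Normc.normcM normcR apos_all.
  by case: (all _ _); rewrite ?normr1 ?normr0 ?mul1r ?mul0r.
exists (Re v) => [|a sa sth].
  have [_ _ e _] := hv; rewrite -lee_fin -e integral_ge0// => z _.
  by rewrite lee_fin ReMl mulr_ge0 ?apos_ge0// normc_ge0.
split.
  by have := row_integrand_has_cint sa (esym sth) th0 st; rewrite sth.
have := row_has_cint sa; rewrite sth => /(_ _ _ mg hv)[_ _ e _]; rewrite -e.
apply: eq_integral => z _; rewrite -row_integrandE// Normc.normcM normcR.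
by rewrite ger0_norm ?row_jac_ge0// ReMl.
Qed.
End row_norm.

(** * Triangles as concatenated rows and the factorisation of the integrand *)

Section triangle.
Context (R : realType).
Local Notation TR := (measurableTypeR R).
Local Notation mu := (@tuple_lebesgue R).
Variables (sigma tau : nat -> R[i]) (theta : nat -> nat -> R[i]).
Implicit Types (l t x a z : seq R) (j k n : nat).

(** [entry] on plain sequences, so that a triangle can be written as a smaller triangle followed by
    its last row. *)
Definition sentry l j k : R := nth 0 l ('C(j, 2) + k.-1)%N.

Definition row l j : seq R := mkseq (fun k => nth 0 l ('C(j, 2) + k)%N) j.

Definition thetas n : seq R[i] := mkseq (fun i => theta n i.+1) n.

Definition tri_powers n l : R[i] :=
  \prod_(1 <= j < n) \prod_(1 <= a < j.+1)
    (cpow (1 +i* sentry l j a) (- sigma j + sigma j.+1 - theta j a) *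
     cpow (1 -i* sentry l j a) (- tau j + tau j.+1 - theta j a)).

Definition tri_last n l : R[i] :=
  \prod_(1 <= p < n.+1)
    (cpow (1 +i* sentry l n p) (- sigma n) * cpow (1 -i* sentry l n p) (- tau n)).

Definition tri_cross n l : R[i] :=
  \prod_(1 <= a < n.+1) \prod_(1 <= p < n.+2)
    cpow (`|sentry l n a - sentry l n.+1 p|%:C) (theta n a - 1).

Definition tri_theta_vdm n l : R[i] :=
  \prod_(1 <= b < n.+1) \prod_(1 <= a < b)
    cpow ((sentry l n b - sentry l n a)%:C) (theta n a + theta n b - 2).

Definition tri_vdm n l : R[i] :=
  \prod_(1 <= q < n.+1) \prod_(1 <= p < q) (sentry l n q - sentry l n p)%:C.

Definition tri_integrand n l : R[i] :=
  tri_powers n l * tri_last n l * (\prod_(1 <= j < n) (tri_cross j l / tri_theta_vdm j l)) *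
  tri_vdm n l.

Lemma rayleigh_integrandE n (l : triangle R n) :
  rayleigh_integrand sigma tau theta l = tri_integrand n l.
Proof. by []. Qed.

Definition strict n l : R :=
  \prod_(1 <= j < n) \prod_(1 <= k < j.+1)
    ((sentry l j.+1 k < sentry l j k) && (sentry l j k < sentry l j.+1 k.+1))%:R.

Definition weak n l : R :=
  \prod_(1 <= j < n) \prod_(1 <= k < j.+1)
    ((sentry l j.+1 k <= sentry l j k) && (sentry l j k <= sentry l j.+1 k.+1))%:R.

Lemma size_row l j : size (row l j) = j. Proof. by rewrite size_mkseq. Qed.

Lemma nth_row l j k : (k < j)%N -> nth 0 (row l j) k = sentry l j k.+1.
Proof. by move=> kj; rewrite nth_mkseq. Qed.

Lemma size_thetas n : size (thetas n) = n. Proof. by rewrite size_mkseq. Qed.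

Lemma nth_thetas n k : (k < n)%N -> nth 0 (thetas n) k = theta n k.+1.
Proof. by move=> kn; rewrite nth_mkseq. Qed.

Lemma tri_number n : 'C(n.+2, 2) = ('C(n.+1, 2) + n.+1)%N.
Proof. by rewrite binS bin1. Qed.

Lemma tri_number_le n m : (n <= m)%N -> ('C(n.+1, 2) <= 'C(m.+1, 2))%N.
Proof. by move=> nm; apply: leq_bin2l. Qed.

Lemma sentry_cat t x n j k : size t = 'C(n.+1, 2) -> (1 <= k <= j)%N -> (j <= n)%N ->
  sentry (t ++ x) j k = sentry t j k.
Proof.
move=> st /andP[k1 kj] jn; rewrite /sentry nth_cat st.
case: j kj jn => [|j] kj jn; first by case: k k1 kj.
rewrite (leq_trans _ (tri_number_le jn))// tri_number ltn_add2l.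
by case: k k1 kj.
Qed.

Lemma sentry_cat_last t x n k : size t = 'C(n.+1, 2) ->
  sentry (t ++ x) n.+1 k = nth 0 x k.-1.
Proof. by move=> st; rewrite /sentry nth_cat st ltnNge leq_addr /= addKn. Qed.

Lemma row_cat t x n : size t = 'C(n.+1, 2) -> row (t ++ x) n = row t n.
Proof.
move=> st; apply: (@eq_from_nth _ 0); rewrite !size_row// => i ni.
by rewrite !nth_row// (sentry_cat _ st)// ltnS ni.
Qed.

Lemma row_cat_last t x n : size t = 'C(n.+1, 2) -> size x = n.+1 -> row (t ++ x) n.+1 = x.
Proof.
move=> st sx; apply: (@eq_from_nth _ 0); rewrite !size_row// => i ni.
by rewrite !nth_row// sentry_cat_last.
Qed.

Lemma strict_cat t x n : size t = 'C(n.+1, 2) -> strict n (t ++ x) = strict n t.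
Proof.
move=> st; apply: eq_big_nat => j /andP[j1 jn]; apply: eq_big_nat => k /andP[k1 kj].
by rewrite !(sentry_cat _ st) //; lia.
Qed.

Lemma tri_integrand_cat t x n : size t = 'C(n.+1, 2) ->
  tri_integrand n (t ++ x) = tri_integrand n t.
Proof.
move=> st; have E j k : (1 <= k <= j)%N -> (j <= n)%N -> sentry (t ++ x) j k = sentry t j k.
  exact: sentry_cat.
rewrite /tri_integrand; apply: f_equal2; [apply: f_equal2; [apply: f_equal2|]|].
- apply: eq_big_nat => j /andP[j1 jn]; apply: eq_big_nat => k /andP[k1 kj].
  by rewrite !E //; lia.
- by apply: eq_big_nat => p /andP[p1 pn]; rewrite !E //; lia.
- apply: eq_big_nat => j /andP[j1 jn]; congr (_ / _).
    apply: eq_big_nat => k /andP[k1 kj]; apply: eq_big_nat => p /andP[p1 pj].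
    by rewrite !E //; lia.
  apply: eq_big_nat => b /andP[b1 bj]; apply: eq_big_nat => k /andP[k1 kb].
  by rewrite !E //; lia.
- apply: eq_big_nat => q /andP[q1 qn]; apply: eq_big_nat => p /andP[p1 pq].
  by rewrite !E //; lia.
Qed.

Lemma triangular_prod (C : comRingType) (f : nat -> nat -> C) n :
  \prod_(0 <= b < n.+1) \prod_(0 <= a < b) f a b =
  (\prod_(0 <= b < n) f 0%N b.+1) * \prod_(0 <= b < n) \prod_(0 <= a < b) f a.+1 b.+1.
Proof.
rewrite big_nat_recl// big_geq// mul1r -big_split /=.
by apply: eq_bigr => b _; rewrite big_nat_recl.
Qed.

Lemma triangular_prod1 (C : comRingType) (f : nat -> nat -> C) n :
  \prod_(1 <= b < n.+1) \prod_(1 <= a < b) f a b =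
  \prod_(0 <= b < n) \prod_(0 <= a < b) f a.+1 b.+1.
Proof. by rewrite big_add1; apply: eq_bigr => b _; rewrite big_add1. Qed.

Lemma vdmE a : vdm a = \prod_(0 <= q < size a) \prod_(0 <= p < q) (nth 0 a q - nth 0 a p).
Proof.
elim: a => [|y a IH]; first by rewrite big_geq.
by rewrite /= triangular_prod IH (big_nth 0).
Qed.

Lemma cexp_log_vdm (th : seq R[i]) a : size th = size a ->
  cexp (log_vdm th a) = \prod_(0 <= q < size a) \prod_(0 <= p < q)
    cexp ((nth 0 th p + nth 0 th q - 2) * (ln (nth 0 a q - nth 0 a p))%:C).
Proof.
elim: a th => [|y a IH] [|u th]//=; first by rewrite big_geq// cexp0.
by move=> [st]; rewrite triangular_prod cexpD IH// cexp_sum.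
Qed.

Lemma cexp_log_cross (th : seq R[i]) a z :
  cexp (log_cross th a z) = \prod_(0 <= i < size a) \prod_(0 <= p < size z)
    cexp ((nth 0 th i - 1) * (ln `|nth 0 a i - nth 0 z p|)%:C).
Proof.
rewrite cexp_sum; apply: eq_bigr => i _; rewrite (big_nth 0) rmorph_sum mulr_sumr.
by rewrite cexp_sum.
Qed.

Lemma interlace_nth a z : size z = (size a).+1 ->
  interlace a z = [forall i : 'I_(size a), (nth 0 z i < nth 0 a i) && (nth 0 a i < nth 0 z i.+1)].
Proof.
case: z => // x t [st] /=.
elim: a x t st => [|l a IH] x [|y t]//= st.
  by symmetry; apply/forallP => -[].
move: st => [st]; rewrite [below y a && _](IH _ _ st); apply/idP/forallP => /=.
  move=> /and3P[xl ly /forallP h] [[|i] ia] /=; first by rewrite xl.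
  exact: (h (Ordinal (ia : (i < size a)%N))).
move=> h; have /andP[-> ->] := h ord0; apply/forallP => i.
exact: (h (lift ord0 i)).
Qed.

Lemma natr_prod_bool (n : nat) (f : nat -> bool) :
  \prod_(0 <= i < n) (f i)%:R = [forall i : 'I_n, f i]%:R :> R.
Proof.
rewrite big_mkord; case: (boolP [forall i, _]) => [/forallP h|/forallPn[i /negbTE fi]].
  by rewrite big1// => i _; rewrite h.
by rewrite (bigD1 i)//= fi mul0r.
Qed.

Lemma strict_row n l : (0 < n)%N ->
  strict n.+1 l = strict n l * (interlace (row l n) (row l n.+1))%:R.
Proof.
move=> n0; rewrite /strict big_nat_recr //; congr (_ * _).
have -> := @interlace_nth (row l n) (row l n.+1); last by rewrite !size_row.
pose f i := (nth 0 (row l n.+1) i < nth 0 (row l n) i) && (nth 0 (row l n) i < nth 0 (row l n.+1) i.+1).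
rewrite -(natr_prod_bool _ f) size_row big_add1 /f.
by apply: eq_big_nat => i /andP[_ ni]; rewrite !nth_row// ltnW.
Qed.

(** It keeps the bases [|a_i - z_p|] away from 0, so that [cpow] is given by the logarithm. *)
Lemma interlace_neq a z i p : interlace a z -> (i < size a)%N -> (p < size z)%N ->
  nth 0 a i != nth 0 z p.
Proof.
case: z => // x t /= /andP[xa ch]; have sa := chain_sorted ch.
case: p => [|p] /= ia pt; first by rewrite gt_eqF// (sorted_below sa).
elim: a t x i p xa ch sa ia pt => [|l a IH] [|y t]//= x i p xl /and3P[ly ya ch] sa ia pt.
have sa' := path_sorted sa.
have yt : sorted <%R (y :: t) := chain_cons_sorted ya ch.
case: i p ia pt => [|i] [|p] ia pt /=.
- by rewrite lt_eqF.
- by rewrite lt_eqF// (lt_trans ly)// (sorted_mem_gt yt)// mem_nth.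
- by rewrite gt_eqF// (sorted_below sa').
- exact: (IH _ y).
Qed.

Lemma cpow_onei (y : R) s : cpow (1 +i* y) s = cexp (s * cln1i y).
Proof. exact: cpow1i. Qed.

Lemma cpow_oneiN (y : R) s : cpow (1 -i* y) s = cexp (s * cln1i (- y)).
Proof. exact: (cpow1i (- y)). Qed.

(** Row [n] has exponent [- sigma_n] as a last row and [- sigma_n + sigma_(n+1) - theta] as an inner
    one; the difference [sigma_(n+1) - theta] is the exponent on [a] in [row_integrand], and
    likewise for [tau]. The Vandermonde product of row [n] is replaced by that of row [n + 1]. *)
Lemma tri_integrand_row n l : (0 < n)%N ->
  (strict n.+1 l)%:C * tri_integrand n.+1 l =
  ((strict n l)%:C * tri_integrand n l) *
  row_integrand (sigma n.+1) (tau n.+1) (thetas n) (row l n) (row l n.+1).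
Proof.
move=> n0; rewrite strict_row// /row_integrand.
set a := row l n; set z := row l n.+1; set th := thetas n.
case: (boolP (interlace a z)) => iz; last by rewrite !(mulr0, mul0r).
rewrite mulr1 mul1r -[RHS]mulrA; congr (_ * _).
have sz : size z = n.+1 by exact: size_row.
have san : size a = n by exact: size_row.
have sth : size th = n by exact: size_thetas.
have sa : sorted <%R a by case: (z) iz => //= x t /andP[_ /chain_sorted].
have szz := interlace_sorted iz.
have vE m : tri_vdm m l = (vdm (row l m))%:C.
  rewrite /tri_vdm triangular_prod1 vdmE size_row rmorph_prod.
  apply: eq_big_nat => q /andP[_ qm]; rewrite rmorph_prod.
  by apply: eq_big_nat => p /andP[_ pq]; rewrite !nth_row// (ltn_trans pq).
have tE : tri_theta_vdm n l = cexp (log_vdm th a).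
  rewrite /tri_theta_vdm triangular_prod1 cexp_log_vdm ?san//.
  apply: eq_big_nat => q /andP[_ qm]; apply: eq_big_nat => p /andP[_ pq].
  have pn := ltn_trans pq qm.
  rewrite !nth_row// !nth_thetas// cpowR// -!nth_row// subr_gt0.
  by rewrite (sorted_ltn_nth lt_trans) ?inE ?san.
have cE : tri_cross n l = cexp (log_cross th a z).
  rewrite cexp_log_cross /tri_cross san sz big_add1; apply: eq_big_nat => i /andP[_ ni].
  rewrite big_add1; apply: eq_big_nat => p /andP[_ pn].
  rewrite nth_thetas// -(nth_row l ni) -(nth_row l pn) cpowR// normr_gt0 subr_eq0.
  by apply: (interlace_neq iz); rewrite ?san ?sz.
have lE m : tri_last m l = cexp (\sum_(y <- row l m) (- sigma m * cln1i y - tau m * cln1i (- y))).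
  rewrite /tri_last [X in cexp X](big_nth 0) size_row cexp_sum big_add1; apply: eq_big_nat => i /andP[_ im].
  by rewrite cpow_onei cpow_oneiN -cexpD nth_row// (mulNr (tau m)).
have pE : tri_powers n.+1 l = tri_powers n l *
    cexp (\sum_(y <- a) (- sigma n * cln1i y - tau n * cln1i (- y))) *
    cexp (\sum_(0 <= i < size a) ((sigma n.+1 - nth 0 th i) * cln1i (nth 0 a i) +
          (tau n.+1 - nth 0 th i) * cln1i (- nth 0 a i))).
  rewrite /tri_powers big_nat_recr//= -mulrA -cexpD; congr (_ * _).
  rewrite big_add1 [X in cexp (X + _)](big_nth 0) -big_split /= cexp_sum san.
  apply: eq_big_nat => i /andP[_ ni].
  rewrite cpow_onei cpow_oneiN -cexpD /th /a (nth_thetas ni) (nth_row _ ni); congr cexp.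
  ring.
have qE : \prod_(1 <= j < n.+1) (tri_cross j l / tri_theta_vdm j l) =
    (\prod_(1 <= j < n) (tri_cross j l / tri_theta_vdm j l)) * (tri_cross n l / tri_theta_vdm n l).
  exact: big_nat_recr.
have eE (A B C D : R[i]) : cexp (A + B + (C - D)) = cexp A * cexp B * (cexp C / cexp D).
  by rewrite (cexpD (A + B)) (cexpD A) (cexpD C) cexpN.
rewrite /tri_integrand pE !lE !vE qE cE tE.
have -> : (vdm z / vdm a)%:C = (vdm z)%:C / (vdm a)%:C :> R[i] by exact: fmorph_div.
have va : (vdm a)%:C != 0 :> R[i].
  by apply/eqP => /complexI /eqP; rewrite gt_eqF// vdm_gt0.
rewrite -/a -/z eE.
have -> : cexp (- sigma n.+1 * (\sum_(y <- z) cln1i y) - tau n.+1 * (\sum_(y <- z) cln1i (- y))) =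
  cexp (\sum_(y <- z) (- sigma n.+1 * cln1i y - tau n.+1 * cln1i (- y))).
  by rewrite sumrB -!mulr_sumr.
have := cexp_neq0 (log_vdm th a).
move: va.
move: (cexp (\sum_(y <- a) _)) (cexp (log_vdm th a)) (cexp (log_cross th a z))
  (cexp (\sum_(0 <= i < size a) _)) (cexp (\sum_(y <- z) _)) (tri_powers n l) ((vdm a)%:C)
  ((vdm z)%:C) (\prod_(1 <= i < n) _).
by move=> X1 X2 X3 X4 X5 X6 X7 X8 X9 n1 n2; field; rewrite n1 n2.
Qed.

Lemma tri_integrand1 (y : R) :
  (strict 1 [:: y])%:C * tri_integrand 1 [:: y] =
  row_integrand (sigma 1) (tau 1) (thetas 0) [::] [:: y].
Proof.
rewrite /strict /tri_integrand /tri_powers /tri_last /tri_vdm /row_integrand.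
rewrite !(big_geq (leqnn 1)) !big_nat1 (big_geq (leqnn 1)) !mul1r !mulr1 /=.
rewrite !big_seq1 big_nil /log_cross [\sum_(0 <= i < _) _]big_geq // subrr addr0 add0r.
by rewrite mulr1 divr1 mul1r cpow_onei cpow_oneiN -cexpD /sentry /= !(mulNr (tau 1)).
Qed.

Lemma measurable_sentry N j k : tmeasurable N (fun l => sentry l j k : TR).
Proof. exact: measurable_nth. Qed.

Lemma tmeasurable_prod2 N n (f : nat -> nat -> seq R -> bool) :
  (forall j k, measurable_fun setT (fun l : N.-tuple TR => f j k l)) ->
  tmeasurable N (fun l => \prod_(1 <= j < n) \prod_(1 <= k < j.+1) (f j k l)%:R : TR).
Proof.
move=> mf; apply: measurable_prod => j _; apply: measurable_prod => k _.
rewrite (_ : (fun _ => _) = (fun l : N.-tuple TR => if f j k l then 1 else 0 : TR)).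
  by apply: measurable_fun_ifT => //; exact: mf.
by apply/funext => l; case: (f j k l).
Qed.

Lemma tmeasurable_strict N n : tmeasurable N (strict n : seq R -> TR).
Proof.
apply: tmeasurable_prod2 => j k; apply: measurable_and;
  by apply: measurable_fun_ltr; exact: measurable_sentry.
Qed.

Lemma tmeasurable_weak N n : tmeasurable N (weak n : seq R -> TR).
Proof.
apply: tmeasurable_prod2 => j k; apply: measurable_and;
  by apply: measurable_fun_ler; exact: measurable_sentry.
Qed.

Lemma tcmeas_tri_integrand N n : tcmeas N (tri_integrand n).
Proof.
have ms j k := @measurable_sentry N j k.
have mi j k : cmeas (fun l : N.-tuple TR => 1 +i* sentry l j k : R[i]).
  by split => //=; exact: ms.
have mn j k : cmeas (fun l : N.-tuple TR => 1 -i* sentry l j k : R[i]).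
  by split => //=; apply: measurableT_comp => //; exact: ms.
apply: cmeasM; [apply: cmeasM; [apply: cmeasM|]|].
- apply: cmeas_prod => j; apply: cmeas_prod => k.
  by apply: cmeasM; apply: cmeas_cpow.
- by apply: cmeas_prod => p; apply: cmeasM; apply: cmeas_cpow.
- apply: cmeas_prod => j; apply: cmeasM.
    apply: cmeas_prod => k; apply: cmeas_prod => p; apply: cmeas_cpow; apply: cmeas_real.
    by apply: measurableT_comp => //; apply: measurable_funB; exact: ms.
  apply: cmeasV; apply: cmeas_prod => b; apply: cmeas_prod => k; apply: cmeas_cpow.
  by apply: cmeas_real; apply: measurable_funB; exact: ms.
- apply: cmeas_prod => q; apply: cmeas_prod => p.
  by apply: cmeas_real; apply: measurable_funB; exact: ms.
Qed.

(** The integrand cut off to strictly interlacing triangles, where all rows are sorted and the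
    logarithms are legitimate. *)
Definition tri_strict n l : R[i] := (strict n l)%:C * tri_integrand n l.

Lemma tcmeas_tri_strict N n : tcmeas N (tri_strict n).
Proof.
by apply: cmeasM; [apply: cmeas_real; exact: tmeasurable_strict|exact: tcmeas_tri_integrand].
Qed.

Lemma row_sorted n l : (0 < n)%N -> strict n l != 0 -> sorted <%R (row l n).
Proof.
case: n => // -[|n] _; first by rewrite /row /mkseq.
rewrite strict_row// => h; apply: (@interlace_sorted _ (row l n.+1)).
by move: h; case: (interlace _ _) => //; rewrite mulr0 eqxx.
Qed.

Definition tri_value n : R[i] :=
  \prod_(1 <= j < n.+1) row_value (sigma j) (tau j) (thetas j.-1).

Lemma all_thetas n : (forall k, (1 <= k <= n)%N -> 0 < Re (theta n k)) ->
  all (fun u => 0 < Re u) (thetas n).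
Proof.
move=> h; apply/(all_nthP 0) => i; rewrite size_thetas => ni; rewrite nth_thetas//.
exact: h.
Qed.

Lemma sum_thetas n : \sum_(u <- thetas n) u = \sum_(1 <= a < n.+1) theta n a.
Proof. by rewrite big_map big_add1 /index_iota subn0. Qed.
End triangle.

(** * Induction over the rows and the assembled constant *)

Section induction.
Context (R : realType).
Local Notation TR := (measurableTypeR R).
Local Notation mu := (@tuple_lebesgue R).
Variables (sigma tau : nat -> R[i]) (theta : nat -> nat -> R[i]).
Implicit Types (j k n : nat).

Lemma tri_strict_cat (t x : seq R) n : (0 < n)%N -> size t = 'C(n.+1, 2) -> size x = n.+1 ->
  tri_strict sigma tau theta n.+1 (t ++ x) = tri_strict sigma tau theta n t *
    row_integrand (sigma n.+1) (tau n.+1) (thetas theta n) (row t n) x.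
Proof.
move=> n0 st sx; rewrite /tri_strict tri_integrand_row//.
by rewrite (strict_cat _ st) (tri_integrand_cat _ _ _ _ st) row_cat// row_cat_last.
Qed.

(** The last row is the inner variable. Its integral and its norm are the constants [ka] and [M], so
    value and norm of the larger triangle are products and Fubini applies. *)
Lemma tri_strict_has_cint n : (0 < n)%N ->
  (forall j k, (1 <= k <= j)%N -> (j <= n.-1)%N -> 0 < Re (theta j k)) ->
  (forall j, (1 <= j <= n)%N ->
     0 < Re (sigma j + tau j - 1 - \sum_(1 <= k < j) theta j.-1 k)) ->
  has_cint (mu 'C(n.+1, 2)) (fun l : 'C(n.+1, 2).-tuple TR => tri_strict sigma tau theta n l)
    (tri_value sigma tau theta n).
Proof.
elim: n => // -[|n] IH _ th0 st0.
  rewrite /tri_value big_nat1 /=.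
  have st1 : 0 < Re (sigma 1 + tau 1 - 1 - \sum_(u <- [::]) u).
    by have := st0 1%N isT; rewrite big_geq// big_nil.
  have h := @row_integrand_has_cint R (sigma 1) (tau 1) [::] [::] isT erefl isT st1.
  apply: eq_has_cint h => // l.
  have -> : (l : seq R) = [:: nth 0 l 0] by case: l => -[|y [|]].
  by rewrite /tri_strict tri_integrand1.
set m := n.+1.
have IH' : has_cint (mu 'C(m.+1, 2))
    (fun l : 'C(m.+1, 2).-tuple TR => tri_strict sigma tau theta m l)
    (tri_value sigma tau theta m).
  apply: IH => // [j k kj jn|j /andP[j1 jn]].
    by apply: th0 => //; rewrite (leq_trans jn)// leq_pred.
  by apply: st0; rewrite j1 ltnW.
have thm : all (fun u => 0 < Re u) (thetas theta m).
  by apply: all_thetas => k km; exact: th0.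
have stm : 0 < Re (sigma m.+1 + tau m.+1 - 1 - \sum_(u <- thetas theta m) u).
  by rewrite sum_thetas; have := st0 m.+1 (leqnn _).
have [M M0 hM] := row_integrand_has_cintN thm stm.
set ka := row_value _ _ _ in hM.
(* The dimension is generalised because the tuple type depends on it: the binomial coefficient
   equals the sum but is not convertible to it. *)
suff h N : N = ('C(m.+1, 2) + m.+1)%N ->
    has_cint (mu N) (fun l : N.-tuple TR => tri_strict sigma tau theta m.+1 l)
      (tri_value sigma tau theta m.+1).
  by apply: h; exact: tri_number.
move=> ->.
have mf := tcmeas_tri_strict sigma tau theta ('C(m.+1, 2) + m.+1) m.+1.
apply/(has_cint_cat _ mf).
have [M' [hI hM']] := has_cint_has_cintN IH'.
have sz : size (thetas theta m) = m by exact: size_thetas.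
have vE : tri_value sigma tau theta m.+1 = tri_value sigma tau theta m * ka.
  by rewrite /tri_value big_nat_recr.
rewrite vE.
have [||||h _] := @has_cintN_prod _ _ _ _ _ (mu 'C(m.+1, 2)) (mu m.+1)
  (fun z => tri_strict sigma tau theta m.+1 (z.1 ++ z.2))
  (fun t : 'C(m.+1, 2).-tuple TR => tri_strict sigma tau theta m t * ka)
  (fun t : 'C(m.+1, 2).-tuple TR => normc (tri_strict sigma tau theta m t) * M)
  (tri_value sigma tau theta m * ka) (M' * M).
- have [h1 h2] := mf; split.
    exact: (measurable_cat (g := fun l => Re (tri_strict sigma tau theta m.+1 l)) h1).
  exact: (measurable_cat (g := fun l => Im (tri_strict sigma tau theta m.+1 l)) h2).
- move=> t /=.
  have fE : (fun x : m.+1.-tuple TR => tri_strict sigma tau theta m.+1 (t ++ x)) =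
      (fun x => tri_strict sigma tau theta m t *
        row_integrand (sigma m.+1) (tau m.+1) (thetas theta m) (row t m) x).
    by apply/funext => x; rewrite tri_strict_cat// size_tuple.
  rewrite fE; have [s0|s0] := eqVneq (strict m t) 0.
    have t0 : tri_strict sigma tau theta m t = 0 by rewrite /tri_strict s0 mul0r.
    rewrite t0 Normc.normc0 !mul0r; under eq_fun do rewrite mul0r.
    exact: has_cintN0.
  have sr : sorted <%R (row t m) by exact: row_sorted s0.
  have := hM _ sr; rewrite size_row sz => /(_ erefl) h.
  exact: has_cintNZ.
- by have := has_cintZ ka hI; apply: eq_has_cint => [t|]; exact: mulrC.
- under eq_integral do rewrite mulrC EFinM.
  rewrite ge0_integralZl_EFin//.
  + by rewrite hM' -EFinM mulrC.
  + by move=> t _; rewrite lee_fin normc_ge0.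
  + by apply/measurable_EFinP; apply: cmeas_normc; exact: tcmeas_tri_strict.
- exact: h.
Qed.

Lemma weak_Rayleigh n (l : triangle R n) : weak n l = (l \in @Rayleigh R n)%:R.
Proof.
have [/set_mem lR|lR] := boolP (l \in _).
  rewrite /weak big_nat_cond big1// => j /andP[/andP[j1 jn] _].
  rewrite big_nat_cond big1// => k /andP[/andP[k1 kj] _].
  by have := lR j k; rewrite /entry /sentry k1 -ltnS kj => -> //; lia.
apply/eqP; apply: contraNT lR; rewrite /weak prodf_seq_neq0 => /allP h.
apply/mem_set => j k /andP[k1 kj] jn.
have jn' : j \in index_iota 1 n by rewrite mem_index_iota; lia.
have := h _ jn'; rewrite prodf_seq_neq0 => /allP /(_ k).
rewrite mem_index_iota k1 ltnS kj /= => /(_ isT).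
by rewrite /entry -/(sentry l j k) -/(sentry l j.+1 k) -/(sentry l j.+1 k.+1); case: andP => // _; rewrite eqxx.
Qed.

Lemma measurable_Rayleigh n : measurable (@Rayleigh R n).
Proof.
have -> : @Rayleigh R n = (fun l : triangle R n => weak n l == 1) @^-1` [set true].
  apply/seteqP; split => l /=; rewrite weak_Rayleigh.
    by move=> lR; rewrite mem_set// eqxx.
  by case: (boolP (l \in _)) => [/set_mem//|_]; rewrite eq_sym oner_eq0.
rewrite -[X in measurable X]setTI.
have mw : measurable_fun setT (fun l : triangle R n => weak n l : TR) by exact: tmeasurable_weak.
have /(_ measurableT [set true]) := measurable_fun_eqr mw (measurable_cst (1 : R)).
exact.
Qed.

(** The two products differ only if entries at distinct positions of the tuple coincide, which
    almost never happens. *)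
Lemma ae_strict_weak n : {ae mu 'C(n.+1, 2), forall l : triangle R n, strict n l = weak n l}.
Proof.
set N := 'C(n.+1, 2).
have : {ae mu N, forall l : N.-tuple TR, forall i j, (i < j < N)%N ->
    nth (0 : R) l i != nth 0 l j}.
  apply: ae_foralln => i; apply: ae_foralln => j.
  have [h|h] := boolP (i < j < N)%N; last by apply: aeW.
  by have := @ae_neq_nth R N i j h; apply: filterS => l dl _.
apply: filterS => l dl; apply: eq_big_nat => j /andP[j1 jn]; apply: eq_big_nat => k /andP[k1 kj].
have e1 : 'C(j.+1, 2) = ('C(j, 2) + j)%N by rewrite binS bin1.
have e2 := tri_number j.
have e3 := tri_number_le jn; rewrite -/N in e3.
have d1 : sentry l j k != sentry l j.+1 k by apply: dl; lia.
have d2 : sentry l j k != sentry l j.+1 k.+1 by apply: dl; rewrite /=; lia.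
by rewrite !lt_neqAle d2 eq_sym d1.
Qed.

(** The row constants are collected factor by factor; the [n] exponents [2 - sigma_j - tau_j] of 2
    add up to the one in the theorem. *)
Lemma tri_valueE n : tri_value sigma tau theta n =
  pi%:C ^+ n * cpow 2 ((2 * n)%:R - \sum_(1 <= j < n.+1) (sigma j + tau j)) *
  (\prod_(1 <= j < n) \prod_(1 <= k < j.+1) Gamma (theta j k)) *
  (\prod_(1 <= j < n.+1)
     (Gamma (sigma j + tau j - 1 - \sum_(1 <= k < j) theta j.-1 k) /
        (Gamma (sigma j) * Gamma (tau j)))).
Proof.
have e2 : cpow 2 ((2 * n)%:R - \sum_(1 <= j < n.+1) (sigma j + tau j)) =
    \prod_(1 <= j < n.+1) cexp ((2 - sigma j - tau j) * (ln 2)%:C).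
  have cp z : cpow (2 : R[i]) z = cexp (z * (ln 2)%:C) by rewrite -(natC R 2) cpowR.
  rewrite cp -cexp_sum -mulr_suml; apply: (congr1 (fun z => cexp (z * (ln 2)%:C))).
  elim: (n) => [|m IH]; first by rewrite muln0 !big_geq// subrr.
  rewrite [RHS]big_nat_recr //= -IH [X in _ - X]big_nat_recr //= mulnS natrD; ring.
have eG : \prod_(1 <= j < n) \prod_(1 <= k < j.+1) Gamma (theta j k) =
    \prod_(1 <= j < n.+1) \prod_(u <- thetas theta j.-1) Gamma u.
  case: n {e2} => [|n]; first by rewrite !big_geq.
  (* The first row comes with an empty list of [theta], so its factor is 1 and the remaining indices
     shift by one. *)
  rewrite [RHS]big_ltn// big_nil mul1r [RHS]big_add1; apply: eq_bigr => j _ /=.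
  by rewrite big_map big_add1 /index_iota subn0.
have ep : pi%:C ^+ n = \prod_(1 <= j < n.+1) pi%:C :> R[i].
  by rewrite prodr_const_nat subn1.
rewrite e2 eG ep -!big_split /=.
rewrite /tri_value; apply: eq_big_nat => -[|j] // _.
rewrite /row_value sum_thetas -[j.+1.-1]/j (invfM (Gamma (sigma j.+1))).
move: (Gamma _) (Gamma _)^-1 (Gamma _)^-1 (cexp _) (\prod_(u <- _) _) => g1 g2 g3 g4 g5.
by ring.
Qed.
End induction.

Theorem mainTheorem2 (R : realType) (n : nat) (sigma tau : nat -> R[i])
    (theta : nat -> nat -> R[i]) :
  (1 <= n)%N ->
  (forall j a : nat, (1 <= a <= j)%N -> (j <= n.-1)%N ->
     0 < complex.Re (theta j a)) ->
  (forall j : nat, (1 <= j <= n)%N ->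
     0 < complex.Re (sigma j + tau j - 1 - \sum_(1 <= a < j) theta j.-1 a)) ->
  abs_convergent (@tuple_lebesgue R 'C(n.+1, 2)) (@Rayleigh R n)
    (rayleigh_integrand sigma tau theta) /\
  cintegral (@tuple_lebesgue R 'C(n.+1, 2)) (@Rayleigh R n)
    (rayleigh_integrand sigma tau theta) =
    pi%:C ^+ n *
    cpow 2 ((2 * n)%:R - \sum_(1 <= j < n.+1) (sigma j + tau j)) *
    (\prod_(1 <= j < n) \prod_(1 <= a < j.+1) Gamma (theta j a)) *
    (\prod_(1 <= j < n.+1)
       (Gamma (sigma j + tau j - 1 - \sum_(1 <= a < j) theta j.-1 a) /
        (Gamma (sigma j) * Gamma (tau j)))).
Proof.
move=> n0 th0 st0; rewrite -tri_valueE.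
apply: has_cint_set; first exact: measurable_Rayleigh.
(* Passing from strict to weak interlacing changes the integrand only on a null set, which also
   contains the points of the domain where some base [|lambda_ja - lambda_(j+1)p|] vanishes. *)
apply: has_cint_ae (tri_strict_has_cint n0 th0 st0).
- have wE (l : triangle R n) : ((l \in @Rayleigh R n)%:R)%:C * rayleigh_integrand sigma tau theta l =
      (weak n l)%:C * tri_integrand sigma tau theta n l by rewrite weak_Rayleigh.
  rewrite (funext wE); apply: cmeasM; last exact: tcmeas_tri_integrand.
  by apply: cmeas_real; exact: tmeasurable_weak.
- have := @ae_strict_weak R n; apply: filterS => l e.
  by rewrite /tri_strict e weak_Rayleigh rayleigh_integrandE.
Qed.
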